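(* Let $d\ge1$ and $1<p<1+\frac4d$. For all $M\in(0,\|Q\|_2)$, there exist $\omega(M)>0$ and a Schwartz radially symmetric solution $Q_M$ on $\mathbb R^d$ of $$\Delta Q_M-\omega(M)Q_M+Q_M^{1+\frac4d}+Q_M^p=0,\qquad \|Q_M\|_2=M.$$
   Context: $\|\cdot\|_2$ is the $L^2(\mathbb R^d)$ norm. $Q\in H^1(\mathbb R^d)$ is the unique positive radial solution of $-\Delta Q+Q-|Q|^{\frac4d}Q=0$. *)

(* Defs.v *)
From HB Require Import structures.
From mathcomp Require Import all_boot all_order all_algebra.
From mathcomp Require Import all_classical all_reals all_analysis.
Set Implicit Arguments.
Unset Strict Implicit.
Unset Printing Implicit Defensive.
Import Order.TTheory GRing.Theory Num.Theory.
Import numFieldNormedType.Exports.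
Local Open Scope classical_set_scope.
Local Open Scope ring_scope.

(* The sigma-algebra on row vectors generated by the coordinates, as the
   library does for n.-tuple; over R it is the Borel sigma-algebra. *)
Section measurable_rV.
Context {d : measure_display} {T : measurableType d} (n : nat).

Let coord : 'I_n -> 'rV[T]_n -> T := fun i x => x ord0 i.

Let rV_set0 : g_sigma_preimage coord set0.
Proof. exact: sigma_algebra0. Qed.

Let rV_setC A : g_sigma_preimage coord A -> g_sigma_preimage coord (~` A).
Proof. exact: sigma_algebraC. Qed.

Let rV_bigcup (F : _^nat) : (forall i, g_sigma_preimage coord (F i)) ->
  g_sigma_preimage coord (\bigcup_i (F i)).
Proof. exact: sigma_algebra_bigcup. Qed.

HB.instance Definition _ := @isMeasurable.Build (measure_tuple_display d)
  'rV[T]_n (g_sigma_preimage coord) rV_set0 rV_setC rV_bigcup.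

Lemma measurable_coord (i : 'I_n) :
  measurable_fun setT (fun x : 'rV[T]_n => x ord0 i).
Proof.
move=> _ Y mY; rewrite setTI; apply: sub_sigma_algebra => /=.
rewrite -bigcup_seq/=; exists i => /=; first by rewrite mem_index_enum.
by exists Y => //; rewrite setTI.
Qed.

End measurable_rV.

Lemma measurable_fun_rV d (T : measurableType d) d' (S : measurableType d') n
    (f : S -> 'rV[T]_n) :
  (forall i, measurable_fun setT (fun s => f s ord0 i)) -> measurable_fun setT f.
Proof.
move=> mf; pose coord i (x : 'rV[T]_n) := x ord0 i.
suff : g_sigma_preimage (fun i => coord i \o f) `<=` measurable.
  by rewrite g_sigma_preimage_comp => + _ A mA; apply; exists A.
apply: smallest_sub; first exact: sigma_algebra_measurable.
rewrite {}/coord; case: n => [|m] in f mf *; first by rewrite big_ord0.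
rewrite -bigcup_mkord_ord; apply: bigcup_sub => i Ii.
by move=> A [B mB <-]; exact: mf.
Qed.

Lemma measurable_box d (T : measurableType d) n (A : 'I_n -> set T) :
  (forall i, measurable (A i)) ->
  measurable [set x : 'rV[T]_n | forall i, A i (x ord0 i)].
Proof.
move=> mA.
rewrite (_ : mkset _ = \bigcap_(i in [set: 'I_n])
    (fun x : 'rV[T]_n => x ord0 i) @^-1` A i); last first.
  by apply/seteqP; split => [x Ax i _|x Ax i]; [exact: Ax|exact: (Ax i)].
apply: fin_bigcap_measurable => // i _.
by rewrite -[X in measurable X]setTI; exact: measurable_coord.
Qed.

Section lebesgue_rV.
Context {R : realType}.

Definition cons_rV n (p : measurableTypeR R * 'rV[R]_n) : 'rV[R]_n.+1 :=
  row_mx (p.1)%:M p.2 : 'rV[R]_(1 + n).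

Lemma cons_rV0 n p : @cons_rV n p ord0 ord0 = p.1.
Proof.
rewrite /cons_rV; have -> : @ord0 n = lshift n (@ord0 0) by exact/val_inj.
apply: (etrans (row_mxEl _ _ _ _)).
by rewrite mxE eqxx mulr1n.
Qed.

Lemma cons_rVS n p i : @cons_rV n p ord0 (lift ord0 i) = p.2 ord0 i.
Proof.
rewrite /cons_rV; have -> : lift ord0 i = rshift 1 i by exact/val_inj.
exact: row_mxEr.
Qed.

Lemma measurable_cons_rV n : measurable_fun setT (@cons_rV n).
Proof.
apply: measurable_fun_rV => i; case: (unliftP ord0 i) => [j|] ->.
- under eq_fun do rewrite cons_rVS.
  exact: (measurableT_comp (measurable_coord j) measurable_snd).
- under eq_fun do rewrite cons_rV0.
  exact: measurable_fst.
Qed.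

Definition uncons_rV n (x : 'rV[R]_n.+1) : measurableTypeR R * 'rV[R]_n :=
  (x ord0 ord0, \row_i x ord0 (lift ord0 i)).

Lemma uncons_rVK n : cancel (@uncons_rV n) (@cons_rV n).
Proof.
move=> x; apply/rowP => i; case: (unliftP ord0 i) => [j|] ->.
- by rewrite cons_rVS mxE.
- by rewrite cons_rV0.
Qed.

Lemma cons_rVK n : cancel (@cons_rV n) (@uncons_rV n).
Proof.
move=> [a x]; rewrite /uncons_rV cons_rV0; congr (_, _).
by apply/rowP => i; rewrite mxE cons_rVS.
Qed.

Lemma measurable_uncons_rV n : measurable_fun setT (@uncons_rV n).
Proof.
apply/measurable_fun_pairP; split; first exact: (measurable_coord ord0).
apply: measurable_fun_rV => i; rewrite /comp/=.
under eq_fun do rewrite mxE; exact: measurable_coord.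
Qed.

Section step.
Variables (n : nat) (mu : {sigma_finite_measure set 'rV[R]_n -> \bar R}).

Definition lebesgue_cons : set 'rV[R]_n.+1 -> \bar R :=
  pushforward ((@lebesgue_measure R) \x mu)%E (@cons_rV n).

Let lebesgue_cons0 : (lebesgue_cons set0 = 0)%E.
Proof. by rewrite /lebesgue_cons /pushforward preimage_set0 measure0. Qed.

Let lebesgue_cons_ge0 A : (0 <= lebesgue_cons A)%E.
Proof. by rewrite /lebesgue_cons /pushforward; exact: measure_ge0. Qed.

Let lebesgue_cons_sigma_additive : semi_sigma_additive lebesgue_cons.
Proof.
move=> F mF tF _; rewrite /lebesgue_cons /pushforward preimage_bigcup.
have mP k : measurable (@cons_rV n @^-1` F k).
  by rewrite -[X in measurable X]setTI; exact: measurable_cons_rV.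
apply: measure_semi_sigma_additive => //; last exact: bigcupT_measurable.
by move=> i j Di Dj [x [xi xj]]; apply: tF => //; exists (cons_rV x).
Qed.

HB.instance Definition _ := isMeasure.Build _ _ _ lebesgue_cons
  lebesgue_cons0 lebesgue_cons_ge0 lebesgue_cons_sigma_additive.

Let lebesgue_cons_sigma_finite : sigma_finite setT lebesgue_cons.
Proof.
have /sigma_finiteP[F [FT ndF Foo]] := sigma_finiteT (@lebesgue_measure R).
have /sigma_finiteP[G [GT ndG Goo]] := sigma_finiteT mu.
exists (fun k => @uncons_rV n @^-1` (F k `*` G k)).
  apply/esym; rewrite -subTset => x _;
  have [k _ Fk] : (\bigcup_k F k) (uncons_rV x).1 by rewrite -FT.
  have [l _ Gl] : (\bigcup_k G k) (uncons_rV x).2 by rewrite -GT.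
  exists (maxn k l) => //; split.
  - by move: Fk; exact/subsetPset/ndF/leq_maxl.
  - by move: Gl; exact/subsetPset/ndG/leq_maxr.
move=> k; have [mF Fk] := Foo k; have [mG Gk] := Goo k; split.
  rewrite -[X in measurable X]setTI; apply: measurable_uncons_rV => //.
  exact: measurableX.
rewrite /lebesgue_cons /pushforward -comp_preimage.
rewrite (_ : _ \o _ = id) ?preimage_id; last exact/funext/cons_rVK.
by rewrite product_measure1E// lte_mul_pinfty// ge0_fin_numE.
Qed.

HB.instance Definition _ := Measure_isSigmaFinite.Build _ _ _ lebesgue_cons
  lebesgue_cons_sigma_finite.

End step.

Fixpoint lebesgue_rV n : {sigma_finite_measure set 'rV[R]_n -> \bar R} :=
  match n with
  | 0 => \d_(0 : 'rV[R]_0)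
  | m.+1 => lebesgue_cons (lebesgue_rV m)
  end.

Lemma lebesgue_rV_box n (A : 'I_n -> set R) : (forall i, measurable (A i)) ->
  lebesgue_rV n [set x | forall i, A i (x ord0 i)] =
  (\prod_(i < n) lebesgue_measure (A i))%E.
Proof.
elim: n => [|n IHn] in A *; move=> mA.
  rewrite big_ord0 /= diracE (_ : _ \in _ = true)//.
  by apply/mem_set => -[].
rewrite big_ord_recl -IHn// -product_measure1E//=; first last.
- exact: (@measurable_box _ _ n (fun i => A (lift ord0 i))).
- exact: mA.
rewrite /lebesgue_cons /pushforward; congr ((_ \x _)%E _); apply/seteqP; split => -[a x] /=.
  move=> Ax; split; first by have := Ax ord0; rewrite cons_rV0.
  by move=> i; have := Ax (lift ord0 i); rewrite cons_rVS.
move=> [Aa Ax] i; case: (unliftP ord0 i) => [j|] ->.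
- by rewrite cons_rVS; exact: Ax.
- by rewrite cons_rV0.
Qed.

End lebesgue_rV.

Section calculus_rV.
Context {R : realType} {d : nat}.
Implicit Types (f g phi u Q : 'rV[R]_d -> R) (x : 'rV[R]_d).

(* The library norm on row vectors is the sup norm. *)
Definition enorm x : R := Num.sqrt (\sum_i x ord0 i ^+ 2).

Definition radial f := forall x y, enorm x = enorm y -> f x = f y.

Definition partial (i : 'I_d) f : 'rV[R]_d -> R :=
  fun x => 'D_(delta_mx ord0 i) f x.

Definition partials (s : seq 'I_d) f : 'rV[R]_d -> R := foldr partial f s.

Definition laplacian f : 'rV[R]_d -> R :=
  fun x => \sum_i partial i (partial i f) x.

Definition smooth f := forall s x, differentiable (partials s f) x.

Definition schwartz f := smooth f /\
  forall (k : nat) (s : seq 'I_d), exists C : R,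
    forall x, enorm x ^+ k * `|partials s f x| <= C.

Definition test_function phi := smooth phi /\
  exists r : R, forall x, r < enorm x -> phi x = 0.

Definition L2norm u : \bar R := 'N[lebesgue_rV d]_2%:E[EFin \o u].

Definition weak_partial (i : 'I_d) u g := forall phi, test_function phi ->
  \int[lebesgue_rV d]_x (u x * partial i phi x) =
  - \int[lebesgue_rV d]_x (g x * phi x).

Definition sobolev_H1 u := u \in Lfun (lebesgue_rV d) 2%:E /\
  forall i, exists2 g, g \in Lfun (lebesgue_rV d) 2%:E & weak_partial i u g.

(* - Delta Q + Q - |Q|^(4/d) Q = 0 in the sense of distributions; for Q in H^1
   the nonlinear term is locally integrable. *)
Definition critical_equation Q := forall phi, test_function phi ->
  \int[lebesgue_rV d]_x
    (Q x * (- laplacian phi x + phi x)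
     - `|Q x| `^ (4 / d%:R) * Q x * phi x) = 0.

Definition positive_radial_solution Q :=
  [/\ sobolev_H1 Q, forall x, 0 < Q x, radial Q & critical_equation Q].

(* Elements of H^1 are classes of functions, so uniqueness is almost
   everywhere. *)
Definition unique_positive_radial_solution Q :=
  positive_radial_solution Q /\
  forall Q', positive_radial_solution Q' -> Q' = Q %[ae lebesgue_rV d].

End calculus_rV.

(* Main.v *)
(* Up to scaling, a positive radial solution is a profile v(|x|) with v(0) = 1 and
   v'' + (d - 1) / r v' - t v + (1 - t) (1 - c) v^p + (1 - t) c v^q = 0, q = 1 + 4/d,
   for some (c, t) in the unit square, and its L^2 norm, which the critical power
   leaves invariant under scaling, becomes a function m(c, t). The profile is a
   ground state if it stays nonnegative together with its energy v'^2 / 2 + F(v);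
   ground states decay exponentially. For t = 1/2 the energy is negative at 0, for
   t = 0 the profile crosses 0 by Pohozaev's identity, and a profile that crosses 0
   has nonnegative energy. A profile is labelled 1 if it crosses 0, otherwise 2 or 3
   according to whether its truncated mass reaches M^2. Sperner's lemma on finer and
   finer grids gives a limit point of the three labels, which is a ground state since
   both crossing 0 and having negative energy somewhere are open and exclude each
   other; its mass is M^2. At c = 0 the mass is 0, and at c = 1 the profile solves the
   critical equation, so that its mass is that of Q by uniqueness; hence 0 < c < 1,
   and rescaling gives the two coefficients 1. *)

Require Import Defs.
From mathcomp Require Import all_boot all_order all_algebra.
From mathcomp Require Import all_classical all_reals all_analysis.
From mathcomp Require Import measurable_realfun ring lra.
Import Order.TTheory GRing.Theory Num.Theory.
Import numFieldNormedType.Exports.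
Local Open Scope classical_set_scope.
Local Open Scope ring_scope.

(** * Calculus on the real line *)

Section calculus.
Context {R : realType}.
Implicit Types (f g h : R -> R) (x a b l m r s t e C : R).

Local Notation D x f l := (is_derive (x : R) (1 : R) (f : R -> R) (l : R)).

(** For given c, nothing in the argument excludes several values of t whose profiles are ground
    states, so there is no curve of ground states along which the mass could be followed from c = 0
    to c = 1. The topological argument in both parameters gets around this, but it needs quantities
    that are continuous on the whole square. Hence the clamped nonlinearity [nlc], Lipschitz and
    bounded, for which every profile exists on the whole line and depends continuously on (c, t);
    and hence a mass truncated by a fixed envelope, to which dominated convergence applies. The
    envelope requires one decay rate for all ground states, that is, a positive lower bound on t,
    which follows by compactness because all profiles with t = 0 cross 0. The normalization v(0) = 1
    with coefficients of sum 1 makes the parameter set compact. At the end the profile is replaced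
    by k v(kap |x|): the choice k^(q-1) = kap^2 ga turns the critical coefficient ga into 1, and
    then k^2 kap^-N = ga^(N/2) in dimension N = n + 1, which is the factor in [mass]. *)

Lemma D_eq x f l m : D x f l -> l = m -> D x f m.
Proof. by move=> + <-. Qed.

Arguments D_eq {x f l m}.

Lemma D_uniq x f l m : D x f l -> D x f m -> l = m.
Proof. by move=> [_ <-] [_ <-]. Qed.

Lemma D_cont x f l : D x f l -> {for x, continuous f}.
Proof.
by move=> [fx _]; apply: differentiable_continuous; exact/derivable1_diffP.
Qed.

Lemma D_cst x a : D x (fun=> a) 0.
Proof. exact: is_derive_cst. Qed.

Lemma D_id x : D x (fun t => t) 1.
Proof. exact: is_derive_id. Qed.

Lemma D_add x f g l m : D x f l -> D x g m -> D x (fun t => f t + g t) (l + m).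
Proof. by move=> ? ?; exact: is_deriveD. Qed.

Lemma D_opp x f l : D x f l -> D x (fun t => - f t) (- l).
Proof. by move=> ?; exact: is_deriveN. Qed.

Lemma D_sub x f g l m : D x f l -> D x g m -> D x (fun t => f t - g t) (l - m).
Proof. by move=> ? ?; exact: is_deriveB. Qed.

Lemma D_mul x f g l m : D x f l -> D x g m ->
  D x (fun t => f t * g t) (l * g x + f x * m).
Proof.
move=> fl gm.
have H : D x (fun t => f t * g t) (f x *: m + g x *: l) by exact: is_deriveM.
by apply: (D_eq H); rewrite addrC /GRing.scale/= mulrC.
Qed.

Lemma D_scale x f l a : D x f l -> D x (fun t => a * f t) (a * l).
Proof. by move=> ?; exact: is_deriveZ. Qed.

Lemma D_comp x f g l m : D (g x) f l -> D x g m -> D x (fun t => f (g t)) (l * m).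
Proof. by move=> ? ?; exact: is_derive1_comp. Qed.

Lemma D_pow x f l n : D x f l -> D x (fun t => f t ^+ n) (n%:R * f x ^+ n.-1 * l).
Proof.
move=> fl; elim: n => [|n IH].
  by rewrite !mul0r; under eq_fun do rewrite expr0; exact: D_cst.
under eq_fun do rewrite exprS; apply: (D_eq (D_mul _ _ _ _ _ fl IH)).
by case: n {IH} => [|n]; rewrite ?mul0r/= -?[n.+2%:R]natr1 ?exprS; ring.
Qed.

Lemma D_inv x f l : f x != 0 -> D x f l -> D x (fun t => (f t)^-1) (- (l / f x ^+ 2)).
Proof.
move=> fx0 fl; apply: (D_eq (is_deriveV fx0 fl)).
by rewrite /GRing.scale/= mulNr mulrC.
Qed.

Lemma D_expR x f l : D x f l -> D x (fun t => expR (f t)) (expR (f x) * l).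
Proof. by move=> fl; exact: (D_comp _ expR). Qed.

Lemma D_powR x f l a : 0 < f x -> D x f l ->
  D x (fun t => f t `^ a) (a * f x `^ (a - 1) * l).
Proof.
move=> fx fl; apply: (D_comp _ (fun t => t `^ a)) => //.
exact: is_derive1_powR.
Qed.

Lemma D_near x f g l a b : a < x < b -> (forall t, a < t < b -> f t = g t) ->
  D x f l -> D x g l.
Proof.
move=> xab fg; apply: near_eq_is_derive.
have : \forall t \near x, t \in `]a, b[ by apply: near_in_itvoo; rewrite in_itv.
by apply: filterS => t; rewrite in_itv/= => /fg.
Qed.

Lemma cont_within f a b : (forall x, a <= x <= b -> {for x, continuous f}) ->
  {within `[a, b], continuous f}.
Proof.
by move=> cf; apply: continuous_in_subspaceT => x; rewrite inE/= in_itv/=; exact: cf.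
Qed.

Lemma D_mvt f df a b : a < b -> (forall x, a <= x <= b -> {for x, continuous f}) ->
  (forall x, a < x < b -> D x f (df x)) ->
  exists2 c : R, a < c < b & f b - f a = df c * (b - a).
Proof.
move=> ab /cont_within cf dfx.
have dfx' x : x \in `]a, b[ -> D x f (df x) by rewrite in_itv/=; exact: dfx.
by have [c] := MVT ab dfx' cf; rewrite in_itv/= => cab E; exists c.
Qed.

Lemma D_le f df a b : a <= b -> (forall x, a <= x <= b -> {for x, continuous f}) ->
  (forall x, a < x < b -> D x f (df x)) -> (forall x, a < x < b -> 0 <= df x) ->
  f a <= f b.
Proof.
rewrite le_eqVlt => /predU1P[->//|ab] cf dfx df0.
have [c cab E] := D_mvt _ _ _ _ ab cf dfx.
by rewrite -subr_ge0 E mulr_ge0 ?df0// subr_ge0 ltW.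
Qed.

Lemma D_ge f df a b : a <= b -> (forall x, a <= x <= b -> {for x, continuous f}) ->
  (forall x, a < x < b -> D x f (df x)) -> (forall x, a < x < b -> df x <= 0) ->
  f b <= f a.
Proof.
move=> ab cf dfx df0; rewrite -lerN2.
apply: (@D_le (fun x => - f x) (fun x => - df x) a b ab) => x xab.
- by apply: continuousN; exact: cf.
- by apply: D_opp; exact: dfx.
- by rewrite oppr_ge0 df0.
Qed.

Lemma D_const f a b : a <= b -> (forall x, a <= x <= b -> {for x, continuous f}) ->
  (forall x, a < x < b -> D x f 0) -> f a = f b.
Proof.
move=> ab cf dfx; apply/eqP; rewrite eq_le.
by rewrite (D_le f (fun=> 0))// (D_ge f (fun=> 0)).
Qed.

Lemma D_norm_le f df g dg a b : a <= b ->
  (forall x, a <= x <= b -> {for x, continuous f}) ->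
  (forall x, a <= x <= b -> {for x, continuous g}) ->
  (forall x, a < x < b -> D x f (df x)) -> (forall x, a < x < b -> D x g (dg x)) ->
  (forall x, a < x < b -> `|df x| <= dg x) ->
  `|f b - f a| <= g b - g a.
Proof.
move=> ab cf cg Df Dg dfg; rewrite ler_norml; apply/andP; split.
- suff : (fun t => f t + g t) a <= (fun t => f t + g t) b by move=> /=; lra.
  apply: (D_le (fun t => f t + g t) (fun x => df x + dg x)) => // x xab.
  + by apply: continuousD; [exact: cf|exact: cg].
  + by apply: D_add; [exact: Df|exact: Dg].
  + by have := dfg _ xab; rewrite ler_norml => /andP[]; lra.
- suff : (fun t => g t - f t) a <= (fun t => g t - f t) b by move=> /=; lra.
  apply: (D_le (fun t => g t - f t) (fun x => dg x - df x)) => // x xab.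
  + by apply: continuousB; [exact: cg|exact: cf].
  + by apply: D_sub; [exact: Dg|exact: Df].
  + by have := dfg _ xab; rewrite ler_norml => /andP[]; lra.
Qed.

Lemma D_ivt f a b l : a <= b -> (forall x, a <= x <= b -> {for x, continuous f}) ->
  f a <= l <= f b \/ f b <= l <= f a -> exists2 c : R, a <= c <= b & f c = l.
Proof.
move=> ab /cont_within cf H; have [] := @IVT _ f a b l ab cf.
  by rewrite ge_min le_max; case: H => /andP[-> ->]; rewrite ?orbT.
by move=> c; rewrite in_itv/= => cab <-; exists c.
Qed.

Lemma cont_eps f x : {for x, continuous f} -> forall e, 0 < e ->
  exists2 dl : R, 0 < dl & forall t, `|t - x| < dl -> `|f t - f x| < e.
Proof.
move=> /cvgrPdist_lt cf e e0; have := cf _ e0.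
move=> /nbhs_ballP[dl /= dl0 H]; exists dl => // t tx.
by rewrite distrC; apply: H; rewrite /ball/= distrC.
Qed.

Lemma eps_cont f x : (forall e, 0 < e ->
  exists2 dl : R, 0 < dl & forall t, `|t - x| < dl -> `|f t - f x| < e) ->
  {for x, continuous f}.
Proof.
move=> H; apply/cvgrPdist_lt => e e0; have [dl dl0 K] := H _ e0.
apply/nbhs_ballP; exists dl => // t; rewrite /ball/= distrC => tx.
by rewrite distrC; exact: K.
Qed.

Lemma cont_pos f x : {for x, continuous f} -> 0 < f x ->
  exists2 dl : R, 0 < dl & forall t, `|t - x| < dl -> 0 < f t.
Proof.
move=> cf fx; have [dl dl0 H] := cont_eps _ _ cf _ fx; exists dl => // t /H.
by rewrite ltr_norml => /andP[]; lra.
Qed.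

Lemma cont_bounded f a b : a <= b -> continuous f ->
  exists2 C : R, 0 < C & forall x : R, a <= x <= b -> `|f x| <= C.
Proof.
move=> ab cf; have cn : {within `[a, b], continuous (fun x => `|f x|)}.
  by apply: continuous_subspaceT => x; apply: continuous_comp; [exact: cf|exact: norm_continuous].
have [c _ H] := EVT_max ab cn; exists (1 + `|f c|).
  by rewrite ltr_wpDr.
by move=> x xab; apply: (le_trans (H x _)); rewrite ?in_itv// lerDr.
Qed.

(** The point is the supremum of the t with f t <= 0: f is nonpositive there because such t
    accumulate at it, and it cannot be negative because f is positive to its right. *)
Lemma last_point f a b : a <= b -> continuous f -> f a <= 0 -> 0 < f b ->
  exists2 c : R, a <= c < b & f c = 0 /\ forall t, c < t <= b -> 0 < f t.
Proof.
move=> ab cf fa fb; pose A := [set t | a <= t <= b /\ f t <= 0].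
have A0 : A a by split=> //; rewrite lexx.
have Aub : has_ubound A by exists b => t [/andP[]].
have Asup : has_sup A by split; [exists a|].
have ac : a <= sup A by exact: (ub_le_sup Aub).
have cb : sup A <= b by apply: sup_le_ub; [exists a|move=> t [/andP[]]].
have pos t : sup A < t <= b -> 0 < f t.
  move=> /andP[ct tb]; rewrite ltNge; apply/negP => ft.
  suff : t <= sup A by rewrite leNgt ct.
  by apply: (ub_le_sup Aub); split=> //; rewrite tb (le_trans ac)// ltW.
have fc : f (sup A) <= 0.
  rewrite leNgt; apply/negP => fc0; have [dl dl0 H] := cont_pos _ _ (cf _) fc0.
  have [t [tab ft] ts] := sup_adherent dl0 Asup.
  have tA : t <= sup A by exact: (ub_le_sup Aub).
  by have := H t; rewrite distrC ger0_norm ?subr_ge0// ltrBlDr -ltrBlDl => /(_ ts); rewrite ltNge ft.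
have cb' : sup A < b.
  by rewrite lt_neqAle cb andbT; apply/eqP => E; move: fc; rewrite E leNgt fb.
exists (sup A); first by rewrite ac.
split => //; apply/eqP; rewrite eq_le fc leNgt; apply/negP => fc0.
have cNf : {for sup A, continuous (fun t => - f t)} by apply: continuousN; exact: cf.
have fN : 0 < - f (sup A) by rewrite oppr_gt0.
have [dl dl0 H] := cont_pos (fun t => - f t) (sup A) cNf fN.
pose t := Order.min b (sup A + dl / 2).
have ct : sup A < t by rewrite lt_min cb' ltrDl divr_gt0.
have := pos t; rewrite ct ge_min lexx => /(_ isT).
have := H t; rewrite gtr0_norm ?subr_gt0// ltrBlDl gt_min.
by rewrite ltrD2l ltr_pdivrMr// ltr_pMr// ltr1n orbT => /(_ isT); lra.
Qed.

(** It is 0 for r <= 0, where the interval is empty or a single point; hence derivatives are taken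
    at r > 0 only, and a primitive needed at 0 is shifted. *)
Definition prim h (r : R) : R := \int[lebesgue_measure]_(t in `[0, r]) h t.

Lemma prim_le0 h r : r <= 0 -> prim h r = 0.
Proof.
rewrite le_eqVlt => /predU1P[->|r0]; rewrite /prim.
- by rewrite set_itv1 Rintegral_set1.
- by rewrite set_itv_ge ?Rintegral_set0// bnd_simp -ltNge.
Qed.

Lemma cont_integrable h a b : continuous h ->
  (@lebesgue_measure R).-integrable `[a, b] (EFin \o h).
Proof.
move=> ch; apply: continuous_compact_integrable; first exact: segment_compact.
exact: continuous_subspaceT.
Qed.

Lemma prim_D h r : continuous h -> 0 < r -> D r (prim h) (h r).
Proof.
move=> ch r0; have [] := @continuous_FTC1_closed _ h 0 r (r + 1) _ _ r0.
- by rewrite ltrDl.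
- exact: cont_integrable.
- exact: ch.
move=> dv E; split; first exact: dv.
by rewrite -derive1E; exact: E.
Qed.

Lemma prim_small h r : continuous h -> 0 <= r ->
  forall C, (forall t, 0 <= t <= r -> `|h t| <= C) -> `|prim h r| <= C * r.
Proof.
move=> ch r0 C hC.
apply: (@le_trans _ _ (\int[lebesgue_measure]_(t in `[0, r]) `|h t|)).
  by apply: le_normr_Rintegral => //; exact: cont_integrable.
apply: (@le_trans _ _ (\int[lebesgue_measure]_(t in `[0, r]) C)).
  apply: le_Rintegral => //.
  - apply: (@cont_integrable (fun t => `|h t|)) => t.
    by apply: continuous_comp; [exact: ch|exact: norm_continuous].
  - by apply: (@cont_integrable (fun=> C)) => t; exact: cst_continuous.
rewrite Rintegral_cst//= lebesgue_measure_itv/= lte_fin.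
case: (ltgtP 0 r) r0 => [r1|//|<-] _; first by rewrite /= oppr0 addr0.
by rewrite /= !mulr0.
Qed.

Lemma prim_cont h : continuous h -> continuous (prim h).
Proof.
move=> ch x; case: (ltgtP x 0) => x0.
- have xx : x - 1 < x < 0 by rewrite x0 andbT ltrBlDr ltrDl.
  have p0 t : x - 1 < t < 0 -> (fun=> 0 : R) t = prim h t.
    by move=> /andP[_ t0]; rewrite prim_le0// ltW.
  exact: D_cont _ _ _ (D_near _ _ _ _ _ _ xx p0 (D_cst x 0)).
- exact: (D_cont _ _ _ (prim_D _ _ ch x0)).
- apply: eps_cont => e e0; rewrite x0.
  have [C C0 hC] := cont_bounded h 0 1 ler01 ch.
  exists (Order.min 1 (e / (2 * C))); first by rewrite lt_min ltr01 divr_gt0// mulr_gt0.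
  move=> t; rewrite subr0 (prim_le0 _ 0)// subr0 lt_min => /andP[t1 te].
  have [t0|t0] := leP t 0; first by rewrite prim_le0// normr0.
  rewrite gtr0_norm// in t1; rewrite gtr0_norm// in te.
  apply: (@le_lt_trans _ _ (C * t)).
    apply: prim_small => //; first exact: ltW.
    by move=> s /andP[s0 st]; apply: hC; rewrite s0 (le_trans st)// ltW.
  move: te; rewrite ltr_pdivlMr ?mulr_gt0//; nra.
Qed.

End calculus.

(** * Continuity rules and geometric convergence *)

Section continuity.
Context {R : realType}.
Implicit Types (f g h : R -> R) (x a b l m r s t e C : R).

Lemma C_cst x a : {for x, continuous (fun=> a)}.
Proof. exact: cst_continuous. Qed.

Lemma C_id x : {for x, continuous (fun t => t)}.
Proof. exact: cvg_id. Qed.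

Lemma C_add x f g : {for x, continuous f} -> {for x, continuous g} ->
  {for x, continuous (fun t => f t + g t)}.
Proof. by move=> ? ?; exact: continuousD. Qed.

Lemma C_sub x f g : {for x, continuous f} -> {for x, continuous g} ->
  {for x, continuous (fun t => f t - g t)}.
Proof. by move=> ? ?; exact: continuousB. Qed.

Lemma C_opp x f : {for x, continuous f} -> {for x, continuous (fun t => - f t)}.
Proof. by move=> ?; exact: continuousN. Qed.

Lemma C_mul x f g : {for x, continuous f} -> {for x, continuous g} ->
  {for x, continuous (fun t => f t * g t)}.
Proof. by move=> ? ?; exact: continuousM. Qed.

Lemma C_pow x f n : {for x, continuous f} -> {for x, continuous (fun t => f t ^+ n)}.
Proof.
move=> cf; elim: n => [|n IH]; first exact: C_cst.
have -> : (fun t => f t ^+ n.+1) = (fun t => f t * f t ^+ n).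
  by apply/funext => t; rewrite exprS.
exact: C_mul.
Qed.

Lemma C_inv x f : f x != 0 -> {for x, continuous f} ->
  {for x, continuous (fun t => (f t)^-1)}.
Proof. by move=> ? ?; exact: continuousV. Qed.

Lemma C_comp x f g : {for g x, continuous f} -> {for x, continuous g} ->
  {for x, continuous (fun t => f (g t))}.
Proof. by move=> ? ?; exact: continuous_comp. Qed.

Lemma C_expR x f : {for x, continuous f} -> {for x, continuous (fun t => expR (f t))}.
Proof. by move=> ?; apply: (C_comp _ expR) => //; exact: continuous_expR. Qed.

Lemma C_near x f g a b : a < x < b -> (forall t, a < t < b -> f t = g t) ->
  {for x, continuous f} -> {for x, continuous g}.
Proof.
move=> xab fg cf; rewrite /prop_for /continuous_at -fg//.
apply: cvg_trans cf; apply: near_eq_cvg.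
have : \forall t \near x, t \in `]a, b[ by apply: near_in_itvoo; rewrite in_itv.
by apply: filterS => t; rewrite in_itv/= => /fg.
Qed.

Lemma lip_cont f L : (forall s t, `|f s - f t| <= L * `|s - t|) -> continuous f.
Proof.
move=> Lf x; apply: eps_cont => e e0; exists (e / (1 + `|L|)).
  by rewrite divr_gt0// ltr_wpDr.
move=> t; rewrite ltr_pdivlMr ?ltr_wpDr// => H; apply: le_lt_trans (Lf _ _) _.
apply: le_lt_trans H; rewrite mulrC ler_wpM2l//.
by apply: (le_trans (ler_norm _)); rewrite lerDr.
Qed.

Lemma half_pow_small (K e : R) : 0 < e -> exists m : nat, K * 2^-1 ^+ m < e.
Proof.
move=> e0; pose m := Num.bound `|K / e|; exists m.
have Km : K / e < m%:R by apply: le_lt_trans (ler_norm _) _; exact: archi_boundP (normr_ge0 _).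
have m2 : m%:R <= 2 ^+ m :> R by rewrite -natrX ler_nat ltnW// ltn_expl.
rewrite exprVn ltr_pdivrMr ?exprn_gt0// mulrC -ltr_pdivrMr//.
exact: lt_le_trans m2.
Qed.

Lemma halves_small (x y K : R) : (forall m : nat, x <= y + K * 2^-1 ^+ m) -> x <= y.
Proof.
move=> H; rewrite leNgt; apply/negP => yx.
have [|m Km] := half_pow_small K (x - y); first by rewrite subr_gt0.
by have := H m; lra.
Qed.

(** The intervals of radius 2 K 2^-m around u m are nested, and the limit is the supremum of their
    left ends. *)
Lemma halves_limit (u : nat -> R) K :
  (forall m : nat, `|u m.+1 - u m| <= K * 2^-1 ^+ m) ->
  exists l, forall m : nat, `|l - u m| <= K * 2 * 2^-1 ^+ m.
Proof.
move=> H; pose A (m : nat) := u m - K * 2 * 2^-1 ^+ m; pose B (m : nat) := u m + K * 2 * 2^-1 ^+ m.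
have K0 : 0 <= K.
  by have := H 0%N; rewrite expr0 mulr1; exact: le_trans (normr_ge0 _).
have AS (m : nat) : A m <= A m.+1.
  by have := H m; rewrite ler_norml => /andP[]; rewrite /A exprS; lra.
have BS (m : nat) : B m.+1 <= B m.
  by have := H m; rewrite ler_norml => /andP[]; rewrite /B exprS; lra.
have Ale (m k : nat) : A m <= A (m + k)%N.
  by elim: k => [|k IH]; rewrite ?addn0// addnS (le_trans IH).
have Ble (m k : nat) : B (m + k)%N <= B m.
  by elim: k => [|k IH]; rewrite ?addn0// addnS (le_trans _ IH).
have AB (m : nat) : A m <= B m.
  have : 0 <= K * 2 * 2^-1 ^+ m by rewrite mulr_ge0 ?exprn_ge0// mulr_ge0.
  by rewrite /A /B; lra.
have AleB (m k : nat) : A m <= B k.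
  apply: (le_trans (Ale m k)); rewrite (le_trans (AB _))// addnC; exact: Ble.
have Au : has_ubound (range A) by exists (B 0%N) => _ [m _ <-].
exists (sup (range A)) => m; rewrite ler_norml; apply/andP; split.
  have : A m <= sup (range A) by apply: ub_le_sup => //; exists m.
  by rewrite /A; lra.
have : sup (range A) <= B m.
  by apply: sup_le_ub; [exists (A 0%N), 0%N|move=> _ [k _ <-]].
by rewrite /B; lra.
Qed.

End continuity.

(** * Weighted averages that invert the radial Laplacian *)

Section average.
Context {R : realType}.
Implicit Types (f g h u w : R -> R) (x a b l m r s t e C : R) (k n : nat).

(** Multiplying v'' + k / r v' + h = 0 by r^k and integrating gives v' = - r [avg k h], so this
    function carries the inverse of the radial Laplacian without its singularity at 0. The value for
    r <= 0 is the limit at 0. *)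
Definition avg k h (r : R) : R :=
  if r <= 0 then h 0 / k.+1%:R else prim (fun t => t ^+ k * h t) r / r ^+ k.+1.

Lemma cont_pow_mul k h : continuous h -> continuous (fun t : R => t ^+ k * h t).
Proof.
move=> ch t; apply: (C_mul t (fun t => t ^+ k) h); last exact: ch.
by apply: C_pow; exact: C_id.
Qed.

Lemma avgE k h r : 0 <= r -> r ^+ k.+1 * avg k h r = prim (fun t => t ^+ k * h t) r.
Proof.
rewrite le_eqVlt => /predU1P[<-|r0].
  by rewrite expr0n/= mul0r prim_le0.
by rewrite /avg leNgt r0/= mulrC divfK// expf_neq0// gt_eqF.
Qed.

Lemma avg_D k h r : continuous h -> 0 < r ->
  is_derive r 1 (fun t => t ^+ k.+1 * avg k h t) (r ^+ k * h r).
Proof.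
move=> ch r0; apply: (D_near _ (prim (fun t => t ^+ k * h t)) _ _ 0 (r + 1)).
- by rewrite r0/= ltrDl ltr01.
- by move=> t /andP[t0 _]; rewrite avgE// ltW.
- exact: prim_D (cont_pow_mul k _ ch) r0.
Qed.

Lemma avg_close k h1 h2 r C : continuous h1 -> continuous h2 -> 0 <= r ->
  (forall t, 0 <= t <= r -> `|h1 t - h2 t| <= C) ->
  `|avg k h1 r - avg k h2 r| <= C.
Proof.
move=> c1 c2; rewrite le_eqVlt => /predU1P[<-|r0] H.
  rewrite /avg lexx -mulrBl normrM [X in _ * X]ger0_norm ?invr_ge0//.
  have := H 0; rewrite lexx => /(_ isT) H0.
  by apply: le_trans _ H0; rewrite ler_piMr// invf_le1 ?ltr0n// ler1n.
have k0 : (0 : R) < k.+1%:R by rewrite ltr0n.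
have rk : 0 < r ^+ k.+1 by rewrite exprn_gt0.
rewrite -(ler_pM2l rk) -[X in X * `|_|](gtr0_norm rk) -normrM mulrBr !avgE ?(ltW r0)//.
pose F t := prim (fun t => t ^+ k * h1 t) t - prim (fun t => t ^+ k * h2 t) t.
pose G t := C / k.+1%:R * t ^+ k.+1.
have : `|F r - F 0| <= G r - G 0.
  apply: (D_norm_le F (fun t => t ^+ k * h1 t - t ^+ k * h2 t) G (fun t => C * t ^+ k)).
  - exact: ltW.
  - by move=> t _; apply: C_sub; apply: prim_cont; exact: cont_pow_mul.
  - by move=> t _; apply: C_mul; [exact: C_cst|apply: C_pow; exact: C_id].
  - move=> t /andP[t0 _].
    by apply: D_sub; apply: (prim_D (fun t => t ^+ k * _ t)) => //; exact: cont_pow_mul.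
  - move=> t _; apply: D_eq (D_scale _ _ _ _ (D_pow _ _ _ _ (D_id _))) _.
    by rewrite mulr1 mulrA divfK// gt_eqF.
  - move=> t /andP[t0 tr]; rewrite /= -[_ - _]/(t ^+ k * h1 t - t ^+ k * h2 t).
    rewrite -mulrBr normrM ger0_norm ?exprn_ge0 ?(ltW t0)//.
    by rewrite mulrC ler_wpM2r ?exprn_ge0 ?(ltW t0)// H// (ltW t0) (ltW tr).
rewrite /F !(prim_le0 _ 0)// !subr0 /G expr0n mulr0 subr0 => /le_trans; apply.
rewrite mulrC ler_wpM2l ?(ltW rk)// ler_pdivrMr// ler_peMr ?ler1n//.
by apply: le_trans (H 0 _); rewrite ?lexx ?(ltW r0).
Qed.

Lemma avg_cst k a r : avg k (fun=> a) r = a / k.+1%:R.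
Proof.
rewrite /avg; case: leP => // r0.
have c : continuous (fun t : R => t ^+ k * a) by apply: cont_pow_mul => ?; exact: C_cst.
pose F t := prim (fun t => t ^+ k * a) t - a / k.+1%:R * t ^+ k.+1.
have : F 0 = F r.
  apply: (D_const F); first exact: ltW.
  - move=> t _; apply: C_sub; first exact: prim_cont.
    by apply: C_mul; [exact: C_cst|apply: C_pow; exact: C_id].
  - move=> t /andP[t0 _].
    apply: D_eq (D_sub _ _ _ _ _ (prim_D _ _ c t0)
      (D_scale _ _ _ (a / k.+1%:R) (D_pow _ _ _ k.+1 (D_id t)))) _.
    by rewrite mulr1 mulrA divfK ?pnatr_eq0// mulrC subrr.
rewrite /F (prim_le0 _ 0)// expr0n mulr0 subrr => /esym/subr0_eq ->.
by rewrite mulfK// expf_neq0// gt_eqF.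
Qed.

Lemma avg_cont k h : continuous h -> continuous (avg k h).
Proof.
move=> ch r; case: (ltgtP r 0) => r0.
- apply: (C_near r (fun=> h 0 / k.+1%:R) _ (r - 1) 0); last exact: C_cst.
  + by rewrite r0 andbT ltrBlDr ltrDl.
  + by move=> t /andP[_ t0]; rewrite /avg ltW.
- apply: (C_near r (fun t => prim (fun t => t ^+ k * h t) t / t ^+ k.+1) _ 0 (r + 1)).
  + by rewrite r0/= ltrDl ltr01.
  + by move=> t /andP[t0 _]; rewrite /avg leNgt t0.
  + apply: C_mul; first by apply: prim_cont; exact: cont_pow_mul.
    by apply: C_inv; [rewrite expf_neq0// gt_eqF|apply: C_pow; exact: C_id].
- rewrite r0; apply: eps_cont => e e0.
  have [dl dl0 H] := cont_eps _ _ (ch 0) _ (divr_gt0 e0 (ltr0n _ 2)).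
  exists dl => // t; rewrite subr0 => tdl.
  have [t0|t0] := leP t 0; first by rewrite /avg t0 lexx subrr normr0.
  (* The value at 0 is the average of the constant h 0 over any interval, so that two averages at
     the same t are compared. *)
  have -> : avg k h 0 = avg k (fun=> h 0) t by rewrite avg_cst /avg lexx.
  apply: (@le_lt_trans _ _ (e / 2)); last by rewrite ltr_pdivrMr// ltr_pMr// ltr1n.
  apply: avg_close => //; [by move=> ?; exact: C_cst|exact: ltW|].
  move=> s /andP[s0 st]; apply/ltW/H; rewrite subr0 ger0_norm//.
  by apply: le_lt_trans tdl; rewrite gtr0_norm.
Qed.

End average.

(** * The radial initial value problem *)

Section radial_ode.
Context {R : realType}.
Implicit Types (f g h u w : R -> R) (x a b l r s t e C K L eta : R) (n m : nat).

(* Fixed points of [step n f] are the solutions of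
   v'' + n / r v' + f v = 0, v 0 = 1, v' 0 = 0, extended by 1 to r < 0. *)
Definition step n f u (r : R) : R := 1 - prim (fun t => t * avg n (f \o u) t) r.

(** The same L serves as Lipschitz constant and as exponent of the weight e^(L r^2); 1 <= L provides
    r^2 <= e^(L r^2). *)
Definition lip L f := 1 <= L /\ forall s t, `|f s - f t| <= L * `|s - t|.

Lemma lip_continuous L f : lip L f -> continuous f.
Proof. by move=> [_]; exact: lip_cont. Qed.

Lemma step_integrand_cont n f u : continuous f -> continuous u ->
  continuous (fun t => t * avg n (f \o u) t).
Proof.
move=> cf cu t; apply: (C_mul t (fun t => t)); first exact: C_id.
by apply: avg_cont => s; apply: (C_comp s f); [exact: cf|exact: cu].
Qed.

Lemma step_cont n f u : continuous f -> continuous u -> continuous (step n f u).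
Proof.
move=> cf cu r; apply: (C_sub r (fun=> 1)); first exact: C_cst.
exact: prim_cont (step_integrand_cont _ _ _ cf cu) r.
Qed.

Lemma step_le0 n f u r : r <= 0 -> step n f u r = 1.
Proof. by move=> r0; rewrite /step prim_le0// subr0. Qed.

Lemma step_D n f u r : continuous f -> continuous u -> 0 < r ->
  is_derive r 1 (step n f u) (- (r * avg n (f \o u) r)).
Proof.
move=> cf cu r0; rewrite -[- _]sub0r.
exact: D_sub _ _ _ _ _ (D_cst r 1) (prim_D _ _ (step_integrand_cont _ _ _ cf cu) r0).
Qed.

Lemma sqr_le_expR L r : 1 <= L -> r ^+ 2 <= expR (L * r ^+ 2).
Proof.
move=> L1; apply: le_trans (expR_ge1Dx _); have := sqr_ge0 r; nra.
Qed.

(* The weight e^(L r^2) turns [step] into a contraction of ratio 1/2. *)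
Lemma step_close n L f g u w K eta : lip L f -> continuous g ->
  continuous u -> continuous w -> 0 <= K -> 0 <= eta ->
  (forall s, `|f s - g s| <= eta) ->
  (forall r, `|u r - w r| <= K * expR (L * r ^+ 2)) ->
  forall r, `|step n f u r - step n g w r| <= (K / 2 + eta) * expR (L * r ^+ 2).
Proof.
move=> Lf cg cu cw K0 eta0 fg uw r; have [L1 lf] := Lf.
have cf := lip_continuous _ _ Lf.
have e0 s : 0 < expR (L * s ^+ 2) by exact: expR_gt0.
have [r0|r0] := leP r 0.
  by rewrite !step_le0// subrr normr0 mulr_ge0 ?(ltW (e0 _))// addr_ge0// divr_ge0.
pose F t := step n f u t - step n g w t.
(* The derivative of [G] is t (L K e^(L t^2) + eta), which by [avg_close] dominates that of [F]: the
   factor t from the radial integration is exactly what the weight produces. *)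
pose G t := K / 2 * expR (L * t ^+ 2) + eta / 2 * t ^+ 2.
have : `|F r - F 0| <= G r - G 0.
  apply: (D_norm_le F (fun t => - (t * avg n (f \o u) t) - - (t * avg n (g \o w) t))
    G (fun t => K / 2 * (expR (L * t ^+ 2) * (L * (2%:R * t ^+ 1 * 1)))
       + eta / 2 * (2%:R * t ^+ 1 * 1))).
  - exact: ltW.
  - by move=> t _; apply: C_sub; exact: step_cont.
  - move=> t _; apply: C_add; apply: C_mul; try exact: C_cst.
      by apply: C_expR; apply: C_mul; [exact: C_cst|apply: C_pow; exact: C_id].
    by apply: C_pow; exact: C_id.
  - by move=> t /andP[t0 _]; apply: D_sub; exact: step_D.
  - move=> t _; apply: D_add; apply: D_scale; last exact: D_pow _ _ _ _ (D_id _).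
    by apply: D_expR; apply: D_scale; exact: D_pow _ _ _ _ (D_id _).
  - move=> t /andP[t0 tr]; rewrite opprK addrC -mulrBr normrM (gtr0_norm t0) distrC.
    have -> : K / 2 * (expR (L * t ^+ 2) * (L * (2%:R * t ^+ 1 * 1)))
      + eta / 2 * (2%:R * t ^+ 1 * 1) = t * (L * (K * expR (L * t ^+ 2)) + eta).
      by rewrite expr1; field.
    rewrite ler_pM2l//; apply: avg_close.
    + by move=> s; apply: (C_comp s f); [exact: cf|exact: cu].
    + by move=> s; apply: (C_comp s g); [exact: cg|exact: cw].
    + exact: ltW.
    + move=> s /andP[s0 st] /=.
      rewrite -[_ - _](subrKA (f (w s))); apply: (le_trans (ler_normD _ _)).
      apply: lerD => //; apply: (le_trans (lf _ _)); rewrite ler_pM2l; last lra.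
      apply: (le_trans (uw _)); rewrite ler_wpM2l// ler_expR ler_pM2l; last lra.
      by rewrite ler_sqr ?nnegrE// (le_trans s0).
have F0 : F 0 = 0 by rewrite /F (step_le0 n f u 0 (lexx 0)) (step_le0 n g w 0 (lexx 0)) subrr.
rewrite F0 subr0 => /le_trans; apply; rewrite /G expr0n/= !mulr0 expR0 addr0.
have : eta * r ^+ 2 <= eta * expR (L * r ^+ 2) by rewrite ler_wpM2l// sqr_le_expR.
have : 0 <= eta * expR (L * r ^+ 2) by rewrite mulr_ge0// ltW.
move: (r ^+ 2) (expR _) => x e; lra.
Qed.

Lemma step_one n L f : lip L f -> forall r,
  `|step n f (fun=> 1) r - 1| <= `|f 1| * expR (L * r ^+ 2).
Proof.
move=> Lf r; have cf := lip_continuous _ _ Lf.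
have L0 : lip L (fun=> 0 : R).
  by case: Lf => L1 _; split=> // s t; rewrite subrr normr0 mulr_ge0//; lra.
have [r0|r0] := leP r 0.
  by rewrite step_le0// subrr normr0 mulr_ge0// ltW// expR_gt0.
have c1 : continuous (fun _ : R => 1 : R) by move=> s; exact: C_cst.
rewrite addrAC subrr sub0r normrN; apply: le_trans (prim_small _ _ _ _ (`|f 1| * r) _) _.
- exact: step_integrand_cont.
- exact: ltW.
- move=> t /andP[t0 tr]; rewrite normrM mulrC (ger0_norm t0); apply: ler_pM => //.
  have -> : f \o (fun=> 1) = fun=> f 1 by [].
  by rewrite avg_cst normrM ler_piMr// ger0_norm ?invr_ge0// invf_le1 ?ltr0n// ler1n.
- by rewrite -mulrA ler_wpM2l// -expr2; case: Lf => ? _; exact: sqr_le_expR.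
Qed.

(** Picard iteration from the constant 1. Successive differences are halved in the weighted norm, so
    the iterates converge uniformly on bounded sets and the limit is continuous. *)
Lemma step_fixpoint n L f : lip L f ->
  exists2 v, continuous v & forall r, v r = step n f v r.
Proof.
move=> Lf; have cf := lip_continuous _ _ Lf; have [L1 _] := Lf.
pose u m := iter m (step n f) (fun=> 1).
have cu m : continuous (u m).
  by elim: m => [|m IH]; [move=> ?; exact: C_cst|exact: step_cont].
pose K := `|f 1|; have K0 : 0 <= K by exact: normr_ge0.
have e0 s : 0 < expR (L * s ^+ 2) by exact: expR_gt0.
have uS m r : `|u m.+1 r - u m r| <= K * 2^-1 ^+ m * expR (L * r ^+ 2).
  elim: m r => [|m IH] r; first by rewrite expr0 mulr1; exact: step_one.
  have -> : K * 2^-1 ^+ m.+1 = K * 2^-1 ^+ m / 2 + 0 by rewrite exprS; field.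
  apply: (step_close n L f f (u m.+1) (u m)) => //.
  + by rewrite mulr_ge0 ?exprn_ge0 ?invr_ge0.
  + by move=> s; rewrite subrr normr0.
have lim r : {l | forall m : nat, `|l - u m r| <= K * expR (L * r ^+ 2) * 2 * 2^-1 ^+ m}.
  apply: cid; apply: (halves_limit (fun m => u m r)) => m.
  by apply: le_trans (uS _ _) _; rewrite mulrAC.
pose v r := projT1 (lim r).
have vu r m : `|v r - u m r| <= K * 2 * 2^-1 ^+ m * expR (L * r ^+ 2).
  apply: (le_trans (projT2 (lim r) m)); rewrite le_eqVlt; apply/orP; left.
  by apply/eqP; ring.
have cv : continuous v.
  move=> r; apply: eps_cont => e e_gt0.
  (* [W] bounds the weight at all points at distance less than 1 from r, so one iterate [u m] is
     within e / 3 of v on that whole neighbourhood. *)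
  pose W := expR (L * (`|r| + 1) ^+ 2).
  have [m Hm] := half_pow_small (K * 2 * W) (e / 3) (divr_gt0 e_gt0 (ltr0n _ 3)).
  have vW t : `|t - r| < 1 -> `|v t - u m t| < e / 3.
    move=> tr; apply: le_lt_trans (vu t m) _; apply: le_lt_trans Hm.
    rewrite [leRHS]mulrAC ler_wpM2l ?mulr_ge0 ?exprn_ge0// ler_expR ler_wpM2l//; first by lra.
    rewrite -[t ^+ 2]real_normK ?num_real// ler_sqr ?nnegrE ?addr_ge0//.
    by rewrite -[t](subrK r) (le_trans (ler_normD _ _))// addrC lerD2l ltW.
  have [dl dl0 H] := cont_eps _ _ (cu m r) _ (divr_gt0 e_gt0 (ltr0n _ 3)).
  exists (Order.min 1 dl); first by rewrite lt_min ltr01.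
  move=> t; rewrite lt_min => /andP[t1 td].
  have := vW t t1; have := H t td.
  have := vW r; rewrite subrr normr0 => /(_ ltr01).
  rewrite !ltr_norml => /andP[? ?] /andP[? ?] /andP[? ?]; apply/andP; split; lra.
exists v => // r; apply/eqP; rewrite -subr_eq0 -normr_le0.
apply: (halves_small _ _ (K * 2 * expR (L * r ^+ 2))) => m.
rewrite add0r; have := vu r m.+1.
have := step_close n L f f v (u m) (K * 2 * 2^-1 ^+ m) 0 Lf cf cv (cu m) _ (lexx _) _ _ r.
rewrite mulr_ge0 ?mulr_ge0 ?exprn_ge0// => /(_ isT) H.
have {}H := H (fun s => _ : `|f s - f s| <= 0).
have ff s : `|f s - f s| <= 0 by rewrite subrr normr0.
have {}H := H ff (vu^~ m); rewrite -[step n f (u m)]/(u m.+1) in H.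
move=> H2; have -> : v r - step n f v r = (v r - u m.+1 r) - (step n f v r - u m.+1 r) by ring.
apply: (le_trans (ler_normB _ _)); apply: (le_trans (lerD H2 H)).
by rewrite exprS le_eqVlt; apply/orP; left; apply/eqP; field.
Qed.

Lemma step_bounded n f u B : continuous f -> continuous u -> (forall s, `|f s| <= B) ->
  forall r, `|step n f u r - 1| <= B * r ^+ 2.
Proof.
move=> cf cu fB r; have [r0|r0] := leP r 0.
  rewrite step_le0// subrr normr0 mulr_ge0 ?sqr_ge0//.
  exact: le_trans (fB 0).
rewrite addrAC subrr sub0r normrN expr2 mulrA; apply: prim_small.
- exact: step_integrand_cont.
- exact: ltW.
- move=> t /andP[t0 tr]; rewrite normrM mulrC (ger0_norm t0); apply: ler_pM => //.
  have {1}-> : avg n (f \o u) t = avg n (f \o u) t - avg n (fun=> 0) t.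
    by rewrite avg_cst mul0r subr0.
  apply: avg_close => //.
  + by move=> s; apply: (C_comp s f); [exact: cf|exact: cu].
  + by move=> s; exact: C_cst.
  + by move=> s _ /=; rewrite subr0.
Qed.

(** Each use of [step_close] turns a bound K into K / 2 + eta, whose fixed point is 2 eta; the
    iteration starts from the crude bound 2 B. This yields the continuous dependence of profiles on
    the parameters. *)
Lemma fixpoint_close n L f g u w B eta : lip L f -> continuous g ->
  continuous u -> continuous w -> (forall s, `|f s| <= B) -> (forall s, `|g s| <= B) ->
  (forall s, `|f s - g s| <= eta) ->
  (forall r, u r = step n f u r) -> (forall r, w r = step n g w r) ->
  forall r, `|u r - w r| <= 2 * eta * expR (L * r ^+ 2).
Proof.
move=> Lf cg cu cw fB gB fg uE wE r; have [L1 _] := Lf.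
have cf := lip_continuous _ _ Lf.
have B0 : 0 <= B by exact: le_trans (fB 0).
have eta0 : 0 <= eta by exact: le_trans (fg 0).
have H m : forall r, `|u r - w r| <= (2 * B * 2^-1 ^+ m + 2 * eta) * expR (L * r ^+ 2).
  elim: m => [|m IH] s.
    rewrite uE wE; move: (step_bounded n f u B cf cu fB s) (step_bounded n g w B cg cw gB s).
    move: (step n f u s) (step n g w s) => a b.
    have h1 : B * s ^+ 2 <= B * expR (L * s ^+ 2) by rewrite ler_wpM2l// sqr_le_expR.
    have h2 : 0 <= eta * expR (L * s ^+ 2) by rewrite mulr_ge0// expR_ge0.
    rewrite expr0 mulr1 mulrDl -!mulrA !ler_norml => /andP[? ?] /andP[? ?].
    by apply/andP; split; lra.
  rewrite uE wE.
  apply: le_trans (step_close n L f g u w _ eta Lf cg cu cw _ eta0 fg IH s) _.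
    by rewrite addr_ge0 ?mulr_ge0 ?exprn_ge0.
  by rewrite ler_wpM2r ?expR_ge0// exprS; lra.
apply: (halves_small _ _ (2 * B * expR (L * r ^+ 2))) => m.
by apply: le_trans (H m r) _; lra.
Qed.

End radial_ode.

(** * The clamped nonlinearity and its potential *)

Section nonlinearity.
Context {R : realType}.
Implicit Types (f g h u w : R -> R) (x a b l r s t e C K L p q al be ga : R).

Definition clamp (s : R) : R := if s <= 0 then 0 else if 1 <= s then 1 else s.

Definition nl p q al be ga (s : R) : R := - (al * s) + be * s `^ p + ga * s `^ q.

(** Constant continuation outside [0, 1] makes the nonlinearity Lipschitz and bounded. Ground states
    take values in (0, 1] and do not notice it, while below 0 the force vanishes, so that a profile
    which has crossed 0 moves freely. *)
Definition nlc p q al be ga (s : R) : R := nl p q al be ga (clamp s).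

Lemma clamp01 s : 0 <= clamp s <= 1.
Proof.
rewrite /clamp; case: (leP s 0) => ?; [|case: (leP 1 s) => ?]; apply/andP; split; lra.
Qed.

Lemma clamp_id s : 0 <= s <= 1 -> clamp s = s.
Proof.
by move=> /andP[s0 s1]; rewrite /clamp; case: (leP s 0) => ?; [|case: leP => ?]; lra.
Qed.

Lemma clamp_lip s t : `|clamp s - clamp t| <= `|s - t|.
Proof.
have H a b : a <= b -> 0 <= clamp b - clamp a <= b - a.
  rewrite /clamp => ab; case: (leP a 0) => ?; case: (leP b 0) => ?;
    case: (leP 1 a) => ?; case: (leP 1 b) => ?; apply/andP; split; lra.
by case: (leP s t) => [|/ltW] st; have /andP[h1 h2] := H _ _ st;
  [rewrite distrC [leRHS]distrC|]; rewrite !ger0_norm//; lra.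
Qed.

Lemma powR_le1 s a : 0 <= s <= 1 -> 0 <= a -> s `^ a <= 1.
Proof.
move=> /andP[s0 s1] a0; have <- : 1 `^ a = 1 :> R by rewrite powR1.
by apply: ge0_ler_powR => //; rewrite nnegrE.
Qed.

Lemma powR_le_id s a : 0 <= s <= 1 -> 1 <= a -> s `^ a <= s.
Proof.
move=> /andP[]; rewrite le_eqVlt => /predU1P[<-|s0] s1 a1.
  by rewrite powR0// gt_eqF//; lra.
by apply: ge1r_powR => //; rewrite s0.
Qed.

Lemma powR_lip s t a : 0 <= s <= 1 -> 0 <= t <= 1 -> 1 <= a ->
  `|s `^ a - t `^ a| <= a * `|s - t|.
Proof.
move=> s01 t01 a1; wlog st : s t s01 t01 / t < s.
  move=> H; case: (ltgtP s t) => [ts|st|->]; last 2 first.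
  - exact: H.
  - by rewrite !subrr normr0 mulr0.
  by rewrite distrC [X in _ * X]distrC; exact: H.
move: t01 => /andP[]; rewrite le_eqVlt => /predU1P[<-|t0] t1.
  rewrite powR0 ?gt_eqF//; last lra.
  rewrite !subr0 ger0_norm ?powR_ge0// ger0_norm; last lra.
  by apply: le_trans (powR_le_id _ _ s01 a1) _; rewrite ler_peMl//; lra.
have cx x : t <= x <= s -> {for x, continuous (fun x => x `^ a)}.
  by move=> /andP[tx _]; apply: D_cont (D_powR _ _ _ _ _ (D_id _)); lra.
have dx x : t < x < s -> is_derive x 1 (fun x => x `^ a) (a * x `^ (a - 1) * 1).
  by move=> /andP[tx _]; apply: (D_powR _ _ _ _ _ (D_id _)); lra.
have [c /andP[c0 ct] ->] := D_mvt _ _ _ _ st cx dx.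
have c1 : c `^ (a - 1) <= 1 by apply: powR_le1; lra.
rewrite mulr1 !normrM (ger0_norm (powR_ge0 _ _)) ger0_norm; last lra.
by rewrite ler_wpM2r// ler_piMr//; lra.
Qed.

Lemma nl0 p q al be ga : 0 < p -> 0 < q -> nl p q al be ga 0 = 0.
Proof. by move=> p0 q0; rewrite /nl !powR0 ?gt_eqF// !mulr0 oppr0 !addr0. Qed.

Lemma nlc_le0 p q al be ga s : 0 < p -> 0 < q -> s <= 0 -> nlc p q al be ga s = 0.
Proof. by move=> p0 q0 s0; rewrite /nlc /clamp s0 nl0. Qed.

Lemma nlcE p q al be ga s : 0 <= s <= 1 -> nlc p q al be ga s = nl p q al be ga s.
Proof. by move=> s01; rewrite /nlc clamp_id. Qed.

Lemma nlc_ge1 p q al be ga s : 1 <= s -> nlc p q al be ga s = nl p q al be ga 1.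
Proof. by move=> s1; rewrite /nlc /clamp s1; case: ltP => //; lra. Qed.

Lemma nlc_lip p q al be ga : 1 < p -> 1 < q -> 0 <= al <= 1 -> 0 <= be <= 1 ->
  0 <= ga <= 1 -> lip (1 + p + q) (nlc p q al be ga).
Proof.
move=> p1 q1 /andP[a0 a1] /andP[b0 b1] /andP[g0 g1]; split; first lra.
move=> s t; apply: (@le_trans _ _ ((1 + p + q) * `|clamp s - clamp t|)); last first.
  by rewrite ler_wpM2l ?clamp_lip//; lra.
rewrite /nlc /nl; have cs := clamp01 s; have ct := clamp01 t.
move: (clamp s) (clamp t) cs ct => {}s {}t cs ct.
have := powR_lip s t p cs ct (ltW p1); have := powR_lip s t q cs ct (ltW q1).
have -> : - (al * s) + be * s `^ p + ga * s `^ q - (- (al * t) + be * t `^ p + ga * t `^ q)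
  = - al * (s - t) + be * (s `^ p - t `^ p) + ga * (s `^ q - t `^ q) by ring.
move: (s `^ p - t `^ p) (s `^ q - t `^ q) (s - t) => P Q S HQ HP.
apply: (le_trans (ler_normD _ _)); apply: (le_trans (lerD (ler_normD _ _) (lexx _))).
rewrite !normrM normrN (ger0_norm a0) (ger0_norm b0) (ger0_norm g0).
move: (normr_ge0 P) (normr_ge0 Q) (normr_ge0 S) HQ HP.
move: `|P| `|Q| `|S| => x y z x0 y0 z0 HQ HP.
have h1 : al * z <= z by rewrite ler_piMl.
have h2 : be * x <= x by rewrite ler_piMl.
have h3 : ga * y <= y by rewrite ler_piMl.
lra.
Qed.

Lemma nlc_bounded p q al be ga s : 1 < p -> 1 < q -> 0 <= al <= 1 -> 0 <= be <= 1 ->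
  0 <= ga <= 1 -> `|nlc p q al be ga s| <= 1 + p + q.
Proof.
move=> p1 q1 a01 b01 g01; have [L1 H] := nlc_lip _ _ _ _ _ p1 q1 a01 b01 g01.
rewrite /nlc -(clamp_id (clamp s)) ?clamp01//.
have := H (clamp s) 0; rewrite (nlc_le0 _ _ _ _ _ 0)// ?subr0; [|lra|lra].
rewrite /nlc => /le_trans; apply; rewrite ler_piMr//; first lra.
by have /andP[? ?] := clamp01 s; rewrite ger0_norm.
Qed.

Lemma nlc_close p q al be ga al' be' ga' s : 1 < p -> 1 < q ->
  `|nlc p q al be ga s - nlc p q al' be' ga' s| <=
  `|al - al'| + `|be - be'| + `|ga - ga'|.
Proof.
move=> p1 q1; rewrite /nlc /nl; have := clamp01 s; move: (clamp s) => {}s s01.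
have -> : - (al * s) + be * s `^ p + ga * s `^ q - (- (al' * s) + be' * s `^ p + ga' * s `^ q)
  = - (al - al') * s + (be - be') * s `^ p + (ga - ga') * s `^ q by ring.
have P01 a : 1 < a -> `|s `^ a| <= 1.
  by move=> a1; rewrite ger0_norm ?powR_ge0// powR_le1//; lra.
apply: (le_trans (ler_normD _ _)); apply: (le_trans (lerD (ler_normD _ _) (lexx _))).
rewrite !normrM normrN; apply: lerD; [apply: lerD|]; rewrite ler_piMr//.
- by rewrite ger0_norm; lra.
- exact: P01.
- exact: P01.
Qed.

(* Shifting by 1 makes the derivative at 0 an instance of [prim_D]. *)
Definition pot f (s : R) : R := prim (fun t => f (t - 1)) (s + 1).

Lemma cont_shift f : continuous f -> continuous (fun t => f (t - 1)).
Proof.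
move=> cf t; apply: (C_comp t f); first exact: cf.
by apply: C_sub; [exact: C_id|exact: C_cst].
Qed.

Lemma pot_le0 f s : continuous f -> (forall t, t <= 0 -> f t = 0) -> s <= 0 -> pot f s = 0.
Proof.
move=> cf f0 s0; rewrite /pot; have [s1|s1] := leP (s + 1) 0; first by rewrite prim_le0.
apply/eqP; rewrite -normr_le0 -(mul0r (s + 1)); apply: prim_small.
- exact: cont_shift.
- exact: ltW.
- by move=> t /andP[_ ts]; rewrite f0 ?normr0//; lra.
Qed.

Lemma pot_D f s : continuous f -> (forall t, t <= 0 -> f t = 0) ->
  is_derive s 1 (pot f) (f s).
Proof.
move=> cf f0; have [s0|s0] := ltP s 0.
  rewrite f0; last exact: ltW.
  apply: (D_near _ (fun=> 0) _ _ (s - 1) 0).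
  - by rewrite s0 andbT; lra.
  - by move=> t /andP[_ t0]; rewrite pot_le0// ltW.
have s1 : 0 < s + 1 by lra.
have H := prim_D _ _ (cont_shift _ cf) s1.
have Ds : is_derive s 1 (fun t : R => t + 1) (1 + 0).
  exact: D_add _ _ _ _ _ (D_id _) (D_cst _ _).
have Hc : is_derive s 1 (pot f) (f (s + 1 - 1) * (1 + 0)).
  exact: (D_comp s (prim (fun t => f (t - 1))) (fun t => t + 1)).
by apply: D_eq Hc _; rewrite addrK addr0 mulr1.
Qed.

Lemma pot_cont f : continuous f -> (forall t, t <= 0 -> f t = 0) -> continuous (pot f).
Proof. by move=> cf f0 s; exact: D_cont _ _ _ (pot_D _ _ cf f0). Qed.

(** The product s s^p stands for s^(p+1), so that a factor s can be taken out when the potential is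
    compared with s f(s). *)
Definition nlpot p q al be ga (s : R) : R :=
  - (al / 2 * s ^+ 2) + be / (p + 1) * (s * s `^ p) + ga / (q + 1) * (s * s `^ q).

Lemma C_mul_powR a : 0 <= a -> forall s, 0 <= s -> {for s, continuous (fun x => x * x `^ a)}.
Proof.
move=> a0 s; rewrite le_eqVlt => /predU1P[<-|s0]; last first.
  apply: C_mul; first exact: C_id.
  exact: D_cont _ _ _ (D_powR _ _ _ a s0 (D_id _)).
apply: eps_cont => e e0; exists (Order.min 1 e); first by rewrite lt_min ltr01.
move=> t; rewrite subr0 mul0r subr0 lt_min => /andP[t1 te].
rewrite normrM; apply: le_lt_trans te; rewrite ler_piMr// ger0_norm ?powR_ge0//.
(* A power of a negative base is 1 by convention, so the bound also holds to the left of 0. *)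
have [t0|t0] := ltP t 0; first by rewrite lt0_powR1.
by apply: powR_le1 => //; rewrite t0/= ltW// -[t]ger0_norm.
Qed.

Lemma mul_powR_D a s : 0 < s -> is_derive s 1 (fun x => x * x `^ a) ((a + 1) * s `^ a).
Proof.
move=> s0; apply: D_eq (D_mul _ _ _ _ _ (D_id _) (D_powR _ _ _ a s0 (D_id _))) _.
have <- : s * s `^ (a - 1) = s `^ a.
  by rewrite -{1}(powRr1 (ltW s0)) -powRD ?(gt_eqF s0) ?implybT// addrC subrK.
by ring.
Qed.

Lemma pot_nlc p q al be ga s : 1 < p -> 1 < q -> 0 <= al <= 1 -> 0 <= be <= 1 ->
  0 <= ga <= 1 -> 0 <= s <= 1 -> pot (nlc p q al be ga) s = nlpot p q al be ga s.
Proof.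
move=> p1 q1 a01 b01 g01 /andP[s0 s1].
have cf := lip_continuous _ _ (nlc_lip _ _ _ _ _ p1 q1 a01 b01 g01).
have f0 t : t <= 0 -> nlc p q al be ga t = 0 by move=> t0; apply: nlc_le0 => //; lra.
pose F t := pot (nlc p q al be ga) t - nlpot p q al be ga t.
have : F 0 = F s.
  apply: (D_const F) => //.
  - move=> x /andP[x0 _]; apply: C_sub; first exact: pot_cont.
    apply: C_add; [apply: C_add|].
    + by apply: C_opp; apply: C_mul; [exact: C_cst|apply: C_pow; exact: C_id].
    + by apply: C_mul; [exact: C_cst|apply: C_mul_powR => //; lra].
    + by apply: C_mul; [exact: C_cst|apply: C_mul_powR => //; lra].
  - move=> x /andP[x0 xs].
    have D1 := D_scale _ _ _ (al / 2) (D_pow _ _ _ 2 (D_id x)).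
    have D2 := D_scale _ _ _ (be / (p + 1)) (mul_powR_D p x x0).
    have D3 := D_scale _ _ _ (ga / (q + 1)) (mul_powR_D q x x0).
    have D4 := D_add _ _ _ _ _ (D_add _ _ _ _ _ (D_opp _ _ _ D1) D2) D3.
    apply: D_eq (D_sub _ _ _ _ _ (pot_D _ x cf f0) D4) _.
    rewrite nlcE ?(ltW x0) ?(ltW (lt_le_trans xs s1))// /nl expr1.
    by field; apply/andP; split; rewrite gt_eqF//; lra.
rewrite /F pot_le0// /nlpot expr0n/= !mul0r !mulr0 oppr0 !addr0 subr0 => /esym/subr0_eq.
by [].
Qed.

End nonlinearity.

(** This is v' for r > 0, read off from the fixed point equation; unlike a derivative it is visibly
    continuous, with value 0 at 0. *)
Definition slope {R : realType} n (f v : R -> R) (r : R) : R := - (r * avg n (f \o v) r).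

Definition energy {R : realType} n (f v : R -> R) (r : R) : R :=
  slope n f v r ^+ 2 / 2 + pot f (v r).

(** * Energy, crossings and ground states *)

Section shooting.
Context {R : realType} (n : nat) (p q al be ga : R) (v : R -> R).
Hypotheses (p1 : 1 < p) (pq : p < q).
Hypotheses (al0 : 0 <= al) (be0 : 0 <= be) (ga0 : 0 <= ga) (abg : al + be + ga = 1).
Implicit Types (a b r s t : R).

Local Ltac hyps := have ? := p1; have ? := pq; have ? := al0; have ? := be0;
  have ? := ga0; have ? := abg.
Local Ltac slra := hyps; lra.
Local Ltac snra := hyps; nra.

Local Notation f := (nlc p q al be ga).
Local Notation L := (1 + p + q).

Hypotheses (cv : continuous v) (vE : forall r, v r = step n f v r).

Local Notation dv := (slope n f v).

Local Notation En := (energy n f v).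

Lemma q1 : 1 < q. Proof. exact: lt_trans pq. Qed.

Lemma al01 : 0 <= al <= 1. Proof. by rewrite al0/=; slra. Qed.
Lemma be01 : 0 <= be <= 1. Proof. by rewrite be0/=; slra. Qed.
Lemma ga01 : 0 <= ga <= 1. Proof. by rewrite ga0/=; slra. Qed.

Lemma f_lip : lip L f.
Proof. exact: nlc_lip p1 q1 al01 be01 ga01. Qed.

Lemma f_cont : continuous f. Proof. exact: lip_continuous _ _ f_lip. Qed.

Lemma f_le0 s : s <= 0 -> f s = 0.
Proof. by move=> s0; apply: nlc_le0 => //; have := q1; slra. Qed.

Lemma f_le s : `|f s| <= L * `|s|.
Proof. by have [_ /(_ s 0)] := f_lip; rewrite (f_le0 0)// !subr0. Qed.

Lemma fv_cont : continuous (f \o v).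
Proof. by move=> r; apply: (C_comp r f); [exact: f_cont|exact: cv]. Qed.

Lemma v_le0 r : r <= 0 -> v r = 1.
Proof. by move=> r0; rewrite vE step_le0. Qed.

Lemma v_D r : 0 < r -> is_derive r 1 v (dv r).
Proof.
move=> r0; apply: (D_near _ (step n f v) _ _ 0 (r + 1)).
- by rewrite r0/=; slra.
- by move=> t _; rewrite -vE.
- exact: step_D f_cont cv r0.
Qed.

Lemma dv_cont : continuous dv.
Proof.
move=> r; apply: (C_opp r (fun t => t * avg n (f \o v) t)); apply: C_mul; first exact: C_id.
exact: avg_cont fv_cont r.
Qed.

Lemma dv0 : dv 0 = 0. Proof. by rewrite /slope mul0r oppr0. Qed.

Lemma flux_D r : 0 < r -> is_derive r 1 (fun t => t ^+ n * dv t) (- (r ^+ n * f (v r))).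
Proof.
move=> r0; have -> : (fun t => t ^+ n * dv t) = (fun t => - (t ^+ n.+1 * avg n (f \o v) t)).
  by apply/funext => t; rewrite /slope mulrN mulrA -exprSr.
exact: D_opp _ _ _ (avg_D n _ _ fv_cont r0).
Qed.

Lemma flux_cont r : {for r, continuous (fun t => t ^+ n * dv t)}.
Proof. by apply: C_mul; [apply: C_pow; exact: C_id|exact: dv_cont]. Qed.

Lemma dv_D r : 0 < r -> is_derive r 1 dv (- (n%:R / r * dv r) - f (v r)).
Proof.
move=> r0; have rn : r ^+ n != 0 by rewrite expf_neq0// gt_eqF.
apply: (D_near _ (fun t => t ^+ n * dv t * (t ^+ n)^-1) _ _ 0 (r + 1)).
- by rewrite r0/=; slra.
- by move=> t /andP[t0 _]; rewrite mulrAC mulfV ?mul1r// expf_neq0// gt_eqF.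
have D1 := D_inv r (fun t => t ^+ n) _ rn (D_pow _ _ _ n (D_id r)).
apply: D_eq (D_mul _ _ _ _ _ (flux_D r r0) D1) _.
move: rn; case: (n) => [|m]; first by rewrite expr0 => _; field; rewrite gt_eqF.
rewrite exprS mulf_eq0 negb_or => /andP[_ rm] /=; move: (dv r) => y.
by field; rewrite rm gt_eqF.
Qed.

Lemma En_D r : 0 < r -> is_derive r 1 En (- (n%:R / r * dv r ^+ 2)).
Proof.
move=> r0; have c2 : 2 != 0 :> R by rewrite pnatr_eq0.
have D1 := D_mul _ _ _ _ _ (D_pow _ _ _ 2 (dv_D r r0)) (D_cst r 2^-1).
have D2 := D_comp _ _ _ _ _ (pot_D f (v r) f_cont f_le0) (v_D r r0).
by apply: D_eq (D_add _ _ _ _ _ D1 D2) _; rewrite /=; field; rewrite gt_eqF.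
Qed.

Lemma En_cont : continuous En.
Proof.
move=> r; apply: (C_add r (fun r => dv r ^+ 2 / 2) (fun r => pot f (v r))).
  by apply: C_mul; [apply: C_pow; exact: dv_cont|exact: C_cst].
by apply: (C_comp r (pot f)); [exact: pot_cont f_cont f_le0 _|exact: cv].
Qed.

Lemma En_decr a b : 0 <= a -> a <= b -> En b <= En a.
Proof.
move=> a0 ab; apply: (D_ge En (fun r => - (n%:R / r * dv r ^+ 2))) => //.
- by move=> r _; exact: En_cont.
- by move=> r /andP[ar _]; apply: En_D; exact: le_lt_trans ar.
- move=> r /andP[ar _]; rewrite oppr_le0 mulr_ge0 ?sqr_ge0// divr_ge0//.
  by rewrite (le_trans a0)// ltW.
Qed.

(* Backward uniqueness: v^2 + v'^2 decays at most exponentially. *)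
Lemma transversal r : 0 < r -> v r = 0 -> dv r = 0 -> False.
Proof.
move=> r0 vr dvr.
have v01 : 0 < v 0 by rewrite v_le0.
have [dl dl0 H] := cont_pos _ _ (cv 0) v01.
(* A starting point with v s > 0 that is itself positive, so that n / t stays below n / s on
   [s, r]. *)
pose s := Order.min (r / 2) (dl / 2).
have s0 : 0 < s by rewrite lt_min !divr_gt0.
have sr : s < r by rewrite gt_min; apply/orP; left; slra.
have vs : 0 < v s.
  by apply: H; rewrite subr0 gtr0_norm// gt_min; apply/orP; right; slra.
(* With |f v| <= L |v| and n / t <= n / s, the derivative of v^2 + v'^2 is at least - C (v^2 +
   v'^2); so [W] increases, although it vanishes at r and is positive at s. *)
pose C := 1 + L + 2 * (n%:R / s).
pose W t := (v t ^+ 2 + dv t ^+ 2) * expR (C * t).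
have : W s <= W r.
  apply: (D_le W (fun t => ((2 * v t * dv t + 2 * dv t * (- (n%:R / t * dv t) - f (v t)))
      + C * (v t ^+ 2 + dv t ^+ 2)) * expR (C * t))).
  - exact: ltW.
  - move=> t _; apply: C_mul; [apply: C_add; apply: C_pow; [exact: cv|exact: dv_cont]|].
    by apply: C_expR; apply: C_mul; [exact: C_cst|exact: C_id].
  - move=> t /andP[st _]; have t0 : 0 < t by exact: lt_trans st.
    have D1 := D_add _ _ _ _ _ (D_pow _ _ _ 2 (v_D t t0)) (D_pow _ _ _ 2 (dv_D t t0)).
    have D2 := D_expR _ _ _ (D_scale _ _ _ C (D_id t)).
    by apply: D_eq (D_mul _ _ _ _ _ D1 D2) _; rewrite /= !expr1 mulr1; ring.
  - move=> t /andP[st _]; have t0 : 0 < t by exact: lt_trans st.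
    rewrite mulr_ge0 ?expR_ge0// /C.
    have nt : n%:R / t <= n%:R / s by rewrite ler_wpM2l// lef_pV2// ltW.
    have nt0 : 0 <= n%:R / t by rewrite divr_ge0// ltW.
    have := f_le (v t); move: nt nt0; move: (n%:R / t) (n%:R / s) => k K.
    move: (dv t) (v t) (f (v t)) => y x F kK k0 Fx.
    have yF : `|y * F| <= L * (x ^+ 2 + y ^+ 2) / 2.
      rewrite normrM; apply: (@le_trans _ _ (`|y| * (L * `|x|))).
        by apply: ler_wpM2l.
      rewrite -(real_normK (num_real x)) -(real_normK (num_real y)).
      have := sqr_ge0 (`|x| - `|y|); have := q1; snra.
    have h1 := sqr_ge0 (x + y); have h2 := sqr_ge0 x; have h3 := sqr_ge0 y.
    move: yF; rewrite ler_norml => /andP[_ yF].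
    have : k * y ^+ 2 <= K * (x ^+ 2 + y ^+ 2) by snra.
    move: yF; slra.
rewrite /W vr dvr expr0n/= addr0 mul0r; apply/negP; rewrite -ltNge.
by rewrite mulr_gt0 ?expR_gt0// ltr_wpDr ?sqr_ge0// exprn_gt0.
Qed.

Lemma flux_le a b : 0 <= a -> a <= b -> (forall t, a < t < b -> 0 <= f (v t)) ->
  b ^+ n * dv b <= a ^+ n * dv a.
Proof.
move=> a0 ab H; apply: (D_ge (fun t => t ^+ n * dv t) (fun t => - (t ^+ n * f (v t)))) => //.
- by move=> t _; exact: flux_cont.
- by move=> t /andP[at_ _]; apply: flux_D; exact: le_lt_trans at_.
- move=> t /andP[at_ tb]; rewrite oppr_le0 mulr_ge0 ?exprn_ge0//.
    by rewrite (le_trans a0)// ltW.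
  by rewrite H// at_.
Qed.

Lemma v_decr a b : 0 <= a -> a <= b -> (forall t, a < t < b -> dv t <= 0) -> v b <= v a.
Proof.
move=> a0 ab H; apply: (D_ge v dv) => // t; first by move=> _; exact: cv.
by move=> /andP[at_ _]; apply: v_D; exact: le_lt_trans at_.
Qed.

Lemma v_incr a b : 0 <= a -> a <= b -> (forall t, a < t < b -> 0 <= dv t) -> v a <= v b.
Proof.
move=> a0 ab H; apply: (D_le v dv) => // t; first by move=> _; exact: cv.
by move=> /andP[at_ _]; apply: v_D; exact: le_lt_trans at_.
Qed.

(** Where v <= 0 the potential vanishes, so negative energy at r forces v r > 0. If r <= s, there is
    a zero of v between them, with energy at least 0, against the decrease of the energy. If s < r,
    then s lies in an interval [a, b] with v <= 0 inside and v = 0 at both ends; without force the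
    flux t^n v' is constant on it, so v is monotone there and cannot be negative at s. *)
Lemma neg_energy_ge0 s r : v s < 0 -> 0 <= r -> 0 <= En r.
Proof.
move=> vs r0; rewrite leNgt; apply/negP => Er.
have vr : 0 < v r.
  rewrite ltNge; apply/negP => vr; move: Er; rewrite /energy (pot_le0 _ _ f_cont f_le0 vr).
  by rewrite addr0 ltNge divr_ge0// sqr_ge0.
have s0 : 0 < s by rewrite ltNge; apply/negP => /v_le0 vs1; move: vs; rewrite vs1; slra.
have [rs|sr] := leP r s.
  have [|t /andP[rt ts] vt] := D_ivt v r s 0 rs (fun t _ => cv t).
    by right; rewrite !ltW.
  have : En t <= En r by exact: En_decr.
  rewrite /energy vt (pot_le0 _ _ f_cont f_le0)// addr0 => H.
  by move: (le_lt_trans H Er); rewrite ltNge divr_ge0// sqr_ge0.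
have cN : continuous (fun t => - v t) by move=> t; apply: C_opp; exact: cv.
have [||a /andP[a0 as_] [va an]] := last_point (fun t => - v t) 0 s (ltW s0) cN.
- by rewrite v_le0//; slra.
- by rewrite oppr_gt0.
have {}a0 : 0 < a.
  by rewrite lt_neqAle a0 andbT; apply/eqP => E; move: va; rewrite -E v_le0//; slra.
(* Applied to the reflected function, [last_point] finds the first zero of v after s. *)
have cNN : continuous (fun t => - v (- t)).
  by move=> t; apply: C_opp; apply: (C_comp t v); [exact: cv|apply: C_opp; exact: C_id].
have [|||b' /andP[b1 b2] [vb bn]] := last_point (fun t => - v (- t)) (- r) (- s) _ cNN.
- by rewrite lerN2 ltW.
- by rewrite opprK; slra.
- by rewrite opprK oppr_gt0.
pose b := - b'; have sb : s < b by rewrite /b; slra.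
have vneg t : a <= t <= b -> v t <= 0.
  move=> /andP[at_ tb]; have [ts|st] := leP t s.
    move: at_; rewrite le_eqVlt => /predU1P[<-|at_]; first by slra.
    by have := an t; rewrite at_ ts => /(_ isT); slra.
  move: tb; rewrite le_eqVlt => /predU1P[->|tb]; first by rewrite /b; slra.
  have := bn (- t); rewrite opprK => H; suff : 0 < - v t by slra.
  by apply: H; rewrite /b in tb; apply/andP; split; slra.
have vb0 : v b = 0 by rewrite /b; slra.
have flat t : a < t < b -> t ^+ n * dv t = a ^+ n * dv a.
  move=> /andP[at_ tb]; apply/esym/(D_const (fun t => t ^+ n * dv t)); first exact: ltW.
  - by move=> x _; exact: flux_cont.
  - move=> x /andP[ax xt]; have x0 : 0 < x by exact: lt_trans ax.
    by apply: D_eq (flux_D x x0) _; rewrite f_le0 ?mulr0 ?oppr0// vneg//; slra.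
have [Y0|Y0] := leP 0 (a ^+ n * dv a).
  have : v a <= v s.
    apply: v_incr; [exact: ltW|exact: ltW|] => t /andP[at_ ts].
    have t0 : 0 < t ^+ n by rewrite exprn_gt0// (lt_trans a0).
    by rewrite -(ler_pM2l t0) mulr0 flat// at_ (lt_trans ts).
  slra.
have : v b <= v s.
  apply: v_decr; [exact: ltW|exact: ltW|] => t /andP[st tb].
  have t0 : 0 < t ^+ n by rewrite exprn_gt0// (lt_trans s0).
  by rewrite -(ler_pM2l t0) mulr0 flat ?(ltW Y0)// tb (lt_trans as_).
rewrite vb0; slra.
Qed.

(** A zero would be an interior minimum, hence a double zero, which [transversal] excludes. *)
Lemma pos_of_ge0 : (forall r, 0 <= r -> 0 <= v r) -> forall r, 0 < v r.
Proof.
move=> v0 r; have [r0|r0] := leP r 0; first by rewrite v_le0.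
rewrite lt_neqAle v0 ?ltW// andbT; apply/eqP => /esym vr.
apply: (transversal r r0 vr).
apply: (D_uniq r v) (v_D r r0) _.
apply: (@derive1_at_min _ v 0 (r + 1) r).
- by slra.
- by move=> t; rewrite in_itv/= => /andP[t0 _]; case: (v_D t t0).
- by rewrite in_itv/= r0/=; slra.
- by move=> t; rewrite in_itv/= => /andP[t0 _]; rewrite vr v0// ltW.
Qed.

(** Since 1 / (p + 1) and 1 / (q + 1) are less than 1/2, the potential is less than s f(s) / 2. *)
Lemma pot_pos s : 0 < be + ga -> 0 < s <= 1 -> 0 <= pot f s -> 0 < f s.
Proof.
move=> bg /andP[s0 s1]; have s01 : 0 <= s <= 1 by rewrite ltW.
rewrite (pot_nlc _ _ _ _ _ _ p1 q1 al01 be01 ga01 s01) nlcE// /nlpot /nl.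
have P0 := powR_gt0 p s0; have Q0 := powR_gt0 q s0.
move: (s `^ p) (s `^ q) P0 Q0 => P Q P0 Q0.
have hq : (q + 1)^-1 < 2^-1 by rewrite ltf_pV2 ?posrE//; have := q1; slra.
have hp : (p + 1)^-1 < 2^-1 by rewrite ltf_pV2 ?posrE//; slra.
have -> : - (al / 2 * s ^+ 2) + be / (p + 1) * (s * P) + ga / (q + 1) * (s * Q) =
  s * (- (al * s) / 2 + be * P / (p + 1) + ga * Q / (q + 1)) by field; have := q1; slra.
rewrite pmulr_rge0// => H.
have [b0|b0] := ltP 0 be.
  have : be * P / (p + 1) < be * P / 2 by rewrite ltr_pM2l// mulr_gt0.
  have : ga * Q / (q + 1) <= ga * Q / 2 by rewrite ler_wpM2l ?(ltW hq)// mulr_ge0// ltW.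
  slra.
have g0 : 0 < ga by slra.
have : be * P / (p + 1) <= be * P / 2 by rewrite ler_wpM2l ?(ltW hp)// mulr_ge0// ltW.
have : ga * Q / (q + 1) < ga * Q / 2 by rewrite ltr_pM2l// mulr_gt0.
slra.
Qed.

Lemma energy0 : En 0 = - (al / 2) + be / (p + 1) + ga / (q + 1).
Proof.
rewrite /energy dv0 expr0n/= mul0r add0r v_le0// pot_nlc ?al01 ?be01 ?ga01 ?q1// ?lexx ?ler01//.
by rewrite /nlpot !powR1 !mulr1 expr1n mulr1.
Qed.

(** Both inequalities are closed conditions and pass to limits of profiles; strict positivity,
    monotonicity and decay are derived from them. *)
Definition ground n f v := forall r : R, 0 <= r -> 0 <= v r /\ 0 <= energy n f v r.

(** If be + ga > 0, the energy at 0 is less than (be + ga - al) / 2 = (1 - 2 al) / 2, because p + 1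
    and q + 1 exceed 2; otherwise it equals - 1/2. *)
Lemma energy0_al : 0 <= En 0 -> 0 < be + ga /\ al < 2^-1.
Proof.
rewrite energy0.
have hq : (q + 1)^-1 < 2^-1 by rewrite ltf_pV2 ?posrE//; have := q1; slra.
have hp : (p + 1)^-1 < 2^-1 by rewrite ltf_pV2 ?posrE//; slra.
have [b0|b0] := ltP 0 be.
  have : be / (p + 1) < be / 2 by rewrite ltr_pM2l.
  have : ga / (q + 1) <= ga / 2 by rewrite ler_wpM2l ?(ltW hq).
  by slra.
have {}b0 : be = 0 by slra.
have [g0|g0] := ltP 0 ga.
  have : ga / (q + 1) < ga / 2 by rewrite ltr_pM2l.
  by rewrite b0 mul0r; slra.
have -> : ga = 0 by slra.
by rewrite b0 !mul0r; slra.
Qed.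

Section ground_state.
Hypothesis gv : ground n f v.

Lemma ground_pos r : 0 < v r.
Proof. by apply: pos_of_ge0 => {}r r0; case: (gv r r0). Qed.

Lemma ground_bg : 0 < be + ga.
Proof. by case: energy0_al => //; case: (gv 0 (lexx 0)). Qed.

(** If v' were positive at r, consider its last zero c before r. The energy there is purely
    potential and nonnegative, so f (v c) > 0 by [pot_pos]; then the flux decreases just after c and
    v' cannot be positive there. *)
Lemma ground_dv r : 0 <= r -> dv r <= 0.
Proof.
move=> r0; rewrite leNgt; apply/negP => dr.
have [|c /andP[c0 cr] [dc cp]] := last_point dv 0 r r0 dv_cont _ dr; first by rewrite dv0.
have fc : 0 < f (v c).
  have [_] := gv c c0; rewrite /energy dc expr0n/= mul0r add0r.
  have [v1|v1] := leP (v c) 1.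
    by apply: pot_pos; [exact: ground_bg|rewrite ground_pos].
  (* Above 1 the clamped force is f 1, which is positive because the energy at 0 is the potential at
     1. *)
  move=> _; rewrite nlc_ge1 ?ltW// -(nlc_ge1 p q al be ga 1)//; apply: pot_pos.
  - exact: ground_bg.
  - by rewrite ltr01/=.
  - by have [_] := gv 0 (lexx 0); rewrite /energy dv0 expr0n/= mul0r add0r v_le0.
have [dl dl0 H] := cont_pos _ _ (fv_cont c) fc.
pose t := Order.min r (c + dl / 2).
have ct : c < t by rewrite lt_min cr/=; slra.
have tr : t <= r by rewrite ge_min lexx.
have : t ^+ n * dv t <= c ^+ n * dv c.
  apply: flux_le => //; first exact: ltW.
  move=> s /andP[cs st]; apply/ltW/H; rewrite ger0_norm ?subr_ge0 ?(ltW cs)//.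
  suff : s < c + dl / 2 by slra.
  by apply: (lt_le_trans st); rewrite ge_min lexx orbT.
rewrite dc mulr0 leNgt mulr_gt0 ?exprn_gt0 ?(le_lt_trans c0 ct)//.
by apply: cp; rewrite ct.
Qed.

Lemma ground_decr a b : 0 <= a -> a <= b -> v b <= v a.
Proof.
move=> a0 ab; apply: v_decr => // t /andP[at_ _]; apply: ground_dv.
by rewrite (le_trans a0)// ltW.
Qed.

Lemma ground_le1 r : v r <= 1.
Proof.
have [r0|r0] := leP r 0; first by rewrite v_le0.
by rewrite -(v_le0 0)//; apply: ground_decr => //; exact: ltW.
Qed.

Lemma ground01 r : 0 <= v r <= 1.
Proof. by rewrite ltW ?ground_pos ?ground_le1. Qed.

End ground_state.
End shooting.

(** * Exponential decay of ground states *)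

Section decay.
Context {R : realType} (n : nat) (p q al be ga : R) (v : R -> R).
Hypotheses (p1 : 1 < p) (pq : p < q).
Hypotheses (al0 : 0 <= al) (be0 : 0 <= be) (ga0 : 0 <= ga) (abg : al + be + ga = 1).
Implicit Types (a b r s t : R).

Local Ltac hyps := have ? := p1; have ? := pq; have ? := al0; have ? := be0;
  have ? := ga0; have ? := abg.
Local Ltac slra := hyps; lra.

Local Notation f := (nlc p q al be ga).
Local Notation dv := (slope n f v).

(** Equal to a (1 - 2 theta / (p + 1)) for theta = (p + 3) / 4; it is positive because theta < (p +
    1) / 2. This number and the next two depend on a lower bound a of al, not on the profile. *)
Definition rate p (a : R) : R := a * (p - 1) / (2 * (p + 1)).

(** The product (theta - 1) a s0 with theta = (p + 3) / 4 and s0 = (theta a)^(1 / (p - 1)), where s0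
    is the least value that v can take in the regime of large v. *)
Definition force p (a : R) : R :=
  (p - 1) / 4 * a * ((p + 3) / 4 * a) `^ (p - 1)^-1.

(** Under a force of at least [force p a] the profile is at most 1 - x r^2 with x = [force p a] / (2
    (n + 1)). The radius 1 + 1 / x makes x r^2 >= 1, so positivity must fail by then. *)
Definition onset n p (a : R) : R := 1 + 2 * n.+1%:R / force p a.

Lemma rate_gt0 a : 0 < a -> 0 < rate p a.
Proof. by have := p1 => ? a0; rewrite /rate divr_gt0// ?mulr_gt0//; lra. Qed.

Lemma force_gt0 a : 0 < a -> 0 < force p a.
Proof. by have := p1 => ? a0; rewrite /force !mulr_gt0// ?powR_gt0// ?mulr_gt0//; lra. Qed.

Lemma powR_mul1 s : 0 < s -> s `^ p = s * s `^ (p - 1) /\ s `^ q = s * s `^ (q - 1).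
Proof. by move=> s0; rewrite !mulr_powRB1 ?ltW//; have := p1; have := pq; lra. Qed.

(** For s <= 1 the left side of the last hypothesis is at most al, up to the factor theta, only when
    s is small: be s^(p-1) + ga s^(q-1) <= s^(p-1) gives s >= (theta a)^(1 / (p - 1)). The remaining
    factor of f s is at least (theta - 1) al. *)
Lemma force_le a s : 0 < a -> a <= al -> 0 < s -> s <= 1 ->
  (p + 3) / 4 * al <= be * s `^ (p - 1) + ga * s `^ (q - 1) -> force p a <= f s.
Proof.
move=> a0 aal s0 s1 big; have [sp sq] := powR_mul1 _ s0.
have qp : s `^ (q - 1) <= s `^ (p - 1) by apply: ger_powR; rewrite ?s0//; slra.
have P0 := powR_ge0 s (p - 1).
have th : (p + 3) / 4 * a <= (p + 3) / 4 * al by rewrite ler_wpM2l//; slra.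
have a3 : 0 <= (p + 3) / 4 * a by apply: mulr_ge0; slra.
have lb : ((p + 3) / 4 * a) `^ (p - 1)^-1 <= s.
  have -> : s = (s `^ (p - 1)) `^ (p - 1)^-1.
    by rewrite -powRrM mulfV ?powRr1 ?(ltW s0)// gt_eqF//; slra.
  apply: ge0_ler_powR => //; first by rewrite invr_ge0; slra.
  have : ga * s `^ (q - 1) <= ga * s `^ (p - 1) by rewrite ler_wpM2l.
  have : (be + ga) * s `^ (p - 1) <= 1 * s `^ (p - 1) by rewrite ler_wpM2r//; slra.
  lra.
rewrite nlcE ?(ltW s0)// /nl sp sq.
have -> : - (al * s) + be * (s * s `^ (p - 1)) + ga * (s * s `^ (q - 1))
  = s * (be * s `^ (p - 1) + ga * s `^ (q - 1) - al) by ring.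
rewrite /force mulrC; apply: ler_pM => //.
- exact: powR_ge0.
- by apply: mulr_ge0; slra.
- have : (p - 1) / 4 * a <= (p - 1) / 4 * al by rewrite ler_wpM2l//; slra.
  slra.
Qed.

(** In this regime - 2 F(s) >= [rate p a] s^2, by 1 / (q + 1) <= 1 / (p + 1); since the rate is at
    most 1, it may be replaced by its square. *)
Lemma rate_le_dv a s y : 0 < a -> a <= al -> 0 < s -> s <= 1 ->
  be * s `^ (p - 1) + ga * s `^ (q - 1) < (p + 3) / 4 * al ->
  0 <= y ^+ 2 / 2 + pot f s -> (rate p a * s) ^+ 2 <= y ^+ 2.
Proof.
move=> a0 aal s0 s1 small; have k0 := rate_gt0 a a0.
have k1 : rate p a <= 1.
  rewrite /rate ler_pdivrMr ?mul1r; last by rewrite mulr_gt0//; slra.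
  have : a * (p - 1) <= 1 * (p - 1) by rewrite ler_wpM2r//; slra.
  slra.
have [sp sq] := powR_mul1 _ s0.
rewrite (pot_nlc p q al be ga _ p1) ?(ltW s0)//; last first.
- by rewrite ga0; slra.
- by rewrite be0; slra.
- by rewrite al0; slra.
- by slra.
rewrite /nlpot sp sq; move: small (powR_ge0 s (p - 1)) (powR_ge0 s (q - 1)).
move: (s `^ (p - 1)) (s `^ (q - 1)) => P Q small P0 Q0.
have p10 : 0 < p + 1 by slra.
have hq : ga / (q + 1) * Q <= ga / (p + 1) * Q.
  by rewrite ler_wpM2r// ler_wpM2l// lef_pV2 ?posrE; slra.
have sm : (be * P + ga * Q) / (p + 1) <= (p + 3) / 4 * al / (p + 1).
  by rewrite ler_pM2r ?(ltW small)// invr_gt0.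
have kal : rate p a <= al / 2 * 2 - 2 * ((p + 3) / 4 * al / (p + 1)).
  have -> : al / 2 * 2 - 2 * ((p + 3) / 4 * al / (p + 1)) = rate p al.
    by rewrite /rate; move: p10 => {}p10; field; rewrite gt_eqF.
  rewrite /rate -!mulrA; apply: ler_wpM2r => //.
  by apply: divr_ge0; slra.
have E : - (al / 2 * s ^+ 2) + be / (p + 1) * (s * (s * P)) +
   ga / (q + 1) * (s * (s * Q)) =
   - (s ^+ 2) * (al / 2 - be / (p + 1) * P - ga / (q + 1) * Q) by ring.
rewrite E exprMn => Er.
have s20 : 0 < s ^+ 2 by rewrite exprn_gt0.
have : s ^+ 2 * rate p a <= s ^+ 2 * (2 * (al / 2 - be / (p + 1) * P - ga / (q + 1) * Q)).
  rewrite ler_pM2l//.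
  have -> : be / (p + 1) * P = (be * P + ga * Q) / (p + 1) - ga / (p + 1) * Q.
    by field; rewrite gt_eqF.
  lra.
have : rate p a ^+ 2 * s ^+ 2 <= rate p a * s ^+ 2.
  by rewrite ler_pM2r// expr2 ler_piMl// ltW.
lra.
Qed.

Hypotheses (cv : continuous v) (vE : forall r, v r = step n f v r).
Hypothesis gv : ground n f v.

Let vpos := ground_pos n p q al be ga v p1 pq al0 be0 ga0 abg cv vE gv.
Let v01 := ground01 n p q al be ga v p1 pq al0 be0 ga0 abg cv vE gv.
Let vdecr := ground_decr n p q al be ga v p1 pq al0 be0 ga0 abg cv vE gv.
Let dvneg := ground_dv n p q al be ga v p1 pq al0 be0 ga0 abg cv vE gv.
Let vD := v_D n p q al be ga v p1 pq al0 be0 ga0 abg cv vE.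
Let vle0 := v_le0 n p q al be ga v vE.
Let fluxD := flux_D n p q al be ga v p1 pq al0 be0 ga0 abg cv.
Let fluxC := flux_cont n p q al be ga v p1 pq al0 be0 ga0 abg cv.

(* While be v^(p-1) + ga v^(q-1) >= theta al with theta = (p+3)/4 in (1, (p+1)/2),
   the force is bounded below, so this regime ends before [onset];
   afterwards v'^2 >= - 2 F(v) >= (rate v)^2. *)
Lemma ground_dv_le a r : 0 < a -> a <= al -> onset n p a <= r -> dv r <= - (rate p a * v r).
Proof.
move=> a0 aal Tr; have fo0 := force_gt0 a a0; have k0 := rate_gt0 a a0.
have n0 : (0 : R) < n.+1%:R by rewrite ltr0n.
have r0 : 0 < r by apply: lt_le_trans Tr; rewrite ltr_wpDr// divr_ge0 ?(ltW fo0)// mulr_ge0.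
have [_ V1] := andP (v01 r); have Vpos := vpos r.
have [big|small] := leP ((p + 3) / 4 * al) (be * v r `^ (p - 1) + ga * v r `^ (q - 1)).
  exfalso.
  (* As v decreases, the regime of large v at r prevails on the whole of [0, r]. *)
  have ft t : 0 <= t <= r -> force p a <= f (v t).
    move=> /andP[t0 tr]; have vrt := vdecr t r t0 tr; have [_ W1] := andP (v01 t).
    have mono e : 0 <= e -> v r `^ e <= v t `^ e.
      by move=> e0; apply: ge0_ler_powR => //; rewrite nnegrE ltW.
    apply: force_le => //; apply: (le_trans big).
    by apply: lerD; apply: ler_wpM2l => //; apply: mono; slra.
  have dvt t : 0 < t < r -> dv t <= - (force p a / n.+1%:R * t).
    move=> /andP[t0 tr].
    pose H x := x ^+ n * dv x + force p a / n.+1%:R * x ^+ n.+1.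
    have : H t <= H 0.
      apply: (D_ge H (fun x => - (x ^+ n * f (v x)) + force p a / n.+1%:R * (n.+1%:R * x ^+ n * 1))).
      - exact: ltW.
      - move=> x _; apply: C_add; first exact: fluxC.
        by apply: C_mul; [exact: C_cst|apply: C_pow; exact: C_id].
      - move=> x /andP[x0 _]; apply: D_add; first exact: fluxD.
        exact: D_scale _ _ _ _ (D_pow _ _ _ n.+1 (D_id x)).
      - move=> x /andP[x0 xt].
        have xn : 0 < x ^+ n by rewrite exprn_gt0.
        rewrite mulr1 mulrA divfK ?(gt_eqF n0)// addrC subr_le0 mulrC ler_pM2l//.
        by apply: ft; rewrite ltW//=; exact: ltW (lt_trans xt tr).
    rewrite /H !expr0n/= mulr0 addr0 dv0 mulr0 exprS => h.
    have tn : 0 < t ^+ n by rewrite exprn_gt0.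
    rewrite -(ler_pM2l tn); move: h; move: (force p a / _) (dv t) (t ^+ n) => c y z h; lra.
  (* A second integration: [H] decreases from 1, which forces v r <= 0 as soon as r reaches
     [onset]. *)
  pose H x := v x + force p a / (2 * n.+1%:R) * x ^+ 2.
  have : H r <= H 0.
    apply: (D_ge H (fun x => dv x + force p a / (2 * n.+1%:R) * (2%:R * x ^+ 1 * 1))).
    - exact: ltW.
    - move=> x _; apply: C_add; first exact: cv.
      by apply: C_mul; [exact: C_cst|apply: C_pow; exact: C_id].
    - move=> x /andP[x0 _]; apply: D_add; first exact: vD.
      exact: D_scale _ _ _ _ (D_pow _ _ _ 2 (D_id x)).
    - move=> x xr; have := dvt x xr; rewrite expr1.
      have -> : force p a / (2 * n.+1%:R) * (2 * x * 1) = force p a / n.+1%:R * x.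
        by move: (n.+1%:R : R) n0 => N N0; field; rewrite gt_eqF.
      by move: (force p a / _ * x) => c; lra.
  rewrite /H expr0n/= mulr0 addr0 (vle0 0 (lexx 0)).
  have : 1 <= force p a / (2 * n.+1%:R) * r ^+ 2.
    set x := force p a / (2 * n.+1%:R).
    have x0 : 0 < x by rewrite divr_gt0// mulr_gt0.
    have Tx : onset n p a = 1 + x^-1 by rewrite /onset /x invf_div.
    move: Tr; rewrite Tx => Tr; have xx : x * x^-1 = 1 by rewrite mulfV// gt_eqF.
    have xi : 0 < x^-1 by rewrite invr_gt0.
    have : x * (1 * (1 + x^-1)) <= x * r ^+ 2.
      rewrite ler_pM2l// expr2; apply: ler_pM => //; lra.
    rewrite mul1r mulrDr xx; lra.
  by move: Vpos; move: (force p a / _ * r ^+ 2) => X ? ? ?; lra.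
have [_ Er] := gv r (ltW r0).
have key : (rate p a * v r) ^+ 2 <= dv r ^+ 2 by exact: rate_le_dv.
have d0 := dvneg r (ltW r0).
rewrite leNgt; apply/negP => H.
have kv : 0 < rate p a * v r by rewrite mulr_gt0.
move: key; rewrite -[leRHS]sqrrN; have : (- dv r) ^+ 2 < (rate p a * v r) ^+ 2.
  by rewrite ltr_sqr ?nnegrE; [lra|lra|exact: ltW].
lra.
Qed.

(** Up to [onset] the right side is at least 1, which bounds v; from there on v e^(rate r)
    decreases. *)
Lemma ground_decay a r : 0 < a -> a <= al -> 0 <= r ->
  v r <= expR (rate p a * (onset n p a - r)).
Proof.
move=> a0 aal r0; have k0 := rate_gt0 a a0; have fo0 := force_gt0 a a0.
have [rT|Tr] := leP r (onset n p a).
  apply: (@le_trans _ _ 1); first by have /andP[] := v01 r.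
  apply: le_trans (expR_ge1Dx _); rewrite lerDl mulr_ge0 ?(ltW k0)//; lra.
have T0 : 0 < onset n p a by rewrite /onset ltr_wpDr// divr_ge0 ?(ltW fo0)// mulr_ge0.
pose H t := v t * expR (rate p a * t).
have : H r <= H (onset n p a).
  apply: (D_ge H (fun t => dv t * expR (rate p a * t)
      + v t * (expR (rate p a * t) * (rate p a * 1)))); first exact: ltW.
  - move=> t _; apply: C_mul; first exact: cv.
    by apply: C_expR; apply: C_mul; [exact: C_cst|exact: C_id].
  - move=> t /andP[Tt _]; have Dv := vD t (lt_trans T0 Tt).
    exact: D_mul _ _ _ _ _ Dv (D_expR _ _ _ (D_scale _ _ _ (rate p a) (D_id t))).
  - move=> t /andP[Tt _]; have := ground_dv_le a t a0 aal (ltW Tt).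
    have := expR_gt0 (rate p a * t); move: (expR _) => e e0 h; nra.
rewrite /H => h; rewrite mulrBr expRD expRN ler_pdivlMr ?expR_gt0//.
apply: (le_trans h); rewrite ler_piMl ?expR_ge0//.
by have /andP[] := v01 (onset n p a).
Qed.

End decay.

(** * Zeros of Emden-Fowler profiles *)

Section emden_fowler.
Context {R : realType} (n : nat) (p q be ga : R) (v : R -> R).
Hypotheses (p1 : 1 < p) (pq : p < q).
Hypotheses (be0 : 0 <= be) (ga0 : 0 <= ga) (abg : 0 + be + ga = 1).
Hypothesis qE : q = 1 + 4 / n.+1%:R.
Implicit Types (a b r s t : R).

Local Ltac hyps := have ? := p1; have ? := pq; have ? := be0;
  have ? := ga0; have ? := abg.
Local Ltac slra := hyps; lra.

Local Notation f := (nlc p q 0 be ga).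
Local Notation dv := (slope n f v).

Hypotheses (cv : continuous v) (vE : forall r, v r = step n f v r).

Let al0 : 0 <= 0 :> R := lexx 0.
Let slope0 : dv 0 = 0 := dv0 n p q 0 be ga v.
Let vle0 := v_le0 n p q 0 be ga v vE.
Let vD := v_D n p q 0 be ga v p1 pq al0 be0 ga0 abg cv vE.
Let fluxD := flux_D n p q 0 be ga v p1 pq al0 be0 ga0 abg cv.
Let fluxC := flux_cont n p q 0 be ga v p1 pq al0 be0 ga0 abg cv.
Let EnD := En_D n p q 0 be ga v p1 pq al0 be0 ga0 abg cv vE.
Let EnC := En_cont n p q 0 be ga v p1 pq al0 be0 ga0 abg cv.

Hypothesis v0 : forall r, 0 <= v r.

Let q1 : 1 < q := lt_trans p1 pq.
Let N0 : (0 : R) < n.+1%:R := eq_ind_r is_true isT (ltr0n R n.+1).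
Let vpos := pos_of_ge0 n p q 0 be ga v p1 pq al0 be0 ga0 abg cv vE (fun r _ => v0 r).

Let f0 r : 0 <= f (v r).
Proof. by rewrite /nlc /nl mul0r oppr0 add0r addr_ge0// mulr_ge0// powR_ge0. Qed.

Let dv_le0 r : 0 <= r -> dv r <= 0.
Proof.
rewrite le_eqVlt => /predU1P[<-|r0]; first by rewrite slope0.
have := flux_le n p q 0 be ga v p1 pq al0 be0 ga0 abg cv 0 r (lexx 0) (ltW r0) (fun t _ => f0 t).
by rewrite slope0 mulr0 pmulr_rle0// exprn_gt0.
Qed.

Let vdecr a b : 0 <= a -> a <= b -> v b <= v a.
Proof.
move=> a0 ab; apply: (v_decr n p q 0 be ga) => // t /andP[at_ _].
by apply: dv_le0; rewrite (le_trans a0)// ltW.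
Qed.

Let v1 r : v r <= 1.
Proof.
have [r0|r0] := leP r 0; first by rewrite vle0.
by rewrite -(vle0 0)//; apply: vdecr => //; exact: ltW.
Qed.

Let fE r : f (v r) = be * v r `^ p + ga * v r `^ q.
Proof. by rewrite nlcE ?v0 ?v1// /nl mul0r oppr0 add0r. Qed.

Let vq_le_vp r : v r `^ q <= v r `^ p.
Proof. by apply: ger_powR; rewrite ?vpos ?v1//; exact: ltW. Qed.

Let vq_le_f r : v r `^ q <= f (v r).
Proof.
have := vq_le_vp r.
have := powR_ge0 (v r) q; rewrite fE; move: (_ `^ q) (_ `^ p) => Q P Q0 QP.
have : be * Q <= be * P by rewrite ler_wpM2l.
have : (be + ga) * Q = Q by rewrite -[RHS]mul1r; congr (_ * _); slra.
lra.
Qed.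

(** On [0, r] the force is at least v^q, hence at least its value at r because v decreases; the flux
    equation is then integrated. *)
Lemma emden_fowler_slope r : 0 < r -> dv r <= - (r * v r `^ q / n.+1%:R).
Proof.
move=> r0; pose H x := x ^+ n * dv x + v r `^ q / n.+1%:R * x ^+ n.+1.
have : H r <= H 0.
  apply: (D_ge H (fun x => - (x ^+ n * f (v x)) + v r `^ q / n.+1%:R * (n.+1%:R * x ^+ n * 1))).
  - exact: ltW.
  - move=> x _; apply: C_add; first exact: fluxC.
    by apply: C_mul; [exact: C_cst|apply: C_pow; exact: C_id].
  - move=> x /andP[x0 _]; have := fluxD x x0 => D1.
    exact: D_add _ _ _ _ _ D1 (D_scale _ _ _ _ (D_pow _ _ _ n.+1 (D_id x))).
  - move=> x /andP[x0 xr].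
    have xn : 0 < x ^+ n by rewrite exprn_gt0.
    rewrite mulr1 mulrA divfK ?(gt_eqF N0)// addrC subr_le0 mulrC ler_pM2l//.
    apply: le_trans (vq_le_f x); apply: ge0_ler_powR; rewrite ?nnegrE//.
    + by apply: ltW; slra.
    + by apply: vdecr; exact: ltW.
rewrite /H !expr0n/= mulr0 addr0 slope0 mulr0 exprS => h.
have rn : 0 < r ^+ n by rewrite exprn_gt0.
rewrite -(ler_pM2l rn); move: h; rewrite -[r * _ / _]mulrA.
by move: (r ^+ n) (dv r) (v r `^ q / _) => X Y Z; lra.
Qed.

(** Integrating v^-q v' <= - r / N, with N = n + 1, gives r^2 v^(q-1) <= 2 N / (q - 1) = N^2 / 2.
    The power N / 2 of this is the claim, because (q - 1) N / 2 = 2 for the critical exponent. *)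
Lemma emden_fowler_upper :
  exists2 C, 0 <= C & forall r, 0 < r -> r ^+ n.+1 * v r ^+ 2 <= C.
Proof.
have q_1 := q1; pose C0 : R := n.+1%:R ^+ 2 / 2.
have C00 : 0 < C0 by rewrite divr_gt0// exprn_gt0.
exists (C0 `^ (n.+1%:R / 2)); first exact: powR_ge0.
move=> r r0; pose H x := v x `^ (- (q - 1)) - (q - 1) / (2 * n.+1%:R) * x ^+ 2.
have vn0 x : v x != 0 by rewrite gt_eqF.
have : H 0 <= H r.
  apply: (D_le H (fun x => - (q - 1) * v x `^ (- (q - 1) - 1) * dv x
      - (q - 1) / (2 * n.+1%:R) * (2%:R * x ^+ 1 * 1))); first exact: ltW.
  - move=> x _; apply: C_sub.
      apply: (C_comp x (fun t => t `^ _)); last exact: cv.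
      exact: D_cont _ _ _ (D_powR _ _ _ _ (vpos x) (D_id _)).
    by apply: C_mul; [exact: C_cst|apply: C_pow; exact: C_id].
  - move=> x /andP[x0 _]; have D1 := D_powR x v _ (- (q - 1)) (vpos x) (vD x x0).
    exact: D_sub _ _ _ _ _ D1 (D_scale _ _ _ _ (D_pow _ _ _ 2 (D_id x))).
  - move=> x /andP[x0 _]; have := emden_fowler_slope x x0.
    have -> : - (q - 1) - 1 = - q by ring.
    rewrite powRN; have := powR_gt0 q (vpos x); move: (v x `^ q) (dv x) => Q y Q0 h.
    rewrite expr1; move: (n.+1%:R : R) N0 h => N N_gt0 h.
    have : (q - 1) / Q * (x * Q / N) <= (q - 1) / Q * (- y).
      by rewrite ler_wpM2l ?divr_ge0//; lra.
    have -> : (q - 1) / Q * (x * Q / N) = (q - 1) / (2 * N) * (2 * x * 1).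
      by field; rewrite !gt_eqF.
    move: (_ * (2 * x * 1)) => Z; rewrite mulNr; lra.
rewrite /H expr0n mulr0 subr0 vle0// powR1 powRN.
have V0 := powR_gt0 (q - 1) (vpos r).
have -> : (q - 1) / (2 * n.+1%:R) = C0^-1.
  by rewrite qE /C0; move: (n.+1%:R : R) N0 => N N_gt0; field; rewrite gt_eqF.
move=> h.
have hV : r ^+ 2 * v r `^ (q - 1) <= C0.
  have : C0^-1 * r ^+ 2 <= (v r `^ (q - 1))^-1 by move: h; lra.
  by move=> h'; rewrite -ler_pdivlMr// -ler_pdivrMl.
have E : r ^+ n.+1 * v r ^+ 2 = (r ^+ 2 * v r `^ (q - 1)) `^ (n.+1%:R / 2).
  rewrite powRM ?sqr_ge0 ?powR_ge0// -powRrM -(powR_mulrn 2 (ltW r0)) -powRrM.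
  have -> : 2 * (n.+1%:R / 2) = n.+1%:R :> R by field.
  have -> : (q - 1) * (n.+1%:R / 2) = 2.
    by rewrite qE; move: (n.+1%:R : R) N0 => N N_gt0; field; rewrite gt_eqF.
  by rewrite powR_mulrn ?ltW// powR_mulrn ?ltW.
rewrite E; apply: ge0_ler_powR => //.
- by rewrite nnegrE mulr_ge0 ?sqr_ge0 ?powR_ge0.
- by rewrite nnegrE ltW.
Qed.

Local Notation M := (n%:R : R).

Let M0 : 0 <= M. Proof. exact: ler0n. Qed.

Let NE : n.+1%:R = M + 1 :> R. Proof. by rewrite natr1. Qed.

Lemma emden_fowler_pot r :
  pot f (v r) = be / (p + 1) * (v r * v r `^ p) + ga / (q + 1) * (v r * v r `^ q).
Proof.
have ? := q1; rewrite pot_nlc//; [|by apply/andP; split; lra|slra|slra|by rewrite v0 v1].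
by rewrite /nlpot mul0r mul0r oppr0 add0r.
Qed.

(* The exponents are at most [1 + 4/N], hence below the Sobolev exponent. *)
Lemma subcritical e : 1 < e -> e <= q -> (M - 1) / 2 < (M + 1) / (e + 1).
Proof.
move=> e1 eq; have m0 := M0; have := q1; have := qE; rewrite NE; move: M m0 => m m0 qe q_1.
have qm : (m - 1) / 2 * (q + 1) < m + 1.
  rewrite qe; have -> : (m - 1) / 2 * (1 + 4 / (m + 1) + 1) = m + 1 - 4 / (m + 1).
    by field; lra.
  have : 0 < 4 / (m + 1) by rewrite divr_gt0//; lra.
  lra.
apply: (@lt_le_trans _ _ ((m + 1) / (q + 1))).
  by rewrite ltr_pdivlMr//; lra.
by rewrite ler_wpM2l ?lef_pV2 ?posrE; lra.
Qed.

(** With N = n + 1, the function r^N E + (N - 2) / 2 r^n v v', whose derivative is r^n (N F(v) - (N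
    - 2) / 2 v f(v)). For each of the two powers the bracket is positive by [subcritical]. *)
Definition pohozaev n p q be ga (v : R -> R) r : R :=
  r ^+ n.+1 * energy n (nlc p q 0 be ga) v r
  + (n%:R - 1) / 2 * (v r * (r ^+ n * slope n (nlc p q 0 be ga) v r)).

Local Notation P := (pohozaev n p q be ga v).

Lemma pohozaev_incr : 0 < P 1 /\ forall r, 1 <= r -> P 1 <= P r.
Proof.
pose P' r := r ^+ n * ((M + 1) * pot f (v r) - (M - 1) / 2 * (v r * f (v r))).
have PC r : {for r, continuous P}.
  apply: C_add; apply: C_mul.
  - by apply: C_pow; exact: C_id.
  - exact: EnC.
  - exact: C_cst.
  - by apply: C_mul; [exact: cv|exact: fluxC].
have PD r : 0 < r -> is_derive r 1 P (P' r).
  move=> r0; have D1 := D_mul _ _ _ _ _ (D_pow _ _ _ n.+1 (D_id r)) (EnD r r0).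
  have D2 := D_scale _ _ _ ((M - 1) / 2) (D_mul _ _ _ _ _ (vD r r0) (fluxD r r0)).
  apply: D_eq (D_add _ _ _ _ _ D1 D2) _.
  rewrite /P' NE /= /energy (exprS r n); move: (pot f (v r)) (dv r) (r ^+ n) => X y rn.
  by field; rewrite gt_eqF.
have P'0 r : 0 < r -> 0 < P' r.
  move=> r0; rewrite /P' mulr_gt0 ?exprn_gt0// emden_fowler_pot fE.
  have V0 := vpos r; have X0 := powR_gt0 p V0; have Y0 := powR_gt0 q V0.
  have c1 := subcritical p p1 (ltW pq); have c2 := subcritical q q1 (lexx q).
  move: (v r) (v r `^ p) (v r `^ q) V0 X0 Y0 => V X Y V0 X0 Y0.
  have -> : (M + 1) * (be / (p + 1) * (V * X) + ga / (q + 1) * (V * Y))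
      - (M - 1) / 2 * (V * (be * X + ga * Y)) =
    be * (V * X * ((M + 1) / (p + 1) - (M - 1) / 2))
    + ga * (V * Y * ((M + 1) / (q + 1) - (M - 1) / 2)) by field; slra.
  have U1 : 0 < V * X * ((M + 1) / (p + 1) - (M - 1) / 2).
    by rewrite !mulr_gt0// subr_gt0.
  have U2 : 0 < V * Y * ((M + 1) / (q + 1) - (M - 1) / 2).
    by rewrite !mulr_gt0// subr_gt0.
  have [b0|b0] := ltP 0 be.
    by apply: ltr_wpDr; [apply: mulr_ge0 => //; exact: ltW|exact: mulr_gt0].
  have -> : be = 0 by slra.
  have -> : ga = 1 by slra.
  by rewrite mul0r add0r mul1r.
split.
  have [c /andP[c0 _]] := D_mvt P P' 0 1 ltr01 (fun x _ => PC x) (fun x h => PD x (proj1 (andP h))).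
  have P0 : P 0 = 0 by rewrite /pohozaev slope0 expr0n/= mul0r !mulr0 addr0.
  by rewrite P0 !subr0 mulr1 => ->; exact: P'0.
move=> r r1; apply: (D_le P P') => // x /andP[x1 _].
- by apply: PD; lra.
- by apply/ltW/P'0; lra.
Qed.

Lemma emden_fowler_pot_le r : pot f (v r) <= v r ^+ 2 * v r `^ (p - 1).
Proof.
have W0 := ltW (vpos r); have q_1 := q1.
have -> : v r ^+ 2 * v r `^ (p - 1) = v r * v r `^ p.
  by rewrite expr2 -mulrA mulr_powRB1//; slra.
rewrite emden_fowler_pot.
have frac (a b x y : R) : 0 <= a -> 0 <= b -> 0 <= y -> y <= x -> a / (b + 1) * y <= a * x.
  move=> a0 b0 y0 yx; apply: ler_pM => //; first by rewrite divr_ge0//; lra.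
  by rewrite ler_piMr// invf_le1; lra.
have X0 : 0 <= v r * v r `^ p by rewrite mulr_ge0// powR_ge0.
have Y0 : 0 <= v r * v r `^ q by rewrite mulr_ge0// powR_ge0.
have YX : v r * v r `^ q <= v r * v r `^ p by rewrite ler_wpM2l.
move: X0 Y0 YX; move: (v r * v r `^ p) (v r * v r `^ q) => X Y X0 Y0 YX.
have h1 : be / (p + 1) * X <= be * X by apply: frac => //; slra.
have h2 : ga / (q + 1) * Y <= ga * X by apply: frac => //; slra.
have : (be + ga) * X = X by rewrite -[RHS]mul1r; congr (_ * _); slra.
lra.
Qed.

(* By the mean value theorem, |v'| <= v r / r somewhere between r and 2 r. *)
Lemma pohozaev_small C r : 0 <= C -> (forall r, 0 < r -> r ^+ n.+1 * v r ^+ 2 <= C) -> 1 <= r ->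
  exists2 d, r < d & P d <= C * 2 ^+ n.+1 * (M + 2) / r + C * v r `^ (p - 1).
Proof.
move=> C0 upper r1; have r0 : 0 < r by lra.
have rr : r < 2 * r by lra.
have [d /andP[rd dr] dE] := D_mvt v dv r (2 * r) rr (fun x _ => cv x)
  (fun x h => vD x (lt_trans r0 (proj1 (andP h)))).
exists d => //; have d0 : 0 < d by lra.
have Vd : v d <= v r by apply: vdecr; exact: ltW.
have y0 : 0 <= - dv d by rewrite oppr_ge0 dv_le0// ltW.
have yr : - dv d <= v r / r.
  rewrite ler_pdivlMr//; have := v0 (2 * r); move: dE.
  have -> : 2 * r - r = r by ring.
  lra.
have T2 : d ^+ n.+1 * pot f (v d) <= C * v r `^ (p - 1).
  apply: (@le_trans _ _ (d ^+ n.+1 * v d ^+ 2 * v d `^ (p - 1))).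
    by rewrite -mulrA ler_pM2l ?exprn_gt0//; exact: emden_fowler_pot_le.
  apply: ler_pM; first by rewrite mulr_ge0 ?sqr_ge0 ?exprn_ge0 ?(ltW d0).
  - exact: powR_ge0.
  - exact: upper.
  - by apply: ge0_ler_powR; rewrite ?nnegrE//; slra.
have up := upper r r0; have W0 := v0 d; have V0 := v0 r.
move: T2; rewrite /pohozaev /energy mulrDr; move: (pot _ _) (v r `^ _) => p1_ p2_.
move: M M0 (v d) (v r) (dv d) W0 V0 Vd y0 yr up {dE} => m m0 W V y W0 V0 WV y0 yr up T2.
have dn : d ^+ n <= 2 ^+ n * r ^+ n.
  by rewrite -exprMn; apply: lerXn2r; rewrite ?nnegrE; lra.
have dn0 : 0 <= d ^+ n by rewrite exprn_ge0// ltW.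
have rn0 : 0 <= r ^+ n by rewrite exprn_ge0// ltW.
rewrite (exprS 2 n); move: (2 ^+ n) (exprn_ge0 n (ler0n R 2)) dn => t t0 dn.
(* Each term of the functional that contains v' is controlled by d^n v(r)^2 / r. Since d < 2 r and
   r^n v(r)^2 <= C for r >= 1, this is at most [Z] = 2^n C / r. *)
pose Z := t * (C / r).
have Z0 : 0 <= Z by rewrite mulr_ge0// divr_ge0// ltW.
have key : d ^+ n * (V ^+ 2 / r) <= Z.
  apply: (@le_trans _ _ (t * r ^+ n * (V ^+ 2 / r))).
    by rewrite ler_wpM2r// divr_ge0 ?sqr_ge0// ltW.
  rewrite -mulrA ler_wpM2l// mulrA ler_pM2r ?invr_gt0//.
  apply: le_trans up; rewrite (exprS r n) -mulrA ler_peMl//.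
  by rewrite mulr_ge0// sqr_ge0.
have Vr : V ^+ 2 / r = V * (V / r) by rewrite expr2 mulrA.
have Vr0 : 0 <= V / r by rewrite divr_ge0// ltW.
have T1 : d ^+ n.+1 * (y ^+ 2 / 2) <= Z.
  apply: le_trans key; rewrite exprS [d * _]mulrC -mulrA ler_wpM2l//.
  have : y ^+ 2 <= (V / r) ^+ 2 by rewrite -sqrrN ler_sqr ?nnegrE.
  move=> s2; have : d * y ^+ 2 <= 2 * r * (V / r) ^+ 2.
    by apply: ler_pM => //; [exact: ltW|exact: sqr_ge0|exact: ltW].
  have -> : 2 * r * (V / r) ^+ 2 = 2 * (V ^+ 2 / r) by field; rewrite gt_eqF.
  by rewrite mulrA; lra.
have z0 : 0 <= W * (d ^+ n * - y) by rewrite !mulr_ge0.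
have z1 : W * (d ^+ n * - y) <= Z.
  by apply: le_trans key; rewrite mulrCA ler_wpM2l// Vr; apply: ler_pM.
have : (m - 1) / 2 * (W * (d ^+ n * y)) <= (m + 1) * Z.
  have -> : (m - 1) / 2 * (W * (d ^+ n * y)) = (1 - m) / 2 * (W * (d ^+ n * - y)) by ring.
  apply: (@le_trans _ _ ((m + 1) * (W * (d ^+ n * - y)))).
    by rewrite ler_wpM2r//; lra.
  by rewrite ler_wpM2l//; lra.
have -> : C * (2 * t) * (m + 2) / r = 2 * (m + 2) * Z by rewrite /Z; field; rewrite gt_eqF.
have : 0 <= m * Z by rewrite mulr_ge0.
lra.
Qed.

(** The functional increases from a positive value at 1, yet [pohozaev_small] finds points far out
    where it is arbitrarily small. *)
Lemma emden_fowler_pos_absurd : False.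
Proof.
have [C C0 upper] := emden_fowler_upper; have [P1 Pmono] := pohozaev_incr.
have p1' : 0 < p - 1 by rewrite subr_gt0.
pose K := C * 2 ^+ n.+1 * (M + 2).
have K0 : 0 <= K by rewrite !mulr_ge0 ?exprn_ge0 ?addr_ge0.
(* The choice of e gives C e^(p-1) <= P 1 / 2. The radius r below is large enough for v r < e,
   through r v(r)^2 <= C, and for K / r < P 1 / 2. *)
pose e := (P 1 / (2 * (C + 1))) `^ (p - 1)^-1.
have C1 : 0 < C + 1 by rewrite ltr_wpDl.
have arg0 : 0 < P 1 / (2 * (C + 1)) by rewrite divr_gt0// mulr_gt0.
have e0 : 0 < e by exact: powR_gt0.
have ee : e `^ (p - 1) = P 1 / (2 * (C + 1)).
  by rewrite /e -powRrM mulVf ?powRr1 ?(ltW arg0)// gt_eqF.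
have e20 : 0 < e ^+ 2 by rewrite exprn_gt0.
pose r := 1 + 2 * K / P 1 + C / e ^+ 2.
have h1 : 0 <= 2 * K / P 1 by rewrite divr_ge0 ?(ltW P1)// mulr_ge0.
have h2 : 0 <= C / e ^+ 2 by rewrite divr_ge0 ?(ltW e20).
have r1 : 1 <= r by rewrite /r; lra.
have r0 : 0 < r by exact: lt_le_trans r1.
have Ve : v r < e.
  rewrite -ltr_sqr ?nnegrE ?(ltW e0)//; have u := upper r r0.
  have : r * v r ^+ 2 <= C.
    apply: le_trans u; rewrite ler_wpM2r ?sqr_ge0// exprS ler_peMr ?(ltW r0)//.
    by rewrite exprn_ege1.
  move=> rv; rewrite -(ltr_pM2l r0); apply: (le_lt_trans rv).
  by rewrite -ltr_pdivrMr// /r; lra.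
have [d rd Pd] := pohozaev_small C r C0 upper r1.
have Kr : K / r < P 1 / 2.
  rewrite ltr_pdivrMr//.
  have -> : P 1 / 2 * r = P 1 / 2 * (1 + C / e ^+ 2) + K by rewrite /r; field; rewrite !gt_eqF.
  by rewrite ltrDr mulr_gt0 ?divr_gt0// ltr_pwDl.
have CV : C * v r `^ (p - 1) <= P 1 / 2.
  have : v r `^ (p - 1) <= e `^ (p - 1).
    by apply: ge0_ler_powR; rewrite ?nnegrE ?(ltW p1') ?(ltW e0) ?(ltW Ve).
  rewrite ee => le_; apply: (@le_trans _ _ (C * (P 1 / (2 * (C + 1))))).
    by rewrite ler_wpM2l.
  have -> : C * (P 1 / (2 * (C + 1))) = P 1 / 2 * (C / (C + 1)) by field; rewrite gt_eqF.
  by rewrite ler_piMr ?divr_ge0 ?(ltW P1)// ler_pdivrMr// mul1r lerDl.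
have d1 : 1 <= d by exact: le_trans r1 (ltW rd).
by have := Pmono d d1; move: Pd; rewrite -/K; lra.
Qed.

End emden_fowler.

Lemma emden_fowler_crosses {R : realType} (n : nat) (p q be ga : R) (v : R -> R) :
  1 < p -> p < q -> 0 <= be -> 0 <= ga -> 0 + be + ga = 1 -> q = 1 + 4 / n.+1%:R ->
  continuous v -> (forall r, v r = step n (nlc p q 0 be ga) v r) -> exists r, v r < 0.
Proof.
move=> p1 pq be0 ga0 abg qE cv vE; apply: contrapT => nneg.
apply: (emden_fowler_pos_absurd n p q be ga v) => // r.
by rewrite leNgt; apply/negP => vr; apply: nneg; exists r.
Qed.

(** * Rapidly decreasing radial functions *)

Section poly_exp.
Context {R : realType}.
Implicit Types (r k : R).

Lemma poly_exp_bounded (m : nat) k : 0 < k ->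
  exists2 C : R, 0 < C & forall r, 0 <= r -> r ^+ m * expR (- (k * r)) <= C.
Proof.
move=> k0; have c0 : 0 < m.+1`!%:R / k ^+ m.+1 by rewrite divr_gt0 ?exprn_gt0// ltr0n fact_gt0.
exists (1 + m.+1`!%:R / k ^+ m.+1); first by rewrite ltr_wpDr// ltW.
move=> r r0; have kr : 0 <= k * r by rewrite mulr_ge0// ltW.
have e0 := expR_gt0 (k * r); rewrite expRN ler_pdivrMr//.
have h1 : 1 <= expR (k * r) by rewrite -expR0 ler_expR.
have h2 : r ^+ m.+1 <= m.+1`!%:R / k ^+ m.+1 * expR (k * r).
  have : (k * r) ^+ m.+1 / m.+1`!%:R <= expR (k * r).
    by apply: le_trans (expR_ge1Dxn m kr); rewrite lerDr.
  rewrite ler_pdivrMr ?ltr0n ?fact_gt0// exprMn mulrAC ler_pdivlMr ?exprn_gt0//.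
  by rewrite mulrC [leRHS]mulrC.
have h3 : r ^+ m <= 1 + r ^+ m.+1.
  have [r1|r1] := leP r 1.
    by apply: (@le_trans _ _ 1); rewrite ?exprn_ile1// lerDl exprn_ge0.
  rewrite exprS; apply: (@le_trans _ _ (r * r ^+ m)); last by rewrite lerDr.
  by rewrite ler_peMl ?exprn_ge0// ltW.
by rewrite mulrDl mul1r (le_trans h3)// lerD.
Qed.

End poly_exp.

Section tower.
Context {R : realType}.
Implicit Types (f g h : R -> R) (r : R) (m k : nat).

(* [tower m h]: h can be differentiated m times by r^-1 d/dr, continuously up to 0. *)
Fixpoint tower m h : Prop := continuous h /\
  if m is m'.+1 then exists2 h1, tower m' h1 & forall r, 0 < r -> is_derive r 1 h (r * h1 r)
  else True.

Lemma tower_cont m h : tower m h -> continuous h.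
Proof. by case: m => [|m] []. Qed.

Lemma towerW m h : tower m.+1 h -> tower m h.
Proof.
elim: m h => [|m IH] h [ch [h1 Th1 Dh]]; split => //.
by exists h1 => //; exact: IH.
Qed.

Lemma tower_cst m (a : R) : tower m (fun=> a).
Proof.
elim: m a => [|m IH] a; split; try (by move=> ?; exact: C_cst); first by [].
by exists (fun=> 0); [exact: IH|move=> r _; rewrite mulr0; exact: D_cst].
Qed.

Lemma tower_add m f g : tower m f -> tower m g -> tower m (fun r => f r + g r).
Proof.
elim: m f g => [|m IH] f g [cf Tf] [cg Tg]; split.
- by move=> r; apply: (C_add r f g); [exact: cf|exact: cg].
- by [].
- by move=> r; apply: (C_add r f g); [exact: cf|exact: cg].
- case: Tf => f1 Tf1 Df; case: Tg => g1 Tg1 Dg.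
  exists (fun r => f1 r + g1 r); first exact: IH.
  by move=> r r0; rewrite mulrDr; exact: D_add _ _ _ _ _ (Df r r0) (Dg r r0).
Qed.

Lemma tower_mul m f g : tower m f -> tower m g -> tower m (fun r => f r * g r).
Proof.
elim: m f g => [|m IH] f g Tf Tg.
  split => // r; apply: (C_mul r f g); [exact: tower_cont Tf r|exact: tower_cont Tg r].
split; first by move=> r; apply: (C_mul r f g); [exact: tower_cont Tf r|exact: tower_cont Tg r].
case: (Tf) => [_ [f1 Tf1 Df]]; case: (Tg) => [_ [g1 Tg1 Dg]].
exists (fun r => f1 r * g r + f r * g1 r).
  by apply: tower_add; apply: IH => //; exact: towerW.
move=> r r0; apply: D_eq (D_mul _ _ _ _ _ (Df r r0) (Dg r r0)) _; ring.
Qed.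

Lemma avg_deriv k h r : continuous h -> 0 < r ->
  is_derive r 1 (avg k h) ((h r - k.+1%:R * avg k h r) / r).
Proof.
move=> ch r0; have rk : r ^+ k.+1 != 0 by rewrite expf_neq0// gt_eqF.
apply: (D_near _ (fun t => t ^+ k.+1 * avg k h t * (t ^+ k.+1)^-1) _ _ 0 (r + 1)).
- by rewrite r0 ltrDl ltr01.
- by move=> t /andP[t0 _]; rewrite mulrAC mulfV ?mul1r// expf_neq0// gt_eqF.
have D1 := D_inv r (fun t => t ^+ k.+1) _ rk (D_pow _ _ _ k.+1 (D_id r)).
apply: D_eq (D_mul _ _ _ _ _ (avg_D k h r ch r0) D1) _.
have rk0 : r ^+ k != 0 by rewrite expf_neq0// gt_eqF.
rewrite /= !exprS; move: (avg k h r) (k.+1%:R : R) (r ^+ k) rk0 => a N z z0.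
by field; rewrite z0 gt_eqF.
Qed.

(* Integration by parts in t^k h. *)
Lemma avg_parts k h h1 r : continuous h -> continuous h1 ->
  (forall r, 0 < r -> is_derive r 1 h (r * h1 r)) -> 0 < r ->
  h r - k.+1%:R * avg k h r = r ^+ 2 * avg k.+2 h1 r.
Proof.
move=> ch ch1 Dh r0.
pose H t := t ^+ k.+1 * h t - k.+1%:R * (t ^+ k.+1 * avg k h t) - t ^+ k.+3 * avg k.+2 h1 t.
have Cp m x : {for x, continuous (fun t : R => t ^+ m)} by apply: C_pow; exact: C_id.
have : H 0 = H r.
  apply: (D_const H); first exact: ltW.
  - move=> x _; apply: C_sub; [apply: C_sub|].
    + by apply: C_mul; [exact: Cp|exact: ch].
    + by apply: C_mul; [exact: C_cst|apply: C_mul; [exact: Cp|exact: avg_cont]].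
    + by apply: C_mul; [exact: Cp|exact: avg_cont].
  - move=> x /andP[x0 _].
    have D1 := D_mul _ _ _ _ _ (D_pow _ _ _ k.+1 (D_id x)) (Dh x x0).
    have D2 := D_scale _ _ _ k.+1%:R (avg_D k h x ch x0).
    have D3 := avg_D k.+2 h1 x ch1 x0.
    apply: D_eq (D_sub _ _ _ _ _ (D_sub _ _ _ _ _ D1 D2) D3) _.
    by rewrite /= !exprS; ring.
rewrite /H !expr0n/= !mul0r mulr0 !subr0 => /esym/subr0_eq.
have rk : r ^+ k.+1 != 0 by rewrite expf_neq0// gt_eqF.
rewrite mulrCA -mulrBr -[k.+3]/(2 + k.+1)%N exprD -mulrA mulrCA => /(mulfI rk).
by [].
Qed.

(** The operator r^-1 d/dr sends [avg k h] to [avg k.+2 h1]: averaging loses no derivative and only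
    raises the weight. *)
Lemma tower_avg m k h : tower m h -> tower m (avg k h).
Proof.
elim: m k h => [|m IH] k h Th.
  by split=> //; apply: avg_cont; exact: tower_cont Th.
split; first by apply: avg_cont; exact: tower_cont Th.
have [ch [h1 Th1 Dh]] := Th; exists (avg k.+2 h1); first exact: IH.
move=> r r0; apply: D_eq (avg_deriv k h r ch r0) _.
rewrite (avg_parts k h h1 r ch (tower_cont _ _ Th1) Dh r0).
by field; rewrite gt_eqF.
Qed.

Definition rapid h := forall k, exists C : R, forall r, 0 <= r -> r ^+ k * `|h r| <= C.

(** The radial counterpart of the Schwartz class. The operator r^-1 d/dr is the right one because
    the i-th partial derivative of h(|x|) is x_i h1(|x|) when h' = r h1. *)
Fixpoint rtower m h : Prop := [/\ continuous h, rapid h &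
  if m is m'.+1 then exists2 h1, rtower m' h1 & forall r, 0 < r -> is_derive r 1 h (r * h1 r)
  else True].

Lemma rapid_scale h (c k : R) : 0 < k -> rapid h -> rapid (fun r => c * h (k * r)).
Proof.
move=> k0 rh m; have [C hC] := rh m; exists (`|c| * C / k ^+ m) => r r0.
have kr : 0 <= k * r by rewrite mulr_ge0// ltW.
rewrite ler_pdivlMr ?exprn_gt0// normrM.
have -> : r ^+ m * (`|c| * `|h (k * r)|) * k ^+ m = `|c| * ((k * r) ^+ m * `|h (k * r)|).
  by rewrite exprMn; ring.
by rewrite ler_wpM2l// hC.
Qed.

Lemma rtower_scale m h (c k : R) : 0 < k -> rtower m h -> rtower m (fun r => c * h (k * r)).
Proof.
move=> k0; have cont h' : continuous h' -> forall c', continuous (fun r => c' * h' (k * r)).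
  move=> ch c' r; apply: (C_mul r (fun=> c')); first exact: C_cst.
  apply: (C_comp r h'); first exact: ch.
  by apply: C_mul; [exact: C_cst|exact: C_id].
elim: m c h => [|m IH] c h [ch rh Th]; split => //; try exact: cont; try exact: rapid_scale.
case: Th => h1 Th1 Dh; exists (fun r => c * k ^+ 2 * h1 (k * r)); first exact: IH.
move=> r r0; have kr : 0 < k * r by rewrite mulr_gt0.
have D1 := D_comp r h (fun t => k * t) _ _ (Dh _ kr) (D_scale _ _ _ k (D_id r)).
by apply: D_eq (D_scale _ _ _ c D1) _; ring.
Qed.

End tower.

(** * Smoothness and decay of all derivatives of a ground state *)

Section profile_regularity.
Context {R : realType} (n : nat) (p q al be ga : R) (v : R -> R).
Hypotheses (p1 : 1 < p) (pq : p < q).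
Hypotheses (al0 : 0 < al) (be0 : 0 <= be) (ga0 : 0 <= ga) (abg : al + be + ga = 1).
Implicit Types (a b r s t : R).

Local Ltac hyps := have ? := p1; have ? := pq; have ? := al0; have ? := be0;
  have ? := ga0; have ? := abg.
Local Ltac slra := hyps; lra.

Local Notation f := (nlc p q al be ga).
Local Notation dv := (slope n f v).

Hypotheses (cv : continuous v) (vE : forall r, v r = step n f v r).
Hypothesis gv : ground n f v.

Let al0' := ltW al0.
Let vpos := ground_pos n p q al be ga v p1 pq al0' be0 ga0 abg cv vE gv.
Let v01 := ground01 n p q al be ga v p1 pq al0' be0 ga0 abg cv vE gv.
Let dvneg := ground_dv n p q al be ga v p1 pq al0' be0 ga0 abg cv vE gv.
Let vD := v_D n p q al be ga v p1 pq al0' be0 ga0 abg cv vE.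
Let dvD := dv_D n p q al be ga v p1 pq al0' be0 ga0 abg cv.
Let dvC := dv_cont n p q al be ga v p1 pq al0' be0 ga0 abg cv.
Let fluxD := flux_D n p q al be ga v p1 pq al0' be0 ga0 abg cv.
Let fluxC := flux_cont n p q al be ga v p1 pq al0' be0 ga0 abg cv.
Let k := rate p al.
Let k0 : 0 < k := rate_gt0 p p1 al al0.

Lemma fvE r : f (v r) = - (al * v r) + be * v r `^ p + ga * v r `^ q.
Proof. by rewrite nlcE. Qed.

Lemma ground_rapid : rapid v.
Proof.
move=> m; have [C C0 hC] := poly_exp_bounded m k k0.
exists (C * expR (k * onset n p al)) => r r0; rewrite gtr0_norm//.
have := ground_decay n p q al be ga v p1 pq al0' be0 ga0 abg cv vE gv al r al0 (lexx _) r0.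
rewrite -/k mulrBr expRD => h.
apply: (@le_trans _ _ (r ^+ m * (expR (k * onset n p al) * expR (- (k * r))))).
  by rewrite ler_wpM2l ?exprn_ge0.
by rewrite mulrCA mulrC ler_wpM2r ?expR_ge0// hC.
Qed.

(** For large t, X = t^n (v' + C v) decreases. If it were negative somewhere, t^n v' would stay
    below a negative constant from there on; but the mean value theorem gives c in (t, 2 t) with c^n
    |v'(c)| <= 2^n t^n v(t) / t, which tends to 0 by the rapid decay. So X >= 0, that is, - v' <= C
    v for large r, and continuity covers bounded r. *)
Lemma ground_slope : exists C, forall r, 1 <= r -> `|dv r| <= C * v r.
Proof.
pose M : R := n%:R; have M0 : 0 <= M by exact: ler0n.
(* Beyond [T] both v' <= - k v and n / x <= k / 2 hold. With C = 2 al / k the derivative of [X],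
   divided by x^n, is then at most (al + al - 2 al) v = 0. *)
pose T := 1 + onset n p al + 2 * M / k.
pose C := 2 * al / k.
have C0 : 0 < C by rewrite divr_gt0// mulr_gt0.
have on0 : 1 <= onset n p al.
  by rewrite /onset lerDl; apply: divr_ge0; [exact: mulr_ge0|exact/ltW/force_gt0].
have Mk : 0 <= 2 * M / k by apply: divr_ge0; [exact: mulr_ge0|exact: ltW].
have T1 : 1 <= T by rewrite /T; lra.
have TZ : 2 * M / k <= T by rewrite /T lerDr; lra.
have TO : onset n p al <= T by rewrite /T; lra.
pose X t := t ^+ n * dv t + C * (t ^+ n * v t).
have Xdecr a b : T <= a -> a <= b -> X b <= X a.
  move=> Ta ab; apply: (D_ge X (fun x => - (x ^+ n * f (v x)) +
      C * (M / x * x ^+ n * v x + x ^+ n * dv x))) => //.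
  - move=> x _; apply: C_add; first exact: fluxC.
    apply: C_mul; first exact: C_cst.
    by apply: C_mul; [apply: C_pow; exact: C_id|exact: cv].
  - move=> x /andP[ax _]; have x0 : 0 < x by lra.
    have D1 := D_mul _ _ _ _ _ (D_pow _ _ _ n (D_id x)) (vD x x0).
    apply: D_eq (D_add _ _ _ _ _ (fluxD x x0) (D_scale _ _ _ C D1)) _.
    congr (_ + C * (_ * _ + _)); rewrite mulr1 /M; case: (n) => [|m].
      by rewrite !mul0r.
    by rewrite exprS; field; rewrite gt_eqF.
  - move=> x /andP[ax _]; have x0 : 0 < x by lra.
    have xT : T <= x by lra.
    have h1 : dv x <= - (k * v x).
      apply: (ground_dv_le n p q al be ga v p1 pq al0' be0 ga0 abg cv vE gv al x al0 (lexx _)).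
      exact: le_trans TO xT.
    have h2 : M / x <= k / 2.
      rewrite ler_pdivrMr//.
      have : k / 2 * (2 * M / k) <= k / 2 * x.
        apply: ler_wpM2l; first by apply: divr_ge0 => //; exact: ltW.
        exact: le_trans TZ xT.
      by have -> : k / 2 * (2 * M / k) = M by field; rewrite gt_eqF.
    have h3 : - f (v x) <= al * v x.
      rewrite fvE; have : 0 <= be * v x `^ p by rewrite mulr_ge0// powR_ge0.
      by have : 0 <= ga * v x `^ q by [rewrite mulr_ge0// powR_ge0]; lra.
    have -> : - (x ^+ n * f (v x)) + C * (M / x * x ^+ n * v x + x ^+ n * dv x)
      = x ^+ n * (- f (v x) + C * (M / x * v x) + C * dv x) by ring.
    rewrite pmulr_rle0 ?exprn_gt0//.
    have h4 : C * (M / x * v x) <= C * (k / 2 * v x) by rewrite ler_pM2l// ler_pM2r.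
    have h5 : C * dv x <= C * - (k * v x) by rewrite ler_pM2l.
    have h6 : C * (k / 2 * v x) = al * v x by rewrite /C; field; rewrite gt_eqF.
    lra.
have X0 r : T <= r -> 0 <= X r.
  move=> Tr; rewrite leNgt; apply/negP => Xr.
  have [B hB] := ground_rapid n.
  have B0 : 0 <= B by apply: le_trans (hB 0 (lexx _)); rewrite mulr_ge0// exprn_ge0.
  pose e := - X r; have e0 : 0 < e by rewrite oppr_gt0.
  pose t := r + 2 ^+ n * B / e.
  have rt : r <= t by rewrite lerDl divr_ge0 ?mulr_ge0 ?exprn_ge0// ltW.
  have t0 : 0 < t by lra.
  have tt : t < 2 * t by lra.
  have [c /andP[tc ct] cE] := D_mvt v dv t (2 * t) tt (fun x _ => cv x)
    (fun x h => vD x (lt_trans t0 (proj1 (andP h)))).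
  have c0 : 0 < c by lra.
  have cn : 0 < c ^+ n by rewrite exprn_gt0.
  have Xc : c ^+ n * dv c <= - e.
    have : X c <= X r by apply: Xdecr; lra.
    have : 0 <= C * (c ^+ n * v c).
      by apply: mulr_ge0; [exact: ltW|apply: mulr_ge0; [exact: ltW|exact/ltW/vpos]].
    by rewrite /e /X; lra.
  have vt : - dv c * t <= v t.
    by have := vpos (2 * t); move: cE; have -> : 2 * t - t = t by [ring]; lra.
  have : e * t <= c ^+ n * v t.
    apply: (@le_trans _ _ (c ^+ n * (- dv c * t))); last by rewrite ler_pM2l.
    by rewrite mulrA ler_pM2r// mulrN; lra.
  have : c ^+ n * v t <= 2 ^+ n * B.
    apply: (@le_trans _ _ (2 ^+ n * (t ^+ n * v t))).
      rewrite mulrA ler_pM2r// -exprMn; apply: lerXn2r; rewrite ?nnegrE; lra.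
    by rewrite ler_pM2l ?exprn_gt0//; have := hB t (ltW t0); rewrite (gtr0_norm (vpos t)).
  have -> : e * t = e * r + 2 ^+ n * B by rewrite /t; field; rewrite gt_eqF.
  have : 0 < e * r by rewrite mulr_gt0//; lra.
  lra.
have cz : continuous (fun r => dv r / v r).
  move=> r; apply: (C_mul r dv); first exact: dvC.
  by apply: C_inv; [rewrite gt_eqF|exact: cv].
have [C' C'0 hC'] := cont_bounded (fun r => dv r / v r) 1 T T1 cz.
exists (C + C') => r r1; have [rT|Tr] := leP r T.
  have := hC' r; rewrite r1 rT => /(_ isT); rewrite normrM normfV (gtr0_norm (vpos r)).
  rewrite ler_pdivrMr// => h; apply: (le_trans h).
  by rewrite ler_pM2r// lerDr ltW.
have rn : 0 < r ^+ n by rewrite exprn_gt0//; lra.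
have : - dv r <= C * v r.
  rewrite -(ler_pM2l rn); have := X0 r (ltW Tr); rewrite /X; lra.
have := dvneg r; rewrite ler0_norm; last by apply: dvneg; lra.
have : 0 <= C' * v r by rewrite mulr_ge0 ?ltW.
lra.
Qed.

(* r^-1, v'/v and the powers of v are bounded for r >= 1 and generate an algebra
   that is stable under differentiation. *)
Inductive balg : (R -> R) -> Prop :=
| balg_cst a : balg (fun=> a)
| balg_inv : balg (fun r => r^-1)
| balg_log : balg (fun r => dv r / v r)
| balg_pow a : 0 <= a -> balg (fun r => v r `^ a)
| balg_add g h : balg g -> balg h -> balg (fun r => g r + h r)
| balg_mul g h : balg g -> balg h -> balg (fun r => g r * h r).

Lemma balg_bounded (b : R -> R) : balg b -> exists C, forall r, 1 <= r -> `|b r| <= C.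
Proof.
elim=> {b} [a|||a a0|g h _ [C hC] _ [C' hC']|g h _ [C hC] _ [C' hC']].
- by exists `|a|.
- exists 1 => r r1; rewrite ger0_norm ?invr_ge0; last lra.
  by rewrite invf_le1//; lra.
- have [C hC] := ground_slope; exists C => r r1.
  by rewrite normrM normfV (gtr0_norm (vpos r)) ler_pdivrMr// hC.
- by exists 1 => r _; rewrite ger0_norm ?powR_ge0// powR_le1.
- exists (C + C') => r r1; apply: (le_trans (ler_normD _ _)).
  by apply: lerD; [exact: hC|exact: hC'].
- exists (C * C') => r r1; rewrite normrM.
  by apply: ler_pM => //; [exact: hC|exact: hC'].
Qed.

Lemma balg_D (b : R -> R) : balg b ->
  exists2 b', balg b' & forall r, 0 < r -> is_derive r 1 b (b' r).
Proof.
elim=> {b} [a|||a a0|g h Bg [g' Bg' Dg] Bh [h' Bh' Dh]|g h Bg [g' Bg' Dg] Bh [h' Bh' Dh]].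
- by exists (fun=> 0); [exact: balg_cst|move=> r _; exact: D_cst].
- exists (fun r => -1 * (r^-1 * r^-1)).
    by apply: balg_mul (balg_cst _) _; apply: balg_mul; exact: balg_inv.
  move=> r r0; have rn : r != 0 by rewrite gt_eqF.
  by apply: D_eq (D_inv r (fun t => t) _ rn (D_id r)) _; field.
(* The profile equation becomes the Riccati equation z' = - z^2 - n / r z + al - be v^(p-1) - ga
   v^(q-1). *)
- pose z r := dv r / v r.
  exists (fun r => -1 * (z r * z r) + (- n%:R * (r^-1 * z r) +
    (al + (- be * v r `^ (p - 1) + - ga * v r `^ (q - 1))))).
    apply: balg_add; first by apply: balg_mul (balg_cst _) _; apply: balg_mul; exact: balg_log.
    apply: balg_add.
      by apply: balg_mul (balg_cst _) _; apply: balg_mul; [exact: balg_inv|exact: balg_log].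
    apply: balg_add (balg_cst _) _; apply: balg_add;
      by apply: balg_mul (balg_cst _) _; apply: balg_pow; slra.
  move=> r r0; have vn : v r != 0 by rewrite gt_eqF.
  apply: D_eq (D_mul _ _ _ _ _ (dvD r r0) (D_inv r v _ vn (vD r r0))) _.
  have -> : v r `^ (p - 1) = v r `^ p / v r.
    by rewrite -(mulr_powRB1 (ltW (vpos r)) (lt_trans ltr01 p1)) mulrC mulKf.
  have -> : v r `^ (q - 1) = v r `^ q / v r.
    by rewrite -(mulr_powRB1 (ltW (vpos r)) (lt_trans (lt_trans ltr01 p1) pq)) mulrC mulKf.
  rewrite fvE /z; move: (dv r) (v r) vn (v r `^ p) (v r `^ q) => y x xn P Q.
  by field; rewrite xn gt_eqF.
- exists (fun r => a * (v r `^ a * (dv r / v r))).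
    apply: balg_mul (balg_cst _) _; apply: balg_mul; [exact: balg_pow|exact: balg_log].
  move=> r r0; apply: D_eq (D_powR _ _ _ a (vpos r) (vD r r0)) _.
  rewrite powRB ?powRr1 ?(ltW (vpos r))//; last by rewrite (gt_eqF (vpos r)) implybT.
  by field; rewrite gt_eqF.
- exists (fun r => g' r + h' r); first exact: balg_add.
  by move=> r r0; exact: D_add _ _ _ _ _ (Dg r r0) (Dh r r0).
- exists (fun r => g' r * h r + g r * h' r).
    by apply: balg_add; exact: balg_mul.
  by move=> r r0; exact: D_mul _ _ _ _ _ (Dg r r0) (Dh r r0).
Qed.

Lemma balg_rapid (h b : R -> R) : continuous h -> balg b ->
  (forall r, 1 < r -> h r = v r * b r) -> rapid h.
Proof.
move=> ch Bb hb j; have [C C0 hC] := cont_bounded h 0 1 ler01 ch.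
have [B hB] := balg_bounded b Bb; have [K hK] := ground_rapid j.
have B0 : 0 <= B by apply: le_trans (hB 1 (lexx _)).
exists (C + K * B) => r r0.
have K0 : 0 <= K by apply: le_trans (hK 0 (lexx _)); rewrite mulr_ge0// exprn_ge0.
have KB : 0 <= K * B by exact: mulr_ge0.
have rj : 0 <= r ^+ j by exact: exprn_ge0.
have [r1|r1] := leP r 1.
  have h1 : `|h r| <= C by apply: hC; rewrite r0.
  have h2 : r ^+ j <= 1 by exact: exprn_ile1.
  have : r ^+ j * `|h r| <= 1 * C by exact: ler_pM.
  lra.
have h1 : r ^+ j * `|v r| * `|b r| <= K * B.
  by apply: ler_pM; rewrite ?mulr_ge0//; [exact: hK|apply: hB; exact: ltW].
by rewrite hb// normrM mulrA; lra.
Qed.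

(** If h = v b then h1 = v (r^-1 ((v' / v) b + b')), and the second factor is again in [balg]; thus
    each derivative is v times a bounded function and inherits the rapid decay of v. *)
Lemma tower_rtower m (h b : R -> R) : balg b -> (forall r, 1 < r -> h r = v r * b r) ->
  tower m h -> rtower m h.
Proof.
elim: m h b => [|m IH] h b Bb hb Th; have ch := tower_cont _ _ Th.
  by split=> //; exact: balg_rapid Bb hb.
have [_ [h1 Th1 Dh]] := Th; split=> //; first exact: balg_rapid Bb hb.
exists h1 => //.
have [b' Bb' Db] := balg_D b Bb.
apply: (IH h1 (fun r => r^-1 * (dv r / v r * b r + b' r))) => //.
  by apply: balg_mul balg_inv _; apply: balg_add => //; apply: balg_mul balg_log _.
move=> r r1; have r0 : 0 < r by lra.
have Dvb : is_derive r 1 h (dv r * b r + v r * b' r).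
  apply: (D_near _ (fun t => v t * b t) _ _ 1 (r + 1)).
  - by rewrite r1 ltrDl ltr01.
  - by move=> t /andP[t1 _]; rewrite hb.
  - exact: D_mul _ _ _ _ _ (vD r r0) (Db r r0).
have := D_uniq _ _ _ _ Dvb (Dh r r0) => E.
apply: (mulfI (lt0r_neq0 r0)); rewrite -E; field.
by rewrite !gt_eqF.
Qed.

(** Bootstrap: v' = - r [avg n (f \o v)] and averages keep the regularity of f(v), so v gains one
    derivative at each round. All real powers of v, which is positive, are carried along, since f(v)
    contains two of them and the derivative of v^a involves v^(a-1). *)
Lemma ground_tower m : tower m v.
Proof.
have fvfun : f \o v = fun r => - al * v r + (be * v r `^ p + ga * v r `^ q).
  by apply/funext => r /=; rewrite fvE; ring.
have cpow a : continuous (fun r => v r `^ a).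
  move=> r; apply: (C_comp r (fun t => t `^ a)); last exact: cv.
  exact: D_cont _ _ _ (D_powR _ _ _ a (vpos r) (D_id _)).
suff H : tower m v /\ forall a, tower m (fun r => v r `^ a) by case: H.
elim: m => [|m [Tv Tp]]; first by split=> [|a]; split=> //; exact: cpow.
have T1 : tower m (fun r => -1 * avg n (f \o v) r).
  apply: tower_mul; first exact: tower_cst.
  apply: tower_avg; rewrite fvfun; apply: tower_add.
    by apply: tower_mul => //; exact: tower_cst.
  by apply: tower_add; apply: tower_mul => //; exact: tower_cst.
split.
  split=> //; exists (fun r => -1 * avg n (f \o v) r) => // r r0.
  by apply: D_eq (vD r r0) _; rewrite /slope; ring.
move=> a; split; first exact: cpow.
exists (fun r => a * v r `^ (a - 1) * (-1 * avg n (f \o v) r)).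
  by apply: tower_mul => //; apply: tower_mul => //; exact: tower_cst.
move=> r r0; apply: D_eq (D_powR _ _ _ a (vpos r) (vD r r0)) _.
by rewrite /slope; ring.
Qed.

Lemma ground_rtower m : rtower m v.
Proof.
apply: (tower_rtower m v (fun=> 1)); [exact: balg_cst| |exact: ground_tower].
by move=> r _; rewrite mulr1.
Qed.

End profile_regularity.

(** * Calculus of radial functions on R^d *)

Section radial_calculus.
Context {R : realType} {d : nat}.
Implicit Types (F G : 'rV[R]_d -> R) (x v : 'rV[R]_d) (h : R -> R) (r : R) (i j : 'I_d) (m k : nat).

Lemma line_is_derive F x v (l : R) :
  is_derive (0 : R) (1 : R) (fun t : R => F (t *: v + x)) l -> is_derive x v F l.
Proof.
have E : (fun h : R => h^-1 *: (((fun t : R => F (t *: v + x)) \o shift 0) (h *: 1)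
    - F (0 *: v + x))) =
  (fun h : R => h^-1 *: ((F \o shift x) (h *: v) - F x)).
  by apply/funext => t; rewrite /= scale0r add0r addr0 [t *: 1]mulr1.
move=> [dv <-]; apply: DeriveDef.
  by move: dv; rewrite /derivable E.
by rewrite /derive E.
Qed.

Definition sumsq x : R := \sum_i x ord0 i ^+ 2.

Lemma sumsq_ge0 x : 0 <= sumsq x.
Proof. by apply: sumr_ge0 => i _; exact: sqr_ge0. Qed.

Lemma enorm_ge0 x : 0 <= enorm x. Proof. exact: sqrtr_ge0. Qed.

Lemma enorm_sqr x : enorm x ^+ 2 = sumsq x.
Proof. by rewrite sqr_sqrtr// sumsq_ge0. Qed.

Lemma coord_le_enorm x i : `|x ord0 i| <= enorm x.
Proof.
rewrite -sqrtr_sqr ler_wsqrtr// (bigD1 i)//= lerDl.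
by apply: sumr_ge0 => j _; exact: sqr_ge0.
Qed.

Lemma sumsq_differentiable x : differentiable sumsq x.
Proof.
have -> : sumsq = \sum_i (fun y : 'rV[R]_d => y ord0 i : R) ^+ 2.
  by apply/funext => y; rewrite /sumsq fct_sumE; apply: eq_bigr => i _; rewrite exprfctE.
by apply: differentiable_sum => i; apply: differentiableX; exact: differentiable_coord.
Qed.

Lemma sumsq_line x i (t : R) :
  sumsq (t *: delta_mx ord0 i + x) = sumsq x + 2 * x ord0 i * t + t ^+ 2.
Proof.
rewrite /sumsq (bigD1 i)//= [in RHS](bigD1 i)//= !mxE !eqxx/=.
under eq_bigr => j ji do rewrite !mxE (negbTE ji) andbF mulr0 add0r.
by rewrite /=; ring.
Qed.

(** Writing h(|x|) as a constant plus [radpot h1] of |x|^2 avoids the square root, which is not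
    differentiable at the origin. The shift by 1 and the value 0 of the square root of a negative
    number make [radpot] differentiable on both sides of s = 0. *)
Definition radpot h (s : R) : R := prim (fun t => h (Num.sqrt (t - 1)) / 2) (s + 1).

Lemma radpot_cont_integrand h : continuous h ->
  continuous (fun t : R => h (Num.sqrt (t - 1)) / 2).
Proof.
move=> ch t; apply: (C_mul t (fun t => h (Num.sqrt (t - 1)))); last exact: C_cst.
apply: (C_comp t h); first exact: ch.
apply: (C_comp t Num.sqrt); first exact: sqrt_continuous.
by apply: C_sub; [exact: C_id|exact: C_cst].
Qed.

Lemma radpot_D h (s : R) : continuous h -> 0 <= s ->
  is_derive s 1 (radpot h) (h (Num.sqrt s) / 2).
Proof.
move=> ch s0; have s1 : 0 < s + 1 by lra.
have H := prim_D _ _ (radpot_cont_integrand h ch) s1.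
have Hc : is_derive s 1 (radpot h) (h (Num.sqrt (s + 1 - 1)) / 2 * (1 + 0)).
  exact: D_comp s (prim (fun t => h (Num.sqrt (t - 1)) / 2)) (fun t => t + 1) _ _ H
    (D_add _ _ _ _ _ (D_id _) (D_cst _ _)).
by apply: D_eq Hc _; rewrite addrK addr0 mulr1.
Qed.

Lemma radpotE h h1 (s : R) : continuous h -> continuous h1 ->
  (forall r, 0 < r -> is_derive r 1 h (r * h1 r)) -> 0 <= s ->
  h (Num.sqrt s) = h 0 - radpot h1 0 + radpot h1 s.
Proof.
move=> ch ch1 Dh s0.
pose H t := h (Num.sqrt t) - radpot h1 t.
have : H 0 = H s.
  apply: (D_const H) => //.
  - move=> x /andP[x0 _]; apply: C_sub; last exact: D_cont _ _ _ (radpot_D h1 x ch1 x0).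
    by apply: (C_comp x h); [exact: ch|exact: sqrt_continuous].
  - move=> x /andP[x0 _]; have sx : 0 < Num.sqrt x by rewrite sqrtr_gt0.
    have D1 := D_comp x h Num.sqrt _ _ (Dh _ sx) (is_derive1_sqrt x0).
    apply: D_eq (D_sub _ _ _ _ _ D1 (radpot_D h1 x ch1 (ltW x0))) _.
    by move: (Num.sqrt x) sx => y y0; field; rewrite gt_eqF.
by rewrite /H sqrtr0; lra.
Qed.

Lemma radial_fun_eq h h1 : continuous h -> continuous h1 ->
  (forall r, 0 < r -> is_derive r 1 h (r * h1 r)) ->
  (fun x => h (enorm x)) = (fun x => h 0 - radpot h1 0 + radpot h1 (sumsq x)).
Proof.
by move=> ch ch1 Dh; apply/funext => x; exact: radpotE (sumsq_ge0 x).
Qed.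

Lemma radial_differentiable h h1 x : continuous h -> continuous h1 ->
  (forall r, 0 < r -> is_derive r 1 h (r * h1 r)) ->
  differentiable (fun x => h (enorm x)) x.
Proof.
move=> ch ch1 Dh; rewrite (radial_fun_eq h h1 ch ch1 Dh).
apply: (@differentiableD _ _ _ (fun=> h 0 - radpot h1 0) (radpot h1 \o sumsq)).
  exact: differentiable_cst.
apply: differentiable_comp; first exact: sumsq_differentiable.
by apply/derivable1_diffP; have [] := radpot_D h1 (sumsq x) ch1 (sumsq_ge0 x).
Qed.

Lemma radial_is_derive h h1 x i : continuous h -> continuous h1 ->
  (forall r, 0 < r -> is_derive r 1 h (r * h1 r)) ->
  is_derive x (delta_mx ord0 i) (fun x => h (enorm x)) (x ord0 i * h1 (enorm x)).
Proof.
move=> ch ch1 Dh; rewrite (radial_fun_eq h h1 ch ch1 Dh).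
apply: line_is_derive; under eq_fun do rewrite sumsq_line.
pose g t : R := sumsq x + 2 * x ord0 i * t + t ^+ 2.
have Dg : is_derive (0 : R) (1 : R) g (0 + 2 * x ord0 i * 1 + 2%:R * 0 ^+ 1 * 1).
  apply: D_add _ _ _ _ _ (D_add _ _ _ _ _ (D_cst _ _) (D_scale _ _ _ _ (D_id _))) (D_pow _ _ _ 2 (D_id _)).
have g0 : g 0 = sumsq x by rewrite /g expr0n mulr0 !addr0.
have Dp : is_derive (g 0) (1 : R) (radpot h1) (h1 (Num.sqrt (g 0)) / 2).
  by apply: radpot_D; rewrite ?g0 ?sumsq_ge0.
apply: D_eq (D_add _ _ _ _ _ (D_cst _ _) (D_comp _ _ _ _ _ Dp Dg)) _.
by rewrite g0 -[Num.sqrt _]/(enorm x); field.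
Qed.

Lemma coord_mul_is_derive F x i j (l : R) : is_derive x (delta_mx ord0 j) F l ->
  is_derive x (delta_mx ord0 j) (fun x => x ord0 i * F x) ((j == i)%:R * F x + x ord0 i * l).
Proof.
move=> DF.
have Dc : is_derive x (delta_mx ord0 j) (fun x : 'rV[R]_d => x ord0 i : R) ((j == i)%:R).
  apply: line_is_derive.
  have -> : (fun t : R => (t *: delta_mx ord0 j + x) ord0 i)
      = (fun t : R => (j == i)%:R * t + x ord0 i).
    by apply/funext => t; rewrite !mxE eqxx/= mulrC eq_sym.
  apply: D_eq (D_add _ _ _ _ _ (D_scale _ _ _ _ (D_id _)) (D_cst _ _)) _.
  by rewrite mulr1 addr0.
have DM : is_derive x (delta_mx ord0 j) (fun x => x ord0 i * F x)
    (x ord0 i *: l + F x *: (j == i)%:R).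
  exact: (@is_deriveM _ _ (fun x : 'rV[R]_d => x ord0 i : R) F).
by apply: is_derive_eq DM _; rewrite addrC /GRing.scale/= [F x * _]mulrC.
Qed.

(** Sums of products of coordinates with radial functions: a class that partial derivatives
    preserve, each at the cost of one level m, and in which rapid decay survives because |x_i| <=
    |x|. *)
Inductive rpoly m : ('rV[R]_d -> R) -> Prop :=
| rpoly_base h : rtower m h -> rpoly m (fun x => h (enorm x))
| rpoly_coord i F : rpoly m F -> rpoly m (fun x => x ord0 i * F x)
| rpoly_add F G : rpoly m F -> rpoly m G -> rpoly m (fun x => F x + G x).

Lemma rtowerW m h : rtower m.+1 h -> rtower m h.
Proof.
elim: m h => [|m IH] h [ch rh [h1 Th1 Dh]]; split => //.
by exists h1 => //; exact: IH.
Qed.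

Lemma rpolyW m F : rpoly m.+1 F -> rpoly m F.
Proof.
elim=> [h Th|i {}F _ IH|{}F G _ IF _ IG].
- exact/rpoly_base/rtowerW.
- exact: rpoly_coord.
- exact: rpoly_add.
Qed.

Lemma rpoly_D m F : rpoly m.+1 F -> (forall x, differentiable F x) /\
  forall j, exists2 F', rpoly m F' & forall x, is_derive x (delta_mx ord0 j) F (F' x).
Proof.
elim=> [h Th|i {}F TF [dF IH]|{}F G _ [dF IF] _ [dG IG]].
- have [ch _ [h1 Th1 Dh]] := Th.
  have ch1 : continuous h1 by case: (m) Th1 => [|?] [].
  split=> [x|j]; first exact: radial_differentiable ch1 Dh.
  exists (fun x => x ord0 j * h1 (enorm x)); first exact/rpoly_coord/rpoly_base.
  by move=> x; exact: radial_is_derive.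
- split=> [x|j].
    by apply: (@differentiableM _ _ (fun x => x ord0 i)) => //; exact: differentiable_coord.
  have [F' TF' DF] := IH j.
  have DM x := coord_mul_is_derive F x i j _ (DF x).
  case: eqP DM => [_|_] DM.
    exists (fun x => F x + x ord0 i * F' x).
      by apply: rpoly_add; [exact: rpolyW|exact: rpoly_coord].
    by move=> x; apply: is_derive_eq (DM x) _; rewrite mul1r.
  exists (fun x => x ord0 i * F' x); first exact: rpoly_coord.
  by move=> x; apply: is_derive_eq (DM x) _; rewrite mul0r add0r.
- split=> [x|j]; first exact: differentiableD.
  have [F' TF' DF] := IF j; have [G' TG' DG] := IG j.
  exists (fun x => F' x + G' x); first exact: rpoly_add.
  by move=> x; exact: is_deriveD.
Qed.

Lemma rpoly_rapid m F k : rpoly m F -> exists C : R, forall x, enorm x ^+ k * `|F x| <= C.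
Proof.
move=> TF; elim: TF k => [h Th|i {}F _ IH|{}F G _ IF _ IG] k.
- have rh : rapid h by case: (m) Th => [|?] [].
  by have [C hC] := rh k; exists C => x; exact/hC/enorm_ge0.
- have [C hC] := IH k.+1; exists C => x; apply: le_trans (hC x).
  rewrite normrM mulrA exprSr ler_wpM2r// ler_wpM2l ?exprn_ge0 ?enorm_ge0//.
  exact: coord_le_enorm.
- have [C hC] := IF k; have [C' hC'] := IG k; exists (C + C') => x.
  apply: le_trans (lerD (hC x) (hC' x)); rewrite -mulrDr.
  by rewrite ler_wpM2l ?exprn_ge0 ?enorm_ge0// ler_normD.
Qed.

Lemma partialE i F G : (forall x, is_derive x (delta_mx ord0 i) F (G x)) -> partial i F = G.
Proof. by move=> H; apply/funext => x; exact: derive_val. Qed.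

Lemma rpoly_partials (s : seq 'I_d) m F : rpoly (size s + m) F -> rpoly m (partials s F).
Proof.
elim: s m => [//|i s IH] m; rewrite [size _]/= addSnnS => /IH /rpoly_D[_ /(_ i)[G TG DG]].
by rewrite /= (partialE _ _ _ DG).
Qed.

Lemma rpoly_schwartz F : (forall m, rpoly m F) -> schwartz F.
Proof.
move=> TF; split.
  by move=> s x; have [H _] := rpoly_D _ _ (rpoly_partials s 1 F (TF _)); exact: H.
by move=> k s; exact: rpoly_rapid (rpoly_partials s 0 F (TF _)).
Qed.

Lemma rtower_schwartz h : (forall m, rtower m h) -> schwartz (fun x => h (enorm x)).
Proof. by move=> Th; apply: rpoly_schwartz => m; exact: rpoly_base. Qed.

Lemma radial_laplacian h h1 h2 x : continuous h -> continuous h1 -> continuous h2 ->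
  (forall r, 0 < r -> is_derive r 1 h (r * h1 r)) ->
  (forall r, 0 < r -> is_derive r 1 h1 (r * h2 r)) ->
  laplacian (fun x => h (enorm x)) x = d%:R * h1 (enorm x) + enorm x ^+ 2 * h2 (enorm x).
Proof.
move=> ch ch1 ch2 Dh Dh1.
have E i : partial i (partial i (fun x => h (enorm x))) x =
    h1 (enorm x) + x ord0 i ^+ 2 * h2 (enorm x).
  rewrite (partialE _ _ _ (fun x => radial_is_derive h h1 x i ch ch1 Dh)).
  apply: derive_val; apply: is_derive_eq.
    exact: coord_mul_is_derive _ _ _ _ _ (radial_is_derive h1 h2 x i ch1 ch2 Dh1).
  by rewrite eqxx mul1r mulrA.
rewrite /laplacian (eq_bigr _ (fun i _ => E i)) big_split/= sumr_const card_ord -mulr_suml.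
by rewrite enorm_sqr mulr_natl.
Qed.

End radial_calculus.

(** * Integration on R^d *)

Section measure_rV.
Context {R : realType}.
Implicit Types (n : nat).

Lemma measurable_floor_eq (c : R) (k : int) :
  measurable [set t : R | Num.floor (c * t) = k].
Proof.
pose f : R -> R := fun t => c * t.
have mf : measurable_fun [set: R] f.
  by apply: continuous_measurable_fun => t; apply: C_mul; [exact: C_cst|exact: C_id].
rewrite (_ : mkset _ = f @^-1` `[k%:~R, (k + 1)%:~R[); last first.
  apply/seteqP; split => t /=; rewrite in_itv/=.
    by move=> <-; apply/andP; split; [exact: floor_le|exact: floorD1_gt].
  by move=> H; exact: floor_def.
by rewrite -[X in measurable X]setTI; exact: mf.
Qed.

(** The sigma-algebra is generated by the coordinates, so open sets are not measurable by
    definition. F is the pointwise limit of its compositions with the rounding [q m] to a grid of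
    mesh 1 / (m + 1), and these are constant on countably many measurable boxes. *)
Lemma measurable_continuous_rV n (F : 'rV[R]_n -> R) :
  continuous F -> measurable_fun setT F.
Proof.
move=> cF.
pose q (m : nat) (x : 'rV[R]_n) : 'rV[R]_n :=
  \row_i ((Num.floor (m.+1%:R * x ord0 i))%:~R / m.+1%:R).
apply: (@measurable_fun_cvg _ _ _ _ (fun m => F \o q m)) => [m|x _].
  move=> _ B mB; rewrite setTI.
  pose box (k : 'rV[int]_n) := [set x : 'rV[R]_n |
    forall i, [set t : R | Num.floor (m.+1%:R * t) = k ord0 i] (x ord0 i)].
  have mbox k : measurable (box k).
    apply: (@measurable_box _ (measurableTypeR R) n
      (fun i => [set t : R | Num.floor (m.+1%:R * t) = k ord0 i])) => i.
    exact: measurable_floor_eq.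
  pose G (k : 'rV[int]_n) : set 'rV[R]_n :=
    if `[< B (F (\row_i ((k ord0 i)%:~R / m.+1%:R))) >] then box k else set0.
  rewrite (_ : _ @^-1` B = \bigcup_k G k); last first.
    apply/seteqP; split => y /=.
      move=> By; exists (\row_i Num.floor (m.+1%:R * y ord0 i)) => //.
      rewrite /G; case: asboolP => [_ i /=|]; first by rewrite mxE.
      apply: contra_notP => _; rewrite (_ : (\row__ _) = q m y)//.
      by apply/rowP => i; rewrite !mxE.
    move=> [k _]; rewrite /G; case: asboolP => // Bk bk.
    rewrite (_ : q m y = \row_i ((k ord0 i)%:~R / m.+1%:R))//.
    by apply/rowP => i; rewrite !mxE; have /= -> := bk i.
  apply: countable_bigcupT_measurable; first exact: countableP.
  by move=> k; rewrite /G; case: ifP => // _; exact: measurable0.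
have /cvgrPdist_lt cFx := cF x.
apply/cvgrPdist_lt => e e0; have /nbhs_ballP[dl /= dl0 H] := cFx _ e0.
have [M hM] : exists M : nat, dl^-1 < M%:R.
  by exists (Num.bound dl^-1); apply: archi_boundP; rewrite invr_ge0 ltW.
exists M => // m /= Mm; apply: H; split=> // i j; rewrite /ball/= !mxE (ord1 i).
set N : R := m.+1%:R.
have N0 : 0 < N by rewrite ltr0n.
have Ndl : N^-1 < dl.
  rewrite invf_plt ?posrE//; apply: lt_trans hM _; by rewrite ltr_nat ltnS.
have h1 := floor_le (N * x ord0 j); have h2 := floorD1_gt (N * x ord0 j).
rewrite intrD in h2.
have -> : x ord0 j - (Num.floor (N * x ord0 j))%:~R / N =
   (N * x ord0 j - (Num.floor (N * x ord0 j))%:~R) / N.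
  by field; rewrite gt_eqF.
apply: le_lt_trans Ndl; rewrite normrM [X in _ * X]ger0_norm ?invr_ge0 ?(ltW N0)//.
by rewrite ler_piMl ?invr_ge0 ?(ltW N0)// ger0_norm; lra.
Qed.

End measure_rV.

Section integral_rV.
Context {R : realType}.
Local Notation leb := (@lebesgue_measure R).
Local Notation lebn := (@lebesgue_rV R).
Implicit Types (n : nat).
Local Open Scope ereal_scope.

Lemma ge0_integral_rVS n (F : 'rV[R]_n.+1 -> \bar R) :
  measurable_fun setT F -> (forall x, 0 <= F x) ->
  \int[lebn n.+1]_x F x = \int[leb \x lebn n]_z F (cons_rV z).
Proof.
move=> mF F0; have F0' : {in setT, forall x, 0 <= F x} by move=> x _.
have H := ge0_integral_pushforward (@measurable_cons_rV R n) (leb \x lebn n)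
  measurableT mF F0'.
rewrite preimage_setT in H; apply: etrans H.
by apply: eq_measure_integral => [|? A mA _]; first exact: measurable_cons_rV.
Qed.

Lemma measurable_comp_cons n (F : 'rV[R]_n.+1 -> \bar R) :
  measurable_fun setT F -> measurable_fun setT (F \o @cons_rV R n).
Proof. by move=> mF; apply: measurableT_comp => //; exact: measurable_cons_rV. Qed.

Lemma ge0_integral_cons n (F : 'rV[R]_n.+1 -> \bar R) :
  measurable_fun setT F -> (forall x, 0 <= F x) ->
  \int[lebn n.+1]_x F x = \int[leb]_a \int[lebn n]_x F (cons_rV (a, x)).
Proof.
move=> mF F0; rewrite ge0_integral_rVS//.
rewrite (fubini_tonelli1 _ (measurable_comp_cons n F mF))//.
by move=> z; exact: F0.
Qed.

Lemma ge0_integral_cons' n (F : 'rV[R]_n.+1 -> \bar R) :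
  measurable_fun setT F -> (forall x, 0 <= F x) ->
  \int[lebn n.+1]_x F x = \int[lebn n]_x \int[leb]_a F (cons_rV (a, x)).
Proof.
move=> mF F0; rewrite ge0_integral_rVS//.
rewrite (fubini_tonelli2 _ (measurable_comp_cons n F mF))//.
by move=> z; exact: F0.
Qed.

Lemma integrable_cons n (F : 'rV[R]_n.+1 -> \bar R) : (lebn n.+1).-integrable setT F ->
  (leb \x lebn n).-integrable setT (F \o @cons_rV R n).
Proof.
move=> /integrableP[mF Foo]; apply/integrableP; split; first exact: measurable_comp_cons.
move: Foo; rewrite ge0_integral_rVS//; exact: measurableT_comp.
Qed.

Lemma integral_cons n (F : 'rV[R]_n.+1 -> \bar R) : (lebn n.+1).-integrable setT F ->
  \int[lebn n.+1]_x F x = \int[leb]_a \int[lebn n]_x F (cons_rV (a, x)) /\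
  \int[lebn n.+1]_x F x = \int[lebn n]_x \int[leb]_a F (cons_rV (a, x)).
Proof.
move=> iF; have iFc := integrable_cons n F iF.
have E : \int[lebn n.+1]_x F x = \int[leb \x lebn n]_z (F \o @cons_rV R n) z.
  have mF : measurable_fun setT F by case/integrableP : iF.
  have iFc' : (leb \x lebn n).-integrable (@cons_rV R n @^-1` setT) (F \o @cons_rV R n).
    by rewrite preimage_setT.
  have H := integral_pushforward (@measurable_cons_rV R n) mF iFc' measurableT.
  rewrite preimage_setT in H; apply: etrans H.
  by apply: eq_measure_integral => [|? A mA _]; first exact: measurable_cons_rV.
split; rewrite E.
- by rewrite -integral12_prod_meas1.
- by rewrite -integral21_prod_meas1.
Qed.

(** An integrable majorant in product form, suited to a measure defined one coordinate at a time:
    its integrability reduces to that of 1 / (1 + a^2) on the line. *)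
Definition weight n (x : 'rV[R]_n) : R := (\prod_i (1 + x ord0 i ^+ 2)^-1)%R.

Lemma weight_gt0 n (x : 'rV[R]_n) : (0 < weight n x)%R.
Proof.
by apply: prodr_gt0 => i _; rewrite invr_gt0 ltr_pwDl// sqr_ge0.
Qed.

Lemma measurable_weight n : measurable_fun setT (weight n).
Proof.
apply: measurable_prod => i _.
apply: (measurableT_comp (f := fun t : R => (1 + t ^+ 2)^-1%R)); last exact: measurable_coord.
by apply: continuous_measurable_fun; exact: continuous_oneDsqrV.
Qed.

Lemma integral_weight1 : \int[leb]_a ((1 + a ^+ 2)^-1)%:E < +oo.
Proof.
have c : continuous (fun a : R => (1 + a ^+ 2)^-1)%R by exact: continuous_oneDsqrV.
rewrite ge0_symfun_integralT//; last 2 first.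
- by move=> a; rewrite invr_ge0 addr_ge0// sqr_ge0.
- by move=> a /=; rewrite sqrrN.
have -> : [set x : R | (0 <= x)%R] = `[0%R, +oo[%classic by rewrite set_itvcy.
by rewrite integral0y_oneDsqr -EFinM ltry.
Qed.

Lemma weight_cons n a (x : 'rV[R]_n) :
  weight n.+1 (cons_rV (a, x)) = ((1 + a ^+ 2)^-1 * weight n x)%R.
Proof.
rewrite /weight big_ord_recl cons_rV0; congr (_ * _)%R.
by apply: eq_bigr => i _; rewrite cons_rVS.
Qed.

Lemma integral_weight n : \int[lebn n]_x (weight n x)%:E < +oo.
Proof.
elim: n => [|n IH].
  have -> : (fun x : 'rV[R]_0 => (weight 0 x)%:E) = cst 1.
    by apply/funext => x; rewrite /weight big_ord0.
  rewrite integral_cst// mul1e /= diracE; by case: (_ \in _); rewrite ltry.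
rewrite ge0_integral_cons; last 2 first.
- by apply/measurable_EFinP; exact: measurable_weight.
- by move=> x; rewrite lee_fin ltW// weight_gt0.
under eq_integral => a _.
  under eq_integral do rewrite weight_cons EFinM.
  rewrite ge0_integralZl//; last 3 first.
  - by apply/measurable_EFinP; exact: measurable_weight.
  - by move=> x _; rewrite lee_fin ltW// weight_gt0.
  - by rewrite lee_fin invr_ge0 addr_ge0// sqr_ge0.
  over.
set I := (\int[lebn n]_x (weight n x)%:E) in IH *; have I0 : 0 <= I.
  by apply: integral_ge0 => x _; rewrite lee_fin ltW// weight_gt0.
have Ifin : I \is a fin_num by rewrite ge0_fin_numE.
have -> : (fun a : R => ((1 + a ^+ 2)^-1)%:E * I) = (fun a : R => I * ((1 + a ^+ 2)^-1)%:E).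
  by apply/funext => a; rewrite muleC.
rewrite ge0_integralZl//; last 2 first.
- apply/measurable_EFinP; apply: continuous_measurable_fun; exact: continuous_oneDsqrV.
- by move=> a _; rewrite lee_fin invr_ge0 addr_ge0// sqr_ge0.
by rewrite lte_mul_pinfty//; exact: integral_weight1.
Qed.

Lemma integrable_le_weight n (F : 'rV[R]_n -> R) (C : R) : measurable_fun setT F ->
  (forall x, `|F x| <= C * weight n x)%R -> (lebn n).-integrable setT (EFin \o F).
Proof.
move=> mF FC; have C0 : (0 <= C)%R.
  have := le_trans (normr_ge0 _) (FC 0%R); rewrite pmulr_lge0//; exact: weight_gt0.
apply: (@le_integrable _ _ _ _ _ _ _ (fun x => (C * weight n x)%:E)) => //.
- exact/measurable_EFinP.
- by move=> x _; rewrite lee_fin (le_trans (FC x))// ler_norm.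
- apply/integrableP; split.
    by apply/measurable_EFinP; apply: measurable_funM => //; exact: measurable_weight.
  under eq_integral => x _.
    rewrite gee0_abs ?EFinM; last by rewrite lee_fin mulr_ge0// ltW// weight_gt0.
    over.
  rewrite ge0_integralZl//; last 2 first.
  - by apply/measurable_EFinP; exact: measurable_weight.
  - by move=> x _; rewrite lee_fin ltW// weight_gt0.
  by rewrite lte_mul_pinfty//; exact: integral_weight.
Qed.

End integral_rV.

(** * Slicing, scaling and integration of derivatives on R^n *)

Section slices.
Context {R : realType}.
Local Notation leb := (@lebesgue_measure R).
Local Notation lebn := (@lebesgue_rV R).
Implicit Types (n : nat).

Lemma is_derive_line n (F : 'rV[R]_n -> R) (x v : 'rV[R]_n) (t l : R) :
  is_derive (t *: v + x) v F l -> is_derive t 1 (fun s => F (s *: v + x)) l.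
Proof.
have E : (fun h : R => h^-1 *: (((fun s : R => F (s *: v + x)) \o shift t) (h *: 1)
    - F (t *: v + x))) =
  (fun h : R => h^-1 *: ((F \o shift (t *: v + x)) (h *: v) - F (t *: v + x))).
  by apply/funext => h; rewrite /= [h *: 1]mulr1 scalerDl addrA.
move=> [dv <-]; apply: DeriveDef.
  by move: dv; rewrite /derivable E.
by rewrite /derive E.
Qed.

Lemma cons_cont_l n (x : 'rV[R]_n) : continuous (fun a : R => cons_rV (a, x)).
Proof.
move=> a; apply/cvg_ballP => e e0; apply/nbhs_ballP; exists e => // b ab.
split=> // i j; rewrite (ord1 i); case: (unliftP ord0 j) => [k|] ->.
  by rewrite !cons_rVS; exact: ballxx.
by rewrite !cons_rV0.
Qed.

Lemma cons_cont_r n (a : R) : continuous (fun x : 'rV[R]_n => cons_rV (a, x)).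
Proof.
move=> x; apply: (iffRL (@cvg_ballP R 'rV[R]_n.+1 'rV[R]_n (nbhs x) (nbhs_filter x)
  (fun x => cons_rV (a, x)) (cons_rV (a, x)))) => e e0.
have := nbhsx_ballx x e e0; apply: filterS => y [_ xy].
split=> // i j; rewrite (ord1 i); case: (unliftP ord0 j) => [k|] ->.
  by rewrite !cons_rVS; exact: xy.
by rewrite !cons_rV0; exact: ballxx.
Qed.

Lemma rV_lineE n (t : R) (i j : 'I_n) (x : 'rV[R]_n) :
  (t *: delta_mx ord0 i + x) ord0 j = t * (j == i)%:R + x ord0 j.
Proof. by rewrite !mxE eqxx. Qed.

Lemma cons_line0 n a (x : 'rV[R]_n) (t : R) :
  cons_rV (t + a, x) = t *: delta_mx ord0 ord0 + cons_rV (a, x).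
Proof.
apply/rowP => j; rewrite rV_lineE; case: (unliftP ord0 j) => [k|] ->.
  by rewrite !cons_rVS mulr0 add0r.
by rewrite !cons_rV0 eqxx/= mulr1.
Qed.

Lemma cons_lineS n a (x : 'rV[R]_n) (i : 'I_n) (t : R) :
  cons_rV (a, t *: delta_mx ord0 i + x) =
  t *: delta_mx ord0 (lift ord0 i) + cons_rV (a, x).
Proof.
apply/rowP => j; rewrite rV_lineE; case: (unliftP ord0 j) => [k|] ->.
  by rewrite !cons_rVS [LHS]rV_lineE (inj_eq (@lift_inj _ ord0)).
by rewrite !cons_rV0 mulr0 add0r.
Qed.

Lemma cons_scale n (k a : R) (x : 'rV[R]_n) :
  k *: cons_rV (a, x) = cons_rV (k * a, k *: x).
Proof.
have Z m (y : 'rV[R]_m) j : (k *: y) ord0 j = k * y ord0 j by rewrite mxE.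
apply/rowP => j; rewrite Z; case: (unliftP ord0 j) => [i|] ->.
  by rewrite !cons_rVS [RHS]Z.
by rewrite !cons_rV0.
Qed.

Lemma ge0_integral_scale1 (G : R -> R) (k : R) : 0 < k -> continuous G ->
  (forall a, 0 <= G a) ->
  (\int[leb]_a (G (k * a))%:E = (k^-1)%:E * \int[leb]_a (G a)%:E)%E.
Proof.
move=> k0 cG G0.
pose F (a : R) := k * a.
have DF a : is_derive a (1 : R) F k.
  by apply: D_eq (D_scale _ _ _ k (D_id a)) _; rewrite mulr1.
have dF : (F^`())%classic = cst k.
  by apply/funext => a; rewrite derive1E; exact: derive_val.
rewrite (@increasing_ge0_integration_by_substitutionT _ F G) //; last 6 first.
- by move=> a b ab; rewrite /F ltr_pM2l.
- by rewrite dF => a; exact: cst_continuous.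
- by rewrite dF; exact: is_cvg_cst.
- by rewrite dF; exact: is_cvg_cst.
- by apply: (gt0_cvgMrNy k0); exact: cvg_id.
- by apply: (gt0_cvgMry k0); exact: cvg_id.
rewrite dF -ge0_integralZl//; last 3 first.
- apply/measurable_EFinP; apply: continuous_measurable_fun => a.
  apply: (C_mul a (G \o F)); last exact: C_cst.
  by apply: (C_comp a G); [exact: cG|exact: (D_cont _ _ _ (DF a))].
- by move=> a _; rewrite lee_fin; apply: mulr_ge0; [exact: G0|exact: ltW].
- by rewrite lee_fin invr_ge0 ltW.
apply: eq_integral => a _; rewrite -EFinM; congr EFin.
by rewrite -[(_ * _) a]/(G (k * a) * k) mulrCA mulVf ?mulr1// gt_eqF.
Qed.

(** One coordinate at a time: the induction hypothesis rescales the last n coordinates, and the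
    one-dimensional substitution rescales the first. *)
Lemma ge0_integral_scale n (F : 'rV[R]_n -> R) (k : R) : 0 < k -> continuous F ->
  (forall x, 0 <= F x) ->
  (\int[lebn n]_x (F (k *: x))%:E = (k ^- n)%:E * \int[lebn n]_x (F x)%:E)%E.
Proof.
move=> k0; elim: n F => [|n IH] F cF F0.
  rewrite invr1 mul1e; apply: eq_integral => x _.
  by rewrite (_ : k *: x = x)//; apply/rowP => -[].
have mF : measurable_fun setT (EFin \o F).
  by apply/measurable_EFinP; exact: measurable_continuous_rV.
have cks : continuous (fun x : 'rV[R]_n.+1 => k *: x) by exact: scaler_continuous.
have mFk : measurable_fun setT (EFin \o (fun x => F (k *: x))).
  apply/measurable_EFinP; apply: measurable_continuous_rV => x.
  by apply: continuous_comp; [exact: cks|exact: cF].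
rewrite (ge0_integral_cons _ (EFin \o (fun x => F (k *: x))))//; last first.
  by move=> x; rewrite lee_fin.
have cFr a : continuous (fun x => F (cons_rV (a, x))).
  by move=> x; apply: continuous_comp; [exact: cons_cont_r|exact: cF].
have cFl x : continuous (fun a : R => F (cons_rV (a, x))).
  by move=> a; apply: continuous_comp; [exact: cons_cont_l|exact: cF].
under eq_integral => a _.
  under eq_integral do rewrite /= cons_scale.
  rewrite (IH (fun x => F (cons_rV (k * a, x))))//.
  over.
pose H (z : measurableTypeR R * 'rV[R]_n) := (F (cons_rV (k * z.1, z.2)))%:E.
have mH : measurable_fun setT H.
  apply: (measurableT_comp mF).
  apply: (measurableT_comp (@measurable_cons_rV R n)).
  apply: measurable_fun_pair; last exact: measurable_snd.
  by apply: measurable_funM; [exact: measurable_cst|exact: measurable_fst].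
have H0 z : (0 <= H z)%E by rewrite lee_fin.
have mI : measurable_fun setT (fun a => \int[lebn n]_x H (a, x))%E.
  exact: measurable_fun_fubini_tonelli_F.
rewrite ge0_integralZl//; last 2 first.
- by move=> a _; apply: integral_ge0 => x _; rewrite lee_fin.
- by rewrite lee_fin invr_ge0 exprn_ge0// ltW.
have -> : (\int[leb]_a \int[lebn n]_x (F (cons_rV (k * a, x)))%:E =
    \int[leb]_a \int[lebn n]_x H (a, x))%E by [].
(* The order of integration is exchanged so that the remaining factor k sits in the inner,
   one-dimensional integral. *)
rewrite -[X in (_ * X)%E](fubini_tonelli1 H mH H0) (fubini_tonelli2 H mH H0).
under eq_integral => x _.
  rewrite /fubini_G /H/= (ge0_integral_scale1 (fun a => F (cons_rV (a, x))) k k0 (cFl x))//.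
  over.
pose H1 (z : measurableTypeR R * 'rV[R]_n) := (F (cons_rV z))%:E.
have mH1 : measurable_fun setT H1 by apply: (measurableT_comp mF); exact: measurable_cons_rV.
have mI1 : measurable_fun setT (fun x => \int[leb]_a H1 (a, x))%E.
  by apply: measurable_fun_fubini_tonelli_G => // z; rewrite lee_fin.
rewrite ge0_integralZl//; last 2 first.
- by move=> a _; apply: integral_ge0 => x _; rewrite lee_fin.
- by rewrite lee_fin invr_ge0 ltW.
rewrite -(ge0_integral_cons' _ (EFin \o F))//.
by rewrite muleA -EFinM -invfM -exprSr.
Qed.

Lemma integral_derive0 (P w : R -> R) (r : R) : continuous w ->
  (forall a : R, is_derive a 1 P (w a)) -> (forall a, r < `|a| -> P a = 0 /\ w a = 0) ->
  (\int[leb]_a (w a)%:E = 0)%E.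
Proof.
move=> cw DP P0; pose b : R := 1 + `|r|.
have rb : r < b by rewrite /b; have := ler_norm r; lra.
have b0 : 0 < b by rewrite /b ltr_pwDl.
have cP : continuous P by move=> a; exact: D_cont _ _ _ (DP a).
have -> : (\int[leb]_a (w a)%:E = \int[leb]_(a in `[(- b)%R, b]) (w a)%:E)%E.
  rewrite [RHS]integral_mkcond; apply: eq_integral => a _; rewrite patchE.
  case: ifPn => //; rewrite notin_setE/= in_itv/= => /negP; rewrite -ler_norml -ltNge => ba.
  by have [_ ->] := P0 a (lt_trans rb ba).
rewrite (@continuous_FTC2 _ w P)//.
- have [-> _] : P b = 0 /\ w b = 0 by apply: P0; rewrite gtr0_norm.
  have [-> _] : P (- b) = 0 /\ w (- b) = 0 by apply: P0; rewrite normrN gtr0_norm.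
  by rewrite -EFinB subrr.
- lra.
- exact: continuous_subspaceT.
- split.
  + by move=> a _; case: (DP a).
  + by apply: cvg_at_right_filter; exact: cP.
  + by apply: cvg_at_left_filter; exact: cP.
- by move=> a _; rewrite derive1E; exact: derive_val.
Qed.

(** On the box of half side b the weight is at least (1 + b^2)^-n and |w| attains a maximum; outside
    it w vanishes. *)
Lemma compact_support_weight n (w : 'rV[R]_n -> R) (r : R) : continuous w ->
  (forall (x : 'rV[R]_n) i, r < `|x ord0 i| -> w x = 0) -> exists C : R, forall x, `|w x| <= C * weight n x.
Proof.
move=> cw w0; pose b : R := 1 + `|r|.
have rb : r < b by rewrite /b; have := ler_norm r; lra.
pose A := [set x : 'rV[R]_n | forall i, `[- b, b]%classic (x ord0 i)].
have cA : compact A.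
  by apply: (@rV_compact R n (fun=> `[- b, b]%classic)) => i; exact: segment_compact.
have A0 : A !=set0.
  by exists 0 => i /=; rewrite mxE in_itv/= /b oppr_le0 andbb addr_ge0.
have cg : continuous (fun x => `|w x|).
  by move=> x; apply: continuous_comp; [exact: cw|exact: norm_continuous].
have [c _ hc] := EVT_max_rV A0 cA (continuous_subspaceT cg).
exists (`|w c| * (1 + b ^+ 2) ^+ n) => x; have [xA|xA] := pselect (A x).
  apply: (@le_trans _ _ `|w c|); first by apply: hc; rewrite inE.
  rewrite -mulrA ler_peMr// mulrC -ler_pdivrMl ?weight_gt0// mulr1.
  rewrite /weight prodfV invrK -[n in X in _ <= X]card_ord -prodr_const.
  apply: ler_prod => i _; rewrite addr_ge0 ?sqr_ge0//= lerD2l.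
  have := xA i; rewrite /= in_itv/= -ler_norml => h.
  rewrite -[x ord0 i ^+ 2]real_normK ?num_real// lerXn2r ?nnegrE//.
  by rewrite /b addr_ge0.
have [i hi] : exists i, ~ `[- b, b]%classic (x ord0 i) by exact/existsNP.
rewrite (w0 x i) ?normr0; last first.
  move: hi => /= /negP; rewrite in_itv/= -ler_norml -ltNge; exact: lt_trans.
rewrite !mulr_ge0 ?exprn_ge0 ?addr_ge0 ?sqr_ge0//; exact/ltW/weight_gt0.
Qed.

(** The order of integration is chosen so that the i-th coordinate comes innermost, where the
    fundamental theorem of calculus gives 0; for the other coordinates the induction hypothesis is
    applied on slices. *)
Lemma integral_partial_eq0 n (i : 'I_n) (P w : 'rV[R]_n -> R) (r : R) : continuous w ->
  (forall x, is_derive x (delta_mx ord0 i) P (w x)) ->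
  (forall (x : 'rV[R]_n) j, r < `|x ord0 j| -> P x = 0 /\ w x = 0) ->
  (\int[lebn n]_x (w x)%:E = 0)%E.
Proof.
elim: n i P w => [[]//|n IH] i P w cw DP P0.
have iw : (lebn n.+1).-integrable setT (EFin \o w).
  have [C hC] := compact_support_weight _ w r cw (fun x j h => proj2 (P0 x j h)).
  exact: integrable_le_weight (measurable_continuous_rV _ _ cw) hC.
have [E1 E2] := integral_cons n (EFin \o w) iw.
case: (unliftP ord0 i) DP => [k|] -> DP.
- rewrite E1 -[RHS](integral0 leb setT); apply: eq_integral => a _ /=.
  apply: (IH k (fun x => P (cons_rV (a, x))) (fun x => w (cons_rV (a, x)))).
  + by move=> x; apply: continuous_comp; [exact: cons_cont_r|exact: cw].
  + move=> x; apply: line_is_derive; under eq_fun do rewrite cons_lineS.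
    by apply: is_derive_line; rewrite scale0r add0r.
  + by move=> x j xj; apply: (P0 _ (lift ord0 j)); rewrite cons_rVS.
- rewrite E2 -[RHS](integral0 (lebn n) setT); apply: eq_integral => x _ /=.
  apply: (integral_derive0 (fun a => P (cons_rV (a, x))) (fun a => w (cons_rV (a, x))) r).
  + by move=> a; apply: continuous_comp; [exact: cons_cont_l|exact: cw].
  + move=> a.
    have -> : (fun a => P (cons_rV (a, x))) =
        (fun t : R => P (t *: delta_mx ord0 ord0 + cons_rV (0, x))).
      by apply/funext => t; rewrite -cons_line0 addr0.
    by apply: is_derive_line; rewrite -cons_line0 addr0.
  + by move=> a ra; apply: (P0 _ ord0); rewrite cons_rV0.
Qed.

(** The inverse weight is at most (1 + |x|^2)^n <= 2^n (1 + |x|^(2n)), so the decay bounds of orders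
    0 and 2 n suffice. *)
Lemma rapid_weight n (F : 'rV[R]_n -> R) :
  (forall k, exists C : R, forall x, enorm x ^+ k * `|F x| <= C) ->
  exists C : R, forall x, `|F x| <= C * weight n x.
Proof.
move=> rF; have [C0 h0] := rF 0%N; have [C1 h1] := rF (2 * n)%N.
exists (2 ^+ n * (C0 + C1)) => x; set s := enorm x ^+ 2.
have s0 : 0 <= s by exact: sqr_ge0.
have w0 := weight_gt0 n x.
rewrite -ler_pdivrMr//.
have wV : (weight n x)^-1 <= (1 + s) ^+ n.
  rewrite /weight prodfV invrK -[n in X in _ <= X]card_ord -prodr_const.
  apply: ler_prod => i _; rewrite addr_ge0 ?sqr_ge0//= lerD2l.
  by rewrite -[x ord0 i ^+ 2]real_normK ?num_real// lerXn2r ?nnegrE ?enorm_ge0// coord_le_enorm.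
have sn : (1 + s) ^+ n <= 2 ^+ n * (1 + s ^+ n).
  have [s1|s1] := leP s 1.
    apply: (@le_trans _ _ (2 ^+ n)).
      by apply: lerXn2r; rewrite ?nnegrE; lra.
    by rewrite ler_peMr ?exprn_ge0// lerDl exprn_ge0.
  apply: (@le_trans _ _ ((2 * s) ^+ n)).
    by apply: lerXn2r; rewrite ?nnegrE; lra.
  by rewrite exprMn ler_pM2l ?exprn_gt0// lerDr.
have := h0 x; have := h1 x; rewrite expr0 mul1r exprM -/s => H1 H0.
apply: (@le_trans _ _ (`|F x| * (2 ^+ n * (1 + s ^+ n)))).
  by rewrite ler_wpM2l// (le_trans wV).
rewrite mulrCA ler_pM2l ?exprn_gt0// mulrDr mulr1 lerD// mulrC//.
Qed.

End slices.

(** * Sperner's lemma on a grid *)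

Section sperner.
Implicit Types (lab : nat -> nat -> nat) (i j m N : nat).

Definition edge23 (x y : nat) : bool :=
  ((x == 2) && (y == 3)) || ((x == 3) && (y == 2)).

Definition label (x : nat) : bool := [|| x == 1, x == 2 | x == 3]%N.

Definition rainbow (x y z : nat) : bool := perm_eq [:: x; y; z] [:: 1; 2; 3]%N.

Lemma edge23_triangle x y z : label x -> label y -> label z -> ~~ rainbow x y z ->
  edge23 x y (+) edge23 y z (+) edge23 x z = false.
Proof.
by move=> /or3P[]/eqP-> /or3P[]/eqP-> /or3P[]/eqP->.
Qed.

Definition cell_rainbow lab i j := exists a b c : nat * nat,
  [/\ (i <= a.1 <= i.+1)%N && (j <= a.2 <= j.+1)%N,
      (i <= b.1 <= i.+1)%N && (j <= b.2 <= j.+1)%N,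
      (i <= c.1 <= i.+1)%N && (j <= c.2 <= j.+1)%N &
      [/\ lab a.1 a.2 = 1, lab b.1 b.2 = 2 & lab c.1 c.2 = 3]%N].

Lemma rainbow_cell lab i j (a b c : nat * nat) :
  (i <= a.1 <= i.+1)%N && (j <= a.2 <= j.+1)%N ->
  (i <= b.1 <= i.+1)%N && (j <= b.2 <= j.+1)%N ->
  (i <= c.1 <= i.+1)%N && (j <= c.2 <= j.+1)%N ->
  rainbow (lab a.1 a.2) (lab b.1 b.2) (lab c.1 c.2) -> cell_rainbow lab i j.
Proof.
move=> ha hb hc hr.
have sel k : k \in [:: 1; 2; 3]%N -> exists2 d : nat * nat,
    (i <= d.1 <= i.+1)%N && (j <= d.2 <= j.+1)%N & lab d.1 d.2 = k.
  rewrite -(perm_mem hr) !inE => /or3P[]/eqP->; by [exists a|exists b|exists c].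
have [//|x hx ex] := sel 1%N; have [//|y hy ey] := sel 2%N; have [//|z hz ez] := sel 3%N.
by exists x, y, z.
Qed.

(** Parity of the edges with labels 2 and 3. Without a rainbow triangle every triangle has an even
    number of them, and the left and right sides have none, so each horizontal line of the grid has
    the same parity. The top line, labelled 1, has none; the bottom line carries only 2 and 3 and
    leads from 3 to 2, so its number is odd. *)
Lemma sperner_grid lab N :
  (forall i j, (i <= N)%N -> (j <= N)%N -> label (lab i j)) ->
  lab 0 0 = 3%N -> lab N 0 = 2%N ->
  (forall i, (i <= N)%N -> lab i 0 != 1%N) -> (forall i, (i <= N)%N -> lab i N = 1%N) ->
  (forall j, (j <= N)%N -> lab 0 j != 2%N) -> (forall j, (j <= N)%N -> lab N j != 3%N) ->
  exists i j, [/\ (i < N)%N, (j < N)%N & cell_rainbow lab i j].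
Proof.
move=> hl l00 lN0 bot top left right; apply: contrapT => none.
have nr i j a b c : (i < N)%N -> (j < N)%N ->
    (i <= a.1 <= i.+1)%N && (j <= a.2 <= j.+1)%N ->
    (i <= b.1 <= i.+1)%N && (j <= b.2 <= j.+1)%N ->
    (i <= c.1 <= i.+1)%N && (j <= c.2 <= j.+1)%N ->
    ~~ rainbow (lab a.1 a.2) (lab b.1 b.2) (lab c.1 c.2).
  move=> iN jN ha hb hc; apply/negP => hr; apply: none.
  by exists i, j; split=> //; exact: rainbow_cell ha hb hc hr.
pose h i j := edge23 (lab i j) (lab i.+1 j).
pose v i j := edge23 (lab i j) (lab i j.+1).
pose H m j := \big[addb/false]_(i < m) h i j.
(* The cell is cut into two triangles by the diagonal from (i + 1, j) to (i, j + 1); in the sum of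
   their parities the diagonal cancels. *)
have cell i j : (i < N)%N -> (j < N)%N -> h i j (+) h i j.+1 = v i j (+) v i.+1 j.
  move=> iN jN; have [iN' jN'] := (ltnW iN, ltnW jN).
  have := nr i j (i, j) (i.+1, j) (i, j.+1) iN jN.
  rewrite /= !leqnn !leqnSn => /(_ isT isT isT) r1.
  have := nr i j (i.+1, j) (i, j.+1) (i.+1, j.+1) iN jN.
  rewrite /= !leqnn !leqnSn => /(_ isT isT isT) r2.
  have := edge23_triangle _ _ _ (hl _ _ iN' jN') (hl _ _ iN jN') (hl _ _ iN' jN) r1.
  have := edge23_triangle _ _ _ (hl _ _ iN jN') (hl _ _ iN' jN) (hl _ _ iN jN) r2.
  rewrite /h /v; move: (edge23 (lab i.+1 j) (lab i j.+1)) => d.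
  by move: (edge23 _ _) (edge23 _ _) (edge23 _ _) (edge23 _ _); case: d; do 4 case.
have sumH m j : (m <= N)%N -> (j < N)%N -> H m j (+) H m j.+1 = v 0 j (+) v m j.
  elim: m => [|m IH] mN jN; first by rewrite /H !big_ord0 !addbb.
  rewrite /H !big_ord_recr/= addbACA -/(H m j) -/(H m j.+1) IH ?(ltnW mN)// cell//.
  by rewrite -addbA [v m j (+) _]addbA addbb addFb.
have v0 j : (j < N)%N -> v 0 j = false.
  move=> jN; rewrite /v /edge23 (negbTE (left _ (ltnW jN))) (negbTE (left _ jN)).
  by rewrite andbF.
have vN j : (j < N)%N -> v N j = false.
  move=> jN; rewrite /v /edge23 (negbTE (right _ (ltnW jN))) (negbTE (right _ jN)).
  by rewrite andbF.
have HN j : (j <= N)%N -> H N 0 = H N j.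
  elim: j => [//|j IH] jN; rewrite (IH (ltnW jN)); apply/eqP.
  by have := sumH N j (leqnn _) jN; rewrite v0// vN//; case: (H N j); case: (H N j.+1).
have HN0 : H N N = false.
  by rewrite /H big1// => i _; rewrite /h !top// ltnW.
(* The parity of the label changes so far tells the current label, since the line starts with 3 and
   has only 2 and 3. *)
have bottom m : (m <= N)%N -> H m 0 = (lab m 0 == 2%N).
  elim: m => [|m IH] mN; first by rewrite /H big_ord0 l00.
  rewrite /H big_ord_recr/= -/(H m 0) (IH (ltnW mN)) /h /edge23.
  have := hl _ 0%N (ltnW mN) isT; have := hl _ 0%N mN isT.
  have := bot _ (ltnW mN); have := bot _ mN; rewrite /label.
  by move=> /negbTE -> /negbTE -> /= /orP[]/eqP-> /orP[]/eqP->.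
have := bottom N (leqnn _); rewrite lN0 eqxx (HN N)// HN0//.
Qed.

End sperner.

Section cluster.
Context {R : realType}.

Lemma square_cluster (u : nat -> R * R) :
  (forall m, 0 <= (u m).1 <= 1 /\ 0 <= (u m).2 <= 1) ->
  exists z : R * R, [/\ 0 <= z.1 <= 1, 0 <= z.2 <= 1 &
    forall e m0, 0 < e -> exists m : nat,
      [/\ (m0 <= m)%N, `|(u m).1 - z.1| < e & `|(u m).2 - z.2| < e]].
Proof.
move=> hu; pose A : set (R * R) := `[0, 1]%classic `*` `[0, 1]%classic.
have cA : compact A by apply: compact_setX; exact: segment_compact.
have FA : (u @ \oo) A.
  by exists 0%N => // m _; split; rewrite /= in_itv/=; case: (hu m).
have [z [[/= z1 z2] zc]] := cA _ _ FA.
rewrite in_itv/= in z1; rewrite in_itv/= in z2.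
exists z; split=> // e m0 e0.
have nz : nbhs z (ball z e) by exact: nbhsx_ballx.
have Fm : (u @ \oo) [set u m | m in [set m | (m0 <= m)%N]].
  by exists m0 => // m /= hm; exists m.
have [_ [[m hm <-] [b1 b2]]] := zc _ _ Fm nz.
by exists m; split=> //; rewrite distrC.
Qed.

End cluster.

(** * Dependence on the parameters *)

Section limits.
Context {R : realType}.
Implicit Types (a d : nat -> R) (l K : R).

Lemma cvg_rate a d l K : d @ \oo --> 0 -> (forall m, `|a m - l| <= K * d m) -> a @ \oo --> l.
Proof.
move=> d0 H; apply/cvgrPdist_le => e e0.
have Kd : (fun m => K * d m) @ \oo --> K * 0 by apply: cvgM => //; exact: cvg_cst.
rewrite mulr0 in Kd; move/cvgrPdist_le : Kd => /(_ e e0); apply: filterS => m.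
rewrite sub0r normrN => h; rewrite distrC; apply: (le_trans (H m)).
exact: le_trans (ler_norm _) h.
Qed.

Lemma cvg_ge a l (b : R) : a @ \oo --> l -> (forall m, b <= a m) -> b <= l.
Proof.
move=> al ba; apply: cvgr_to_ge al _; exact: nearW.
Qed.

Lemma harmonic0 : (fun m : nat => m.+1%:R^-1 : R) @ \oo --> 0.
Proof. exact: cvg_harmonic. Qed.

Lemma square_subsequence (u : nat -> R * R) :
  (forall m, 0 <= (u m).1 <= 1 /\ 0 <= (u m).2 <= 1) ->
  exists (z : R * R) (f : nat -> nat), [/\ 0 <= z.1 <= 1, 0 <= z.2 <= 1 &
    forall m, [/\ (m <= f m)%N, `|(u (f m)).1 - z.1| <= m.+1%:R^-1 &
      `|(u (f m)).2 - z.2| <= m.+1%:R^-1]].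
Proof.
move=> /square_cluster[z [z1 z2 zc]].
have /choice[f hf] m : exists k : nat, [/\ (m <= k)%N, `|(u k).1 - z.1| <= m.+1%:R^-1 &
      `|(u k).2 - z.2| <= m.+1%:R^-1].
  have [|k [mk k1 k2]] := zc m.+1%:R^-1 m; first by rewrite invr_gt0.
  by exists k; split=> //; exact: ltW.
by exists z, f.
Qed.

End limits.

Section parameters.
Context {R : realType} (n : nat) (p q : R).
Hypotheses (p1 : 1 < p) (pq : p < q) (qE : q = 1 + 4 / n.+1%:R).
Local Notation L := (1 + p + q).
Implicit Types (c z : R * R) (r s t : R).

Let q1 : 1 < q := lt_trans p1 pq.

(* The coefficients of - v, v^p and v^q are c.2, (1 - c.2) (1 - c.1) and
   (1 - c.2) c.1; rescaling v brings them to the values of the theorem. *)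
Definition par_be c : R := (1 - c.2) * (1 - c.1).

Definition par_ga c : R := (1 - c.2) * c.1.

Definition par_nl p q c := nlc p q c.2 (par_be c) (par_ga c).

Local Notation F := (par_nl p q).

Definition square c := 0 <= c.1 <= 1 /\ 0 <= c.2 <= 1.

(** A chosen solution, with default value 1. On the square a solution exists, and [fixpoint_close]
    with eta = 0 shows that the choice is immaterial. *)
Definition prof n p q c : R -> R :=
  xget (fun=> 1) [set v : R -> R | continuous v /\ forall r, v r = step n (par_nl p q c) v r].

Local Notation V := (prof n p q).

Lemma par_bounds c : square c ->
  [/\ 0 <= c.2, 0 <= par_be c, 0 <= par_ga c & c.2 + par_be c + par_ga c = 1].
Proof.
move=> [/andP[? ?] /andP[? ?]]; split=> //.
- by apply: mulr_ge0; lra.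
- by apply: mulr_ge0; lra.
- by rewrite /par_be /par_ga; ring.
Qed.

Lemma par_lip c : square c -> lip L (F c).
Proof.
move=> /par_bounds[a0 b0 g0 abg].
by apply: nlc_lip => //; apply/andP; split; lra.
Qed.

Lemma par_bounded c s : square c -> `|F c s| <= L.
Proof.
move=> /par_bounds[a0 b0 g0 abg].
by apply: nlc_bounded => //; apply/andP; split; lra.
Qed.

Lemma par_cont c : square c -> continuous (F c).
Proof. by move=> /par_lip/lip_continuous. Qed.

Lemma par_le0 c s : s <= 0 -> F c s = 0.
Proof. by move=> s0; apply: nlc_le0 => //; have := p1; have := q1; lra. Qed.

Lemma prof_spec c : square c -> continuous (V c) /\ forall r, V c r = step n (F c) (V c) r.
Proof.
move=> sc; have [v cv vE] := step_fixpoint n L (F c) (par_lip c sc).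
exact: (@xgetPex _ (fun=> 1) [set v | continuous v /\ forall r, v r = step n (F c) v r]
  (ex_intro _ v (conj cv vE))).
Qed.

(** The constant is 1 + 2 + 2: one d for the coefficient of v, and two for each product, which
    varies in both factors. *)
Lemma par_close c z d s : square c -> square z -> `|c.1 - z.1| <= d -> `|c.2 - z.2| <= d ->
  `|F c s - F z s| <= 5 * d.
Proof.
move=> [/andP[c1 c1'] /andP[c2 c2']] [/andP[z1 z1'] /andP[z2 z2']] d1 d2.
apply: (le_trans (nlc_close _ _ _ _ _ _ _ _ s p1 q1)).
have E1 : par_be c - par_be z = (1 - c.1) * (z.2 - c.2) + (1 - z.2) * (z.1 - c.1).
  by rewrite /par_be; ring.
have E2 : par_ga c - par_ga z = c.1 * (z.2 - c.2) + (1 - z.2) * (c.1 - z.1).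
  by rewrite /par_ga; ring.
have bd (x y X Y : R) : 0 <= x <= 1 -> 0 <= y <= 1 -> `|X| <= d -> `|Y| <= d ->
    `|x * X + y * Y| <= d + d.
  move=> /andP[x0 x1] /andP[y0 y1] hX hY; apply: (le_trans (ler_normD _ _)).
  by rewrite !normrM (ger0_norm x0) (ger0_norm y0); apply: lerD;
    [rewrite -[leRHS]mul1r|rewrite -[leRHS]mul1r]; apply: ler_pM.
have h1 : `|par_be c - par_be z| <= d + d.
  by rewrite E1; apply: bd; rewrite 1?distrC//; apply/andP; split; lra.
have h2 : `|par_ga c - par_ga z| <= d + d.
  by rewrite E2; apply: bd; rewrite 1?[`|z.2 - _|]distrC//; apply/andP; split; lra.
lra.
Qed.

Section sequence.
Context (c : nat -> R * R) (z : R * R) (d : nat -> R).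
Hypotheses (sc : forall m, square (c m)) (sz : square z) (d0 : d @ \oo --> 0).
Hypotheses (cz1 : forall m, `|(c m).1 - z.1| <= d m) (cz2 : forall m, `|(c m).2 - z.2| <= d m).

Lemma par_dist m s : `|F (c m) s - F z s| <= 5 * d m.
Proof. exact: par_close. Qed.

Lemma prof_dist m r : `|V (c m) r - V z r| <= 10 * d m * expR (L * r ^+ 2).
Proof.
have [cvc vcE] := prof_spec _ (sc m); have [cvz vzE] := prof_spec _ sz.
have := fixpoint_close n L (F (c m)) (F z) (V (c m)) (V z) L (5 * d m) (par_lip _ (sc m))
  (par_cont _ sz) cvc cvz (fun s => par_bounded _ s (sc m)) (fun s => par_bounded _ s sz)
  (par_dist m) vcE vzE r.
by have -> : 2 * (5 * d m) = 10 * d m by ring.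
Qed.

Lemma prof_cvg r : (fun m => V (c m) r) @ \oo --> V z r.
Proof.
apply: (@cvg_rate _ _ d _ (10 * expR (L * r ^+ 2))) => // m.
by apply: le_trans (prof_dist m r) _; rewrite mulrAC.
Qed.

Lemma slope_cvg r : 0 <= r ->
  (fun m => slope n (F (c m)) (V (c m)) r) @ \oo --> slope n (F z) (V z) r.
Proof.
move=> r0; apply: (@cvg_rate _ _ d _ (r * (L * (10 * expR (L * r ^+ 2)) + 5))) => // m.
have [cvc vcE] := prof_spec _ (sc m); have [cvz vzE] := prof_spec _ sz.
have [L1 lc] := par_lip _ (sc m).
have lin (A B : R) : - (r * A) - - (r * B) = - (r * (A - B)) by ring.
rewrite /slope lin normrN normrM (ger0_norm r0) -mulrA ler_wpM2l//.
apply: avg_close => //.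
- by move=> s; apply: (C_comp s (F (c m))); [exact: par_cont|exact: cvc].
- by move=> s; apply: (C_comp s (F z)); [exact: par_cont|exact: cvz].
move=> s /andP[s0 sr] /=.
rewrite -[_ - _](subrKA (F (c m) (V z s))); apply: (le_trans (ler_normD _ _)).
have h1 := lc (V (c m) s) (V z s); have h2 := prof_dist m s.
have h3 := par_dist m (V z s).
have dm0 : 0 <= d m by apply: le_trans (cz1 m).
have h4 : 10 * d m * expR (L * s ^+ 2) <= 10 * d m * expR (L * r ^+ 2).
  apply: ler_wpM2l; first by rewrite mulr_ge0.
  rewrite ler_expR ler_wpM2l//; first by lra.
  by rewrite ler_sqr ?nnegrE.
have h5 : L * `|V (c m) s - V z s| <= L * (10 * d m * expR (L * r ^+ 2)).
  by apply: ler_wpM2l; [lra|exact: le_trans h4].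
move: h1 h3 h5; move: (expR _) (`|F (c m) _ - _|) => e X Y1 Y3 Y5.
lra.
Qed.

(** Both the potential and its argument vary with m. The argument is handled by continuity of the
    limit potential, the potential by integrating [par_dist] up to a bound [B] for the profiles that
    does not depend on m. *)
Lemma pot_cvg r : (fun m => pot (F (c m)) (V (c m) r)) @ \oo --> pot (F z) (V z r).
Proof.
pose B := 1 + L * r ^+ 2.
have h1 : (fun m => pot (F z) (V (c m) r)) @ \oo --> pot (F z) (V z r).
  apply: (@continuous_cvg _ _ _ _ _ (fun m => V (c m) r) (pot (F z))); last exact: prof_cvg.
  by apply: pot_cont; [exact: par_cont|exact: par_le0].
have h2 : (fun m => pot (F (c m)) (V (c m) r) - pot (F z) (V (c m) r)) @ \oo --> 0.
  apply: (@cvg_rate _ _ d _ (5 * (1 + B))) => // m; rewrite subr0.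
  have [cvc vcE] := prof_spec _ (sc m).
  have vB : V (c m) r <= B.
    have := step_bounded n (F (c m)) (V (c m)) L (par_cont _ (sc m)) cvc
      (fun s => par_bounded _ s (sc m)) r.
    by rewrite -vcE ler_norml /B => /andP[]; lra.
  move: vB; move: (V (c m) r) => s sB.
  have dm0 : 0 <= d m by apply: le_trans (cz1 m).
  have B0 : 0 <= B.
    by rewrite /B addr_ge0// mulr_ge0 ?sqr_ge0//; have := p1; have := q1; lra.
  have [s1|s1] := leP (s + 1) 0.
    by rewrite /pot !prim_le0// subrr normr0 mulr_ge0//; lra.
  pose H t := prim (fun t => F (c m) (t - 1)) t - prim (fun t => F z (t - 1)) t.
  have cFc := cont_shift _ (par_cont _ (sc m)); have cFz := cont_shift _ (par_cont _ sz).
  have : `|H (s + 1) - H 0| <= 5 * d m * (s + 1) - 5 * d m * 0.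
    apply: (D_norm_le H (fun t => F (c m) (t - 1) - F z (t - 1)) (fun t => 5 * d m * t)
       (fun t => 5 * d m * 1)).
    - exact: ltW.
    - by move=> t _; apply: C_sub; exact: prim_cont.
    - by move=> t _; apply: C_mul; [exact: C_cst|exact: C_id].
    - by move=> t /andP[t0 _]; exact: D_sub _ _ _ _ _ (prim_D _ _ cFc t0) (prim_D _ _ cFz t0).
    - by move=> t _; rewrite mulr1; exact: par_dist.
  rewrite /H !(prim_le0 _ 0)// subrr subr0 mulr0 subr0 -/(pot _ s) -/(pot _ s) => h.
  apply: (le_trans h); have : d m * (s + 1) <= d m * (1 + B) by apply: ler_wpM2l => //; lra.
  lra.
have h3 := cvgD h2 h1; rewrite add0r in h3.
have E : (fun m => pot (F (c m)) (V (c m) r)) =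
    (fun m => pot (F (c m)) (V (c m) r) - pot (F z) (V (c m) r)) +
    (fun m => pot (F z) (V (c m) r)).
  by apply/funext => m; rewrite [RHS]subrK.
rewrite E; exact: h3.
Qed.

Lemma energy_cvg r : 0 <= r ->
  (fun m => energy n (F (c m)) (V (c m)) r) @ \oo --> energy n (F z) (V z) r.
Proof.
move=> r0; apply: cvgD; last exact: pot_cvg.
apply: cvgM; last exact: cvg_cst.
by apply: cvgM; exact: slope_cvg.
Qed.

End sequence.

Lemma neg_energy c s r : square c -> V c s < 0 -> 0 <= r -> 0 <= energy n (F c) (V c) r.
Proof.
move=> sc; have [cv vE] := prof_spec c sc; have [a0 b0 g0 abg] := par_bounds c sc.
exact: (neg_energy_ge0 n p q c.2 (par_be c) (par_ga c)).
Qed.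

Lemma par_emden_fowler c : square c -> c.2 = 0 -> exists r, V c r < 0.
Proof.
move=> sc c20; have [cv vE] := prof_spec c sc; have [a0 b0 g0 abg] := par_bounds c sc.
have E : F c = nlc p q 0 (par_be c) (par_ga c) by rewrite /par_nl c20.
rewrite c20 in abg; rewrite E in vE.
exact: (emden_fowler_crosses n p q (par_be c) (par_ga c)).
Qed.

Lemma ground_al_lt c : square c -> ground n (F c) (V c) -> c.2 < 2^-1.
Proof.
move=> sc gv; have [cv vE] := prof_spec c sc; have [a0 b0 g0 abg] := par_bounds c sc.
have [_ e0] := gv 0 (lexx 0).
by have [] := energy0_al n p q c.2 (par_be c) (par_ga c) (V c) p1 pq a0 b0 g0 abg vE e0.
Qed.

Lemma not_neg_ge0 c : ~ (exists r, V c r < 0) -> forall r, 0 <= V c r.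
Proof. by move=> H r; rewrite leNgt; apply/negP => vr; apply: H; exists r. Qed.

(** Otherwise ground states with second parameter tending to 0 would accumulate at a parameter with
    value 0, whose profile would be nonnegative as a limit, against [par_emden_fowler]. *)
Lemma ground_al_bound : exists2 a : R, 0 < a &
  forall c, square c -> ground n (F c) (V c) -> a <= c.2.
Proof.
apply: contrapT => H.
have /choice[u hu] (m : nat) : exists c,
    [/\ square c, ground n (F c) (V c) & c.2 < m.+1%:R^-1].
  apply: contrapT => Hm; apply: H; exists m.+1%:R^-1; first by rewrite invr_gt0.
  move=> c sc gc; rewrite leNgt; apply/negP => cm; apply: Hm; by exists c.
have [|z [f [z1 z2 hf]]] := square_subsequence u; first by move=> m; case: (hu m).
pose c m := u (f m).
have sc m : square (c m) by case: (hu (f m)).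
have cz1 m : `|(c m).1 - z.1| <= m.+1%:R^-1 by case: (hf m).
have cz2 m : `|(c m).2 - z.2| <= m.+1%:R^-1 by case: (hf m).
have sz : square z by [].
have z20 : z.2 = 0.
  have c2z : (fun m => (c m).2) @ \oo --> z.2.
    by apply: (@cvg_rate _ _ (fun m => m.+1%:R^-1) _ 1 harmonic0) => m; rewrite mul1r.
  apply/eqP; rewrite eq_le; have /andP[-> _] := z2; rewrite andbT.
  have := harmonic0 (R := R) => h0.
  apply: (ler_cvg_to c2z h0); apply: nearW => m.
  have [_ _ h] := hu (f m); have [mf _ _] := hf m.
  apply: (le_trans (ltW h)); rewrite lef_pV2 ?posrE// ler_nat ltnS//.
have [r vr] := par_emden_fowler z sz z20.
have : 0 <= V z r.
  apply: (cvg_ge (fun m => V (c m) r)); first exact: (prof_cvg c z _ sc sz harmonic0 cz1 cz2 r).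
  move=> m; have [r0|r0] := leP r 0.
    by have [_ vE] := prof_spec _ (sc m); rewrite vE step_le0.
  by have [_ g _] := hu (f m); have [] := g r (ltW r0).
by rewrite leNgt vr.
Qed.

End parameters.

(** * A ground state of prescribed mass *)

Section mass.
Context {R : realType} (n : nat) (p q : R).
Hypotheses (p1 : 1 < p) (pq : p < q) (qE : q = 1 + 4 / n.+1%:R).
Local Notation lebn := (@lebesgue_rV R n.+1).
Local Notation F := (par_nl p q).
Local Notation V := (prof n p q).
Implicit Types (c z : R * R) (r s t : R) (x : 'rV[R]_n.+1).

Context (a0 : R).
Hypothesis a0_gt0 : 0 < a0.
Hypothesis a0P : forall c, square c -> ground n (F c) (V c) -> a0 <= c.2.

(** The bound of [ground_decay]; for the lower bound a0 it dominates all ground states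
    simultaneously. *)
Definition envelope n p a (r : R) : R := expR (rate p a * (onset n p a - r)).

Local Notation env := (envelope n p a0).

(* The truncation dominates all profiles by one integrable function,
   and does not change the ground states. *)
Definition cut n p q a0 c (x : 'rV[R]_n.+1) : R :=
  Num.min (Num.max (prof n p q c (enorm x)) 0) (envelope n p a0 (enorm x)).

(** For a ground state, the square of the L^2 norm after the rescaling that turns the critical
    coefficient into 1. The factor makes it vanish for c.1 = 0. *)
Definition mass n p q a0 c : R :=
  Num.sqrt (par_ga c) ^+ n.+1 * \int[@lebesgue_rV R n.+1]_x (cut n p q a0 c x ^+ 2).

Lemma cut_ge0 c x : 0 <= cut n p q a0 c x.
Proof. by rewrite le_min le_max lexx orbT expR_ge0. Qed.

Lemma cut_le c x : cut n p q a0 c x <= env (enorm x).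
Proof. by rewrite ge_min lexx orbT. Qed.

Lemma enorm_cont d : continuous (@enorm R d).
Proof.
move=> x; apply: (@continuous_comp _ _ _ sumsq Num.sqrt); last exact: sqrt_continuous.
exact/differentiable_continuous/sumsq_differentiable.
Qed.

Lemma comp_enorm_cont d (h : R -> R) : continuous h -> continuous (fun x : 'rV[R]_d => h (enorm x)).
Proof. by move=> ch x; apply: continuous_comp; [exact: enorm_cont|exact: ch]. Qed.

Lemma env_cont : continuous env.
Proof.
move=> r; apply: (C_expR r (fun t => rate p a0 * (onset n p a0 - t))).
apply: (C_mul r (fun=> rate p a0) (fun t => onset n p a0 - t)); first exact: C_cst.
by apply: (C_sub r (fun=> onset n p a0) (fun t => t)); [exact: C_cst|exact: C_id].
Qed.

Lemma measurable_cut c : square c -> measurable_fun setT (cut n p q a0 c).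
Proof.
move=> sc; have [cv _] := prof_spec n p q p1 pq c sc.
apply: measurable_minr; last exact: measurable_continuous_rV (comp_enorm_cont _ _ env_cont).
apply: measurable_maxr; last exact: measurable_cst.
exact: measurable_continuous_rV (comp_enorm_cont _ _ cv).
Qed.

Lemma env_rapid : rapid env.
Proof.
move=> k; have k0 := rate_gt0 p p1 a0 a0_gt0.
have [C C0 hC] := poly_exp_bounded k _ k0.
exists (expR (rate p a0 * onset n p a0) * C) => r r0.
rewrite ger0_norm ?expR_ge0// /envelope mulrBr expRD mulrCA.
by rewrite ler_wpM2l ?expR_ge0// hC.
Qed.

Lemma env_sqr_weight : exists C : R, forall x, env (enorm x) ^+ 2 <= C * weight n.+1 x.
Proof.
have [|C hC] := @rapid_weight R n.+1 (fun x => env (enorm x) ^+ 2).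
  move=> k; have [C1 h1] := env_rapid k; have [C2 h2] := env_rapid 0%N.
  exists (C1 * C2) => x; have r0 := enorm_ge0 x.
  rewrite normrX expr2 mulrA; apply: ler_pM => //.
  - by rewrite mulr_ge0 ?exprn_ge0.
  - exact: h1.
  - by have := h2 _ r0; rewrite expr0 mul1r.
exists C => x; apply: le_trans (hC x); exact: ler_norm.
Qed.

(** Dominated convergence: the squares of all truncated profiles lie below the square of the
    envelope, hence below a multiple of [weight]. *)
Lemma mass_cvg (c : nat -> R * R) z (d : nat -> R) : (forall m, square (c m)) -> square z ->
  d @ \oo --> 0 -> (forall m, `|(c m).1 - z.1| <= d m) -> (forall m, `|(c m).2 - z.2| <= d m) ->
  (fun m => mass n p q a0 (c m)) @ \oo --> mass n p q a0 z.
Proof.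
move=> sc sz d0 cz1 cz2.
have c1 : (fun m => (c m).1) @ \oo --> z.1.
  by apply: (cvg_rate _ _ _ 1 d0) => m; rewrite mul1r.
have c2 : (fun m => (c m).2) @ \oo --> z.2.
  by apply: (cvg_rate _ _ _ 1 d0) => m; rewrite mul1r.
apply: cvgM.
  have sg : (fun m => Num.sqrt (par_ga (c m))) @ \oo --> Num.sqrt (par_ga z).
    apply: (@continuous_cvg _ _ _ _ _ (fun m => par_ga (c m)) Num.sqrt).
      exact: sqrt_continuous.
    by apply: cvgM => //; apply: cvgB => //; exact: cvg_cst.
  apply: (@continuous_cvg _ _ _ _ _ (fun m => Num.sqrt (par_ga (c m))) (fun t => t ^+ n.+1)) => //.
  exact: exprn_continuous.
have [C hC] := env_sqr_weight.
have mE e : square e -> measurable_fun setT (EFin \o (fun x => cut n p q a0 e x ^+ 2)).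
  by move=> se; apply/measurable_EFinP; apply: measurable_funX; exact: measurable_cut.
have [] := @dominated_convergence _ _ R lebn setT measurableT
  (fun m => EFin \o (fun x => cut n p q a0 (c m) x ^+ 2))
  (EFin \o (fun x => cut n p q a0 z x ^+ 2)) (fun x => (C * weight n.+1 x)%:E).
- by move=> m; exact: mE.
- exact: mE.
- apply: aeW => x _; apply: cvg_EFin; first exact: nearW.
  have cc : (fun m => cut n p q a0 (c m) x) @ \oo --> cut n p q a0 z x.
    have Vc := prof_cvg n p q p1 pq c z d sc sz d0 cz1 cz2 (enorm x).
    pose h (s : R) := Num.min (Num.max s 0) (env (enorm x)).
    have ch : continuous h.
      move=> s; apply: (@continuous_min R R (fun s => Num.max s 0) (fun=> env (enorm x)) s);
        last exact: cst_continuous.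
      apply: (@continuous_max R R (fun s => s) (fun=> 0) s); last exact: cst_continuous.
      exact: C_id.
    exact: (@continuous_cvg _ _ _ _ _ (fun m => V (c m) (enorm x)) h _ (ch _) Vc).
  by apply: cvgM.
- apply: (@integrable_le_weight R n.+1 (fun x => C * weight n.+1 x) `|C|).
    by apply: measurable_funM; [exact: measurable_cst|exact: measurable_weight].
  by move=> x; rewrite normrM (gtr0_norm (weight_gt0 _ _)).
- apply: aeW => x m _; rewrite lee_fin ger0_norm ?sqr_ge0//; apply: le_trans (hC x).
  by rewrite ler_sqr ?nnegrE ?cut_ge0 ?expR_ge0// cut_le.
move=> iz _ cvgI; apply: fine_cvg.
rewrite fineK; last exact: integrable_fin_num.
exact: cvgI.
Qed.

Lemma ground_cut c x : square c -> ground n (F c) (V c) ->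
  cut n p q a0 c x = V c (enorm x).
Proof.
move=> sc gc; have [cv vE] := prof_spec n p q p1 pq c sc.
have [al0 be0 ga0 abg] := par_bounds c sc.
have vpos := ground_pos n p q c.2 (par_be c) (par_ga c) (V c) p1 pq al0 be0 ga0 abg cv vE gc.
rewrite /cut max_l ?ltW// min_l//.
exact: (ground_decay n p q c.2 (par_be c) (par_ga c) (V c) p1 pq al0 be0 ga0 abg cv vE gc a0
  (enorm x) a0_gt0 (a0P c sc gc) (enorm_ge0 x)).
Qed.

Lemma ground_mass c : square c -> ground n (F c) (V c) ->
  mass n p q a0 c = Num.sqrt (par_ga c) ^+ n.+1 * \int[lebn]_x (V c (enorm x) ^+ 2).
Proof.
move=> sc gc; congr (_ * _); apply: eq_Rintegral => x _.
by rewrite ground_cut.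
Qed.

Definition crossing c : bool := `[< exists r, V c r < 0 >].

(* The value on the sides c.1 = 0 and c.1 = 1 makes the labelling by [crossing]
   and [heavy] a Sperner labelling. *)
Definition heavy M2 c : bool := (c.1 == 1) || ((c.1 != 0) && (M2 <= mass n p q a0 c)).

Lemma crossing_al_lt c : square c -> crossing c -> c.2 < 2^-1.
Proof.
move=> sc /asboolP[s vs]; have [cv vE] := prof_spec n p q p1 pq c sc.
have [al0 be0 ga0 abg] := par_bounds c sc.
have e0 := neg_energy n p q p1 pq c s 0 sc vs (lexx 0).
by have [] := energy0_al n p q c.2 (par_be c) (par_ga c) (V c) p1 pq al0 be0 ga0 abg vE e0.
Qed.

Lemma selection_cell (M2 : R) (m : nat) : exists w : (R * R) * (R * R) * (R * R),
    [/\ square w.1.1, square w.1.2, square w.2,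
     [/\ crossing w.1.1, ~~ crossing w.1.2, heavy M2 w.1.2 & ~~ heavy M2 w.2] &
     [/\ `|w.1.2.1 - w.1.1.1| <= m.+1%:R^-1, `|w.1.2.2 - w.1.1.2| <= m.+1%:R^-1,
      `|w.2.1 - w.1.1.1| <= m.+1%:R^-1 & `|w.2.2 - w.1.1.2| <= m.+1%:R^-1]].
Proof.
pose lab c : nat := if crossing c then 1%N else if heavy M2 c then 2%N else 3%N.
pose N := m.+1; pose x (i : nat) : R := i%:R / N%:R.
(* The second parameter runs downwards from 1/2 to 0. On row 0 no profile crosses, so label 1 is
   absent; on row N all profiles cross. The first column is never heavy and the last always is,
   which excludes the labels 2 and 3 there. *)
pose pt (i j : nat) : R * R := (x i, (1 - x j) / 2).
have Nr : (0 : R) < N%:R by rewrite ltr0n.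
have x0 : x 0%N = 0 by rewrite /x mul0r.
have xN : x N = 1 by rewrite /x divff// gt_eqF.
have x01 i : (i <= N)%N -> 0 <= x i <= 1.
  by move=> iN; rewrite divr_ge0//= ler_pdivrMr// mul1r ler_nat.
have sq i j : (i <= N)%N -> (j <= N)%N -> square (pt i j).
  move=> /x01/andP[? ?] /x01/andP[? ?].
  by split; rewrite /pt/=; apply/andP; split; lra.
have xx i a b : (i <= a <= i.+1)%N -> (i <= b <= i.+1)%N -> `|x a - x b| <= N%:R^-1.
  move=> /andP[ia ai] /andP[ib bi].
  have Nv : 0 <= (N%:R^-1 : R) by rewrite invr_ge0 ltW.
  rewrite /x -mulrBl normrM (ger0_norm Nv) ler_piMl// ler_norml.
  have := ia; have := ai; have := ib; have := bi.
  rewrite -!(ler_nat R) -!natr1 => ? ? ? ?; apply/andP; split; lra.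
have nc i : (i <= N)%N -> ~~ crossing (pt i 0%N).
  move=> iN; apply/negP => /(crossing_al_lt _ (sq i 0%N iN isT)).
  by rewrite /pt/= x0 subr0 mul1r ltxx.
have [] := sperner_grid (fun i j => lab (pt i j)) N.
- by move=> i j _ _; rewrite /lab; case: ifP => // _; case: ifP.
- by rewrite /lab (negbTE (nc 0%N isT)) /heavy /pt/= x0 eqxx eq_sym oner_eq0.
- by rewrite /lab (negbTE (nc N (leqnn N))) /heavy /pt/= xN eqxx.
- by move=> i iN; rewrite /lab (negbTE (nc i iN)); case: ifP.
- move=> i iN; rewrite /lab ifT//; apply/asboolP.
  by apply: (par_emden_fowler n p q p1 pq qE); [exact: sq|rewrite /pt/= xN subrr mul0r].
- move=> j jN; rewrite /lab; case: ifP => // _; rewrite ifF//.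
  by rewrite /heavy /pt/= x0 eqxx eq_sym oner_eq0.
- move=> j jN; rewrite /lab; case: ifP => // _; rewrite ifT//.
  by rewrite /heavy /pt/= xN eqxx.
move=> i [j [iN jN [a [b [e [/andP[a1 a2] /andP[b1 b2] /andP[e1 e2] [la lbb le]]]]]]].
have bd k l (h : (l <= k <= l.+1)%N) : (l < N)%N -> (k <= N)%N.
  by move=> lN; apply: leq_trans lN; case/andP : h.
exists (pt a.1 a.2, pt b.1 b.2, pt e.1 e.2); rewrite /=.
have yy u v : (j <= u <= j.+1)%N -> (j <= v <= j.+1)%N ->
    `|(1 - x u) / 2 - (1 - x v) / 2| <= N%:R^-1.
  have Nv : 0 <= (N%:R^-1 : R) by rewrite invr_ge0 ltW.
  move=> hu hv; move: (xx _ _ _ hu hv) Nv; move: (x u) (x v) (N%:R^-1) => s t y.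
  by rewrite !ler_norml => /andP[? ?] ?; apply/andP; split; lra.
split; try by apply: sq; [exact: bd iN|exact: bd jN].
- have key (c1 h1 c2 h2 c3 h3 : bool) : (if c1 then 1 else if h1 then 2 else 3)%N = 1%N ->
      (if c2 then 1 else if h2 then 2 else 3)%N = 2%N ->
      (if c3 then 1 else if h3 then 2 else 3)%N = 3%N -> [/\ c1, ~~ c2, h2 & ~~ h3].
    by move: c1 h1 c2 h2 c3 h3 => [] [] [] [] [] [].
  exact: (key (crossing (pt a.1 a.2)) (heavy M2 (pt a.1 a.2)) (crossing (pt b.1 b.2))
    (heavy M2 (pt b.1 b.2)) (crossing (pt e.1 e.2)) (heavy M2 (pt e.1 e.2)) la lbb le).
- by split; [exact: (xx i _ _ b1 a1)|exact: (yy _ _ b2 a2)|exact: (xx i _ _ e1 a1)|exact: (yy _ _ e2 a2)].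
Qed.

Lemma selection (M2 : R) : 0 < M2 ->
  (forall c, square c -> c.1 = 1 -> ground n (F c) (V c) -> M2 < mass n p q a0 c) ->
  exists c, [/\ square c, ground n (F c) (V c), mass n p q a0 c = M2, 0 < c.1 < 1 & c.2 < 1].
Proof.
move=> M20 endpoint.
have /choice[w hw] := selection_cell M2.
have [|z [f [z1 z2 hf]]] := square_subsequence (fun m => (w m).1.1).
  by move=> m; have [[? ?] _ _ _ _] := hw m.
have sz : square z by [].
(* Twice the mesh bound: one part for the distance to the crossing vertex of the same cell, one for
   the distance of that vertex to z. *)
pose d (m : nat) : R := 2 * m.+1%:R^-1.
have d0 : d @ \oo --> 0.
  by rewrite -(mulr0 (2 : R)); apply: cvgM; [exact: cvg_cst|exact: harmonic0].
have fm m : ((f m).+1%:R^-1 : R) <= m.+1%:R^-1.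
  by rewrite lef_pV2 ?posrE// ler_nat ltnS; case: (hf m).
have dd m (s t r : R) : `|s - t| <= (f m).+1%:R^-1 -> `|t - r| <= m.+1%:R^-1 -> `|s - r| <= d m.
  move=> h1 h2; rewrite -(subrKA t) (le_trans (ler_normD _ _))// /d mulr_natl mulr2n lerD//.
  exact: le_trans (fm m).
pose A m := (w (f m)).1.1; pose B m := (w (f m)).1.2; pose C m := (w (f m)).2.
have [sA sB sC] : [/\ forall m, square (A m), forall m, square (B m) & forall m, square (C m)].
  by split=> m; case: (hw (f m)).
have A1 m : `|(A m).1 - z.1| <= d m by apply: (dd m _ (A m).1); [rewrite subrr normr0|case: (hf m)].
have A2 m : `|(A m).2 - z.2| <= d m by apply: (dd m _ (A m).2); [rewrite subrr normr0|case: (hf m)].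
have B1 m : `|(B m).1 - z.1| <= d m.
  by apply: (dd m _ (A m).1); [case: (hw (f m)) => _ _ _ _ []|case: (hf m)].
have B2 m : `|(B m).2 - z.2| <= d m.
  by apply: (dd m _ (A m).2); [case: (hw (f m)) => _ _ _ _ []|case: (hf m)].
have C1 m : `|(C m).1 - z.1| <= d m.
  by apply: (dd m _ (A m).1); [case: (hw (f m)) => _ _ _ _ []|case: (hf m)].
have C2 m : `|(C m).2 - z.2| <= d m.
  by apply: (dd m _ (A m).2); [case: (hw (f m)) => _ _ _ _ []|case: (hf m)].
(* Nonnegativity of the profile comes from the vertices [B], which do not cross; nonnegativity of
   the energy comes from the vertices [A], which do. *)
have gz : ground n (F z) (V z).
  move=> r r0; split.
    apply: (cvg_ge (fun m => V (B m) r)); first exact: (prof_cvg n p q p1 pq B z d).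
    move=> m; apply: not_neg_ge0 => H; case: (hw (f m)) => _ _ _ [_ + _ _] _.
    by move=> /negP; apply; apply/asboolP.
  apply: (cvg_ge (fun m => energy n (F (A m)) (V (A m)) r)).
    exact: (energy_cvg n p q p1 pq A z d).
  move=> m; case: (hw (f m)) => _ _ _ [/asboolP[s vs] _ _ _] _.
  exact: (neg_energy n p q p1 pq _ s).
have mB : (fun m => mass n p q a0 (B m)) @ \oo --> mass n p q a0 z by exact: (mass_cvg B z d).
have mC : (fun m => mass n p q a0 (C m)) @ \oo --> mass n p q a0 z by exact: (mass_cvg C z d).
have B1z : (fun m => (B m).1) @ \oo --> z.1.
  by apply: (cvg_rate _ _ _ 1 d0) => m; rewrite mul1r.
have C1z : (fun m => (C m).1) @ \oo --> z.1.
  by apply: (cvg_rate _ _ _ 1 d0) => m; rewrite mul1r.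
have hB m : heavy M2 (B m) by case: (hw (f m)) => _ _ _ [].
have hC m : ~~ heavy M2 (C m) by case: (hw (f m)) => _ _ _ [].
have upper : z.1 != 0 -> mass n p q a0 z <= M2.
  move=> z0; apply: cvgr_to_le mC _.
  have : \forall m \near \oo, (C m).1 != 0 by apply: cvgr_neq0 C1z z0.
  apply: filterS => m Cm; have := hC m; rewrite /heavy negb_or Cm/= -ltNge => /andP[_].
  exact: ltW.
have lower : z.1 != 1 -> M2 <= mass n p q a0 z.
  move=> z0; apply: cvgr_to_ge mB _.
  have : \forall m \near \oo, 1 - (B m).1 != 0.
    have h : (fun m => 1 - (B m).1) @ \oo --> 1 - z.1 by apply: cvgB => //; exact: cvg_cst.
    by apply: cvgr_neq0 h _; rewrite subr_eq0 eq_sym.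
  apply: filterS => m; rewrite subr_eq0 eq_sym => Bm.
  by have := hB m; rewrite /heavy (negbTE Bm)/= => /andP[].
(* The artificial values of [heavy] on the sides leave one of the two mass inequalities at z. On the
   side c.1 = 0 it is M2 <= mass, but the mass is 0 there. *)
have z10 : z.1 != 0.
  apply/eqP => z10; have := lower; rewrite z10 eq_sym oner_neq0 => /(_ isT).
  by rewrite /mass /par_ga z10 mulr0 sqrtr0 expr0n mul0r leNgt M20.
(* On this side mass <= M2 remains, which contradicts the assumption on the endpoint. *)
have z11 : z.1 != 1.
  apply/eqP => z11; have := endpoint z sz z11 gz; rewrite ltNge upper//.
exists z; split=> //.
- by apply/eqP; rewrite eq_le upper// lower.
- by case/andP : z1 => ? ?; rewrite !lt_neqAle eq_sym z10 z11; apply/andP.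
- by apply: (lt_trans (ground_al_lt n p q p1 pq z sz gz)); rewrite invf_lt1// ltr1n.
Qed.

End mass.

(** * Weak and strong solutions *)

Section green.
Context {R : realType} {d : nat}.
Local Notation lebd := (@lebesgue_rV R d).
Implicit Types (u phi F P : 'rV[R]_d -> R) (x : 'rV[R]_d) (i : 'I_d) (s : seq 'I_d).

Lemma smooth_partial u i : smooth u -> smooth (partial i u).
Proof.
by move=> su s x; have := su (rcons s i) x; rewrite /partials foldr_rcons.
Qed.

Lemma smooth_cont u : smooth u -> continuous u.
Proof. by move=> su x; exact: differentiable_continuous (su [::] x). Qed.

Lemma smooth_is_derive u i x : smooth u -> is_derive x (delta_mx ord0 i) u (partial i u x).
Proof. by move=> su; apply: derivableP; exact: diff_derivable (su [::] x). Qed.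

(** The norm is continuous along the line through x, so phi vanishes on a segment of it around x. *)
Lemma partial_eq0 phi i (r : R) x : (forall x, r < enorm x -> phi x = 0) ->
  r < enorm x -> partial i phi x = 0.
Proof.
move=> h rx; set v : 'rV[R]_d := delta_mx ord0 i.
have cl : {for (0 : R), continuous (fun t : R => enorm (t *: v + x) - r)}.
  apply: (C_sub 0 (fun t : R => enorm (t *: v + x)) (fun=> r)); last exact: C_cst.
  apply: (@continuous_comp _ _ _ (fun t : R => t *: v + x) (@enorm R d)); last exact: enorm_cont.
  by apply: cvgD; [apply: cvgZr_tmp; exact: cvg_id|exact: cvg_cst].
have [|dl dl0 hd] := cont_pos _ _ cl; first by rewrite scale0r add0r subr_gt0.
have D0 : is_derive x v phi 0.
  apply: line_is_derive; have ab : - dl < 0 < dl by rewrite oppr_lt0 dl0.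
  apply: (D_near 0 (fun=> 0) (fun t : R => phi (t *: v + x)) 0 (- dl) dl ab _ (D_cst 0 0)).
  move=> t tdl; apply/esym/h; rewrite -subr_gt0; apply: hd.
  by rewrite subr0 ltr_norml.
by rewrite /partial; case: D0.
Qed.

Lemma supp_coord P (r : R) : (forall x, r < enorm x -> P x = 0) ->
  forall x i, r < `|x ord0 i| -> P x = 0.
Proof. by move=> h x i rx; apply: h; exact: lt_le_trans rx (coord_le_enorm x i). Qed.

Lemma compact_integrable P (r : R) : continuous P -> (forall x, r < enorm x -> P x = 0) ->
  lebd.-integrable setT (EFin \o P).
Proof.
move=> cP P0; have [C hC] := compact_support_weight _ P r cP (supp_coord P r P0).
exact: integrable_le_weight (measurable_continuous_rV _ _ cP) hC.
Qed.

Lemma cont_mul_rV P F : continuous P -> continuous F -> continuous (fun x => P x * F x).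
Proof. by move=> cP cF x; apply: (@continuousM _ _ P F x); [exact: cP|exact: cF]. Qed.

(** The product u phi has bounded support, so the integral of its partial derivative is 0; decay of
    u plays the part of neither boundary term. *)
Lemma smooth_weak_partial u i : smooth u -> weak_partial i u (partial i u).
Proof.
move=> su phi [sphi [r phi0]].
have cu := smooth_cont u su; have cphi := smooth_cont phi sphi.
have cdu := smooth_cont _ (smooth_partial u i su).
have cdphi := smooth_cont _ (smooth_partial phi i sphi).
have dphi0 x : r < enorm x -> partial i phi x = 0 by exact: partial_eq0.
have z1 x : r < enorm x -> u x * partial i phi x = 0 by move=> /dphi0 ->; rewrite mulr0.
have z2 x : r < enorm x -> partial i u x * phi x = 0 by move=> /phi0 ->; rewrite mulr0.
have c1 := cont_mul_rV _ _ cu cdphi; have c2 := cont_mul_rV _ _ cdu cphi.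
have i1 := compact_integrable _ r c1 z1; have i2 := compact_integrable _ r c2 z2.
apply/eqP; rewrite -addr_eq0 -RintegralD//; apply/eqP.
rewrite -[RHS]/(fine 0) /Rintegral; congr fine.
apply: (integral_partial_eq0 d i (fun x => u x * phi x)
  (fun x => u x * partial i phi x + partial i u x * phi x) r).
- by move=> x; apply: (@continuousD _ _ _ (fun x => u x * partial i phi x)); [exact: c1|exact: c2].
- move=> x; have h1 := smooth_is_derive u i x su; have h2 := smooth_is_derive phi i x sphi.
  have h : is_derive x (delta_mx ord0 i) (fun x => u x * phi x)
      (u x *: partial i phi x + phi x *: partial i u x) by exact: is_deriveM.
  by apply: is_derive_eq h _; rewrite [_ *: partial i u x]mulrC.
- move=> x j xj; have rx := lt_le_trans xj (coord_le_enorm x j).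
  by rewrite z1// z2// phi0// mulr0 addr0.
Qed.

(** For each i the integrand is the i-th derivative of phi times that of u, minus u times that of
    phi, in divergence form, and this field has bounded support. *)
Lemma green_identity u phi : smooth u -> test_function phi ->
  \int[lebd]_x (phi x * laplacian u x - u x * laplacian phi x) = 0.
Proof.
move=> su [sphi [r phi0]].
have cu := smooth_cont u su; have cphi := smooth_cont phi sphi.
pose w i x := phi x * partial i (partial i u) x - u x * partial i (partial i phi) x.
have wE x : phi x * laplacian u x - u x * laplacian phi x = \sum_i w i x.
  by rewrite /w sumrB /laplacian !mulr_sumr.
have cw i : continuous (w i).
  have c1 := cont_mul_rV _ _ cphi (smooth_cont _ (smooth_partial _ i (smooth_partial _ i su))).
  have c2 := cont_mul_rV _ _ cu (smooth_cont _ (smooth_partial _ i (smooth_partial _ i sphi))).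
  by move=> x; apply: (@continuousB _ _ _ (fun x => phi x * partial i (partial i u) x));
    [exact: c1|exact: c2].
have d0 i x : r < enorm x -> partial i phi x = 0 by exact: partial_eq0.
have dd0 i x : r < enorm x -> partial i (partial i phi) x = 0.
  by apply: partial_eq0 => y; exact: d0.
have w0 i x : r < enorm x -> w i x = 0.
  by move=> rx; rewrite /w phi0// dd0// mul0r mulr0 subrr.
have iw i := compact_integrable _ r (cw i) (w0 i).
rewrite /Rintegral; under eq_integral do rewrite wE -sumEFin.
rewrite integral_sum//.
rewrite big1// => i _.
apply: (integral_partial_eq0 d i
  (fun x => phi x * partial i u x - u x * partial i phi x) (w i) r (cw i)).
- move=> x; have h1 := smooth_is_derive u i x su; have h2 := smooth_is_derive phi i x sphi.
  have h3 := smooth_is_derive _ i x (smooth_partial _ i su).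
  have h4 := smooth_is_derive _ i x (smooth_partial _ i sphi).
  have h5 : is_derive x (delta_mx ord0 i) (fun x => phi x * partial i u x)
      (phi x *: partial i (partial i u) x + partial i u x *: partial i phi x).
    exact: is_deriveM.
  have h6 : is_derive x (delta_mx ord0 i) (fun x => u x * partial i phi x)
      (u x *: partial i (partial i phi) x + partial i phi x *: partial i u x).
    exact: is_deriveM.
  have h7 : is_derive x (delta_mx ord0 i)
    (fun x => phi x * partial i u x - u x * partial i phi x) _ := is_deriveB h5 h6.
  have key (a b c e f g : R) : a * b + c * e - (f * g + e * c) = a * b - f * g by ring.
  exact: is_derive_eq h7 (key _ _ _ _ _ _).
- move=> x j xj; have rx := lt_le_trans xj (coord_le_enorm x j).
  by rewrite w0// phi0// d0// mul0r mulr0 subrr.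
Qed.

Lemma sqr_rapid u : (forall k, exists C : R, forall x, enorm x ^+ k * `|u x| <= C) ->
  exists C : R, forall x, `|u x ^+ 2| <= C * weight d x.
Proof.
move=> ru; apply: rapid_weight => k; have [C1 h1] := ru k; have [C2 h2] := ru 0%N.
exists (C1 * C2) => x; rewrite normrX expr2 mulrA; apply: ler_pM => //.
- by rewrite mulr_ge0 ?exprn_ge0 ?enorm_ge0.
- by have := h2 x; rewrite expr0 mul1r.
Qed.

Lemma L2norm_sqr u : continuous u ->
  (forall k, exists C : R, forall x, enorm x ^+ k * `|u x| <= C) ->
  L2norm u = (Num.sqrt (\int[lebd]_x (u x ^+ 2)))%:E.
Proof.
move=> cu ru; have [C hC] := sqr_rapid u ru.
have iu : lebd.-integrable setT (EFin \o (fun x => u x ^+ 2)).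
  apply: integrable_le_weight hC; apply: measurable_funX; exact: measurable_continuous_rV.
rewrite /L2norm unlock /Lnorm.
under eq_integral => x _.
  rewrite /= powR_mulrn// real_normK ?num_real//.
  over.
rewrite -[X in (X `^ _)%E](fineK (integrable_fin_num measurableT iu)).
by rewrite poweR_EFin -powR12_sqrt// Rintegral_ge0// => x _; exact: sqr_ge0.
Qed.

Lemma schwartz_Lfun2 u : continuous u ->
  (forall k, exists C : R, forall x, enorm x ^+ k * `|u x| <= C) ->
  u \in Lfun lebd 2%:E.
Proof.
move=> cu ru; apply/andP; rewrite !inE; split.
  exact: measurable_continuous_rV.
have h : (L2norm u < +oo)%E by rewrite (L2norm_sqr u cu ru) ltry.
exact: h.
Qed.

Lemma schwartz_H1 u : schwartz u -> sobolev_H1 u.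
Proof.
move=> [su ru]; split.
  by apply: schwartz_Lfun2; [exact: smooth_cont|move=> k; exact: (ru k [::])].
move=> i; exists (partial i u); last exact: smooth_weak_partial.
apply: schwartz_Lfun2; first exact/smooth_cont/smooth_partial.
by move=> k; exact: (ru k [:: i]).
Qed.

Lemma ae_L2norm u Q : u \in Lfun lebd 2%:E -> Q \in Lfun lebd 2%:E ->
  u = Q %[ae lebd] -> L2norm u = L2norm Q.
Proof.
move=> /sub_Lfun_mfun mu /sub_Lfun_mfun mQ uQ.
rewrite /L2norm unlock /Lnorm; congr (_ `^ _)%E.
rewrite !inE in mu mQ.
have mp (f : 'rV[R]_d -> R) : measurable_fun setT f ->
    measurable_fun setT (fun x => `|(f x)%:E| `^ 2)%E.
  move=> mf; apply/measurable_EFinP; apply: (measurableT_comp (f := fun t : R => t `^ 2)).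
    exact: measurable_powR.
  exact: measurableT_comp.
apply: ae_eq_integral => //; [exact: mp|exact: mp|].
by apply: filterS uQ => x uQ xT; rewrite /= uQ.
Qed.

End green.

(** * Rescaled ground states as solutions on R^N *)

Section rescaled_ground.
Context {R : realType} (n : nat) (p q al be ga : R) (v : R -> R) (k kap : R).
Hypotheses (p1 : 1 < p) (pq : p < q) (al0 : 0 < al) (be0 : 0 <= be) (ga0 : 0 <= ga)
  (abg : al + be + ga = 1) (cv : continuous v)
  (vE : forall r, v r = step n (nlc p q al be ga) v r) (gv : ground n (nlc p q al be ga) v)
  (k0 : 0 < k) (kap0 : 0 < kap).
Local Notation N := n.+1.
Local Notation f := (nlc p q al be ga).
Local Notation u := (fun x : 'rV[R]_N => k * v (kap * enorm x)).

Lemma rescaled_rtower m : rtower m (fun r => k * v (kap * r)).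
Proof. by apply: rtower_scale => //; exact: (ground_rtower n p q al be ga v). Qed.

Lemma rescaled_schwartz : schwartz u.
Proof. exact: (rtower_schwartz (fun r => k * v (kap * r)) rescaled_rtower). Qed.

(** For r > 0 this is the profile equation with v' = r h1; at 0, where that equation is singular, it
    follows by continuity. *)
Lemma ground_flux (h1 h2 : R -> R) : continuous h1 -> continuous h2 ->
  (forall r : R, 0 < r -> is_derive r (1 : R) v (r * h1 r)) ->
  (forall r : R, 0 < r -> is_derive r (1 : R) h1 (r * h2 r)) ->
  forall r : R, 0 <= r -> N%:R * h1 r + r ^+ 2 * h2 r = - f (v r).
Proof.
move=> c1 c2 D1 D2.
have cf := f_cont p q al be ga p1 pq (ltW al0) be0 ga0 abg.
pose dv := slope n f v.
have dvE r : 0 < r -> dv r = r * h1 r.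
  by move=> r0; apply: D_uniq (v_D n p q al be ga v p1 pq (ltW al0) be0 ga0 abg cv vE r r0) (D1 r r0).
pose G r := N%:R * h1 r + r ^+ 2 * h2 r + f (v r).
have G0 r : 0 < r -> G r = 0.
  move=> r0; have Dd := dv_D n p q al be ga v p1 pq (ltW al0) be0 ga0 abg cv r r0.
  have Dh : is_derive r (1 : R) (fun t => t * h1 t) (1 * h1 r + r * (r * h2 r)).
    exact: D_mul _ _ _ _ _ (D_id r) (D2 r r0).
  have Dh' : is_derive r (1 : R) dv (1 * h1 r + r * (r * h2 r)).
    apply: (D_near r (fun t => t * h1 t) dv _ 0 (r + 1) _ _ Dh).
      by rewrite r0/= ltrDl.
    by move=> t /andP[t0 _]; rewrite dvE.
  have := D_uniq _ _ _ _ Dd Dh'; rewrite -/dv (dvE r r0) /G.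
  have -> : n%:R / r * (r * h1 r) = n%:R * h1 r by field; rewrite gt_eqF.
  have -> : N%:R = 1 + n%:R :> R by rewrite -natr1 addrC.
  by move: (f (v r)) => F E; lra.
have cG : continuous G.
  move=> r; apply: (C_add r (fun r => N%:R * h1 r + r ^+ 2 * h2 r) (fun r => f (v r))).
    apply: (C_add r (fun r => N%:R * h1 r) (fun r => r ^+ 2 * h2 r)).
      by apply: (C_mul r (fun=> N%:R) h1); [exact: C_cst|exact: c1].
    apply: (C_mul r (fun r => r ^+ 2) h2); last exact: c2.
    by apply: (C_pow r (fun r => r)); exact: C_id.
  by apply: (C_comp r f v); [exact: cf|exact: cv].
have G00 : G 0 = 0.
  apply/eqP; apply: contraT => G0n.
  have [|dl dl0 hd] := cont_eps G 0 (cG 0) `|G 0|; first by rewrite normr_gt0.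
  have := hd (dl / 2); rewrite subr0 gtr0_norm ?divr_gt0// G0 ?divr_gt0// sub0r normrN ltxx.
  by apply; rewrite ltr_pdivrMr// ltr_pMr// ltr1n.
move=> r; rewrite le_eqVlt => /orP[/eqP<-|r0]; first by apply/eqP; rewrite -addr_eq0 -/(G 0) G00.
by apply/eqP; rewrite -addr_eq0 -/(G r) G0.
Qed.

Lemma rescaled_laplacian x : laplacian u x = - (k * kap ^+ 2 * f (v (kap * enorm x))).
Proof.
have [_ _ [h1 [c1 _ [h2 [c2 _ _] D2]] D1]] := ground_rtower n p q al be ga v p1 pq al0 be0 ga0 abg cv vE gv 2.
have cs (h : R -> R) (c : R) : continuous h -> continuous (fun r : R => c * h (kap * r)).
  move=> ch r; apply: (C_mul r (fun=> c) (fun r => h (kap * r))); first exact: C_cst.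
  apply: (C_comp r h (fun r => kap * r)); first exact: ch.
  by apply: (C_mul r (fun=> kap) (fun r => r)); [exact: C_cst|exact: C_id].
have Ds (h g : R -> R) (c : R) : (forall r : R, 0 < r -> is_derive r (1 : R) h (r * g r)) ->
    forall r : R, 0 < r -> is_derive r (1 : R) (fun r => c * h (kap * r))
      (r * (c * kap ^+ 2 * g (kap * r))).
  move=> Dh r r0; have kr : 0 < kap * r by rewrite mulr_gt0.
  apply: D_eq (D_scale _ _ _ c (D_comp _ h (fun r => kap * r) _ _ (Dh _ kr) (D_scale _ _ _ kap (D_id r)))) _.
  by move: (g _) => y; ring.
rewrite (radial_laplacian (fun r => k * v (kap * r)) (fun r => k * kap ^+ 2 * h1 (kap * r))
  (fun r => k * kap ^+ 2 * kap ^+ 2 * h2 (kap * r)) x (cs _ _ cv) (cs _ _ c1) (cs _ _ c2)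
  (Ds _ _ _ D1) (Ds _ _ _ D2)).
have kr : 0 <= kap * enorm x by apply: mulr_ge0; [exact: ltW|exact: enorm_ge0].
have := ground_flux h1 h2 c1 c2 D1 D2 _ kr.
move: (enorm x) (N%:R : R) (h1 _) (h2 _) (f _) => e M a b F E.
have -> : F = - (M * a + (kap * e) ^+ 2 * b) by rewrite E opprK.
by ring.
Qed.

Lemma enorm_scale (x : 'rV[R]_N) : enorm (kap *: x) = kap * enorm x.
Proof.
rewrite /enorm; under eq_bigr do rewrite mxE exprMn.
by rewrite -mulr_sumr sqrtrM ?sqr_ge0// sqrtr_sqr gtr0_norm.
Qed.

Lemma rescaled_L2norm :
  L2norm u = (Num.sqrt (k ^+ 2 * kap ^- N * \int[lebesgue_rV N]_x (v (enorm x) ^+ 2)))%:E.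
Proof.
have [su ru] := rescaled_schwartz.
rewrite (L2norm_sqr u (smooth_cont _ su) (fun j => ru j [::])); congr (Num.sqrt _)%:E.
have [sv rv] := rtower_schwartz (d := N) v (ground_rtower n p q al be ga v p1 pq al0 be0 ga0 abg cv vE gv).
have [C hC] := sqr_rapid _ (fun j => rv j [::]).
pose F (x : 'rV[R]_N) := v (enorm x) ^+ 2.
have cF : continuous F.
  apply: (comp_enorm_cont N (fun r => v r ^+ 2)) => r.
  by apply: (C_pow r v); exact: cv.
have iF : (lebesgue_rV N).-integrable setT (EFin \o F).
  exact: integrable_le_weight (measurable_continuous_rV _ _ cF) hC.
have cks : continuous (fun x : 'rV[R]_N => kap *: x) by exact: scaler_continuous.
have mFk : measurable_fun setT (EFin \o (fun x => F (kap *: x))).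
  apply/measurable_EFinP; apply: measurable_continuous_rV => x.
  by apply: continuous_comp; [exact: cks|exact: cF].
have -> : \int[lebesgue_rV N]_x (u x ^+ 2) = \int[lebesgue_rV N]_x (k ^+ 2 * F (kap *: x)).
  by apply: eq_Rintegral => x _; rewrite /F enorm_scale exprMn.
have FE := ge0_integral_scale N F kap kap0 cF (fun x => sqr_ge0 _).
rewrite RintegralZl//; last first.
  apply/integrableP; split=> //.
  under eq_integral do rewrite /= ger0_norm ?sqr_ge0//.
  rewrite FE; apply: lte_mul_pinfty; rewrite ?lee_fin ?invr_ge0 ?exprn_ge0 ?ltW//.
  have /integrableP[_] := iF; under eq_integral do rewrite /= ger0_norm ?sqr_ge0//.
  by [].
by rewrite -mulrA; congr (_ * _); rewrite /Rintegral FE fineM//; exact: integrable_fin_num.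
Qed.

End rescaled_ground.

Section rescaled_equation.
Context {R : realType} (n : nat) (p q al be ga : R) (v : R -> R) (k kap : R).
Hypotheses (p1 : 1 < p) (pq : p < q) (al0 : 0 < al) (be0 : 0 <= be) (ga0 : 0 <= ga)
  (abg : al + be + ga = 1) (cv : continuous v)
  (vE : forall r, v r = step n (nlc p q al be ga) v r) (gv : ground n (nlc p q al be ga) v)
  (k0 : 0 < k) (kap0 : 0 < kap).
Hypothesis kq : k `^ (q - 1) = kap ^+ 2 * ga.
Local Notation N := n.+1.
Local Notation u := (fun x : 'rV[R]_N => k * v (kap * enorm x)).

Lemma powR_pred (a : R) : k `^ a = k * k `^ (a - 1).
Proof.
rewrite -[X in X * _]powRr1 ?ltW// -powRD ?(gt_eqF k0) ?implybT//.
by rewrite addrC subrK.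
Qed.

Lemma rescaled_pos x : 0 < u x.
Proof.
by rewrite mulr_gt0// (ground_pos n p q al be ga v p1 pq (ltW al0) be0 ga0 abg cv vE gv).
Qed.

(** The Laplacian of k v(kap |x|) has coefficient k kap^2 ga in front of v^q, and [kq] makes this
    k^q; so the critical term appears with coefficient 1. *)
Lemma rescaled_equation x : laplacian u x =
  kap ^+ 2 * al * u x - kap ^+ 2 * be * (k * v (kap * enorm x) `^ p) - u x `^ q.
Proof.
have v0 := ground_pos n p q al be ga v p1 pq (ltW al0) be0 ga0 abg cv vE gv (kap * enorm x).
rewrite (rescaled_laplacian n p q al be ga)// (fvE n p q al be ga)//.
rewrite powRM ?ltW// [k `^ q]powR_pred kq.
by move: (v _) (_ `^ p) (_ `^ q) => a b c; ring.
Qed.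

(** From (q - 1) N / 2 = 2 one gets k^2 = (k^(q-1))^(N/2) = (kap^2 ga)^(N/2), and kap disappears:
    this is the invariance of the norm at the critical power. *)
Lemma rescaled_mass : q = 1 + 4 / N%:R ->
  L2norm u = (Num.sqrt (Num.sqrt ga ^+ N * \int[lebesgue_rV N]_x (v (enorm x) ^+ 2)))%:E.
Proof.
move=> qE; rewrite (rescaled_L2norm n p q al be ga)//.
suff -> : k ^+ 2 * kap ^- N = Num.sqrt ga ^+ N by [].
have N0 : (0 : R) < N%:R by rewrite ltr0n.
have s0 : 0 <= kap * Num.sqrt ga by exact: mulr_ge0 (ltW kap0) (sqrtr_ge0 _).
have h : k ^+ 2 = (kap * Num.sqrt ga) ^+ N.
  have -> : k ^+ 2 = (k `^ (q - 1)) `^ (N%:R / 2).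
    rewrite -powRrM qE addrAC subrr add0r -powR_mulrn ?ltW//; congr (_ `^ _).
    by move: (N%:R : R) N0 => M M0; field; rewrite gt_eqF.
  have -> : k `^ (q - 1) = (kap * Num.sqrt ga) `^ 2%:R.
    by rewrite kq powR_mulrn// exprMn sqr_sqrtr.
  rewrite -powRrM -[RHS]powR_mulrn//.
  congr (_ `^ _).
  by move: (N%:R : R) => M; field.
by rewrite h exprMn mulrAC divff ?mul1r// expf_neq0// gt_eqF.
Qed.

End rescaled_equation.

Theorem lemma2 (R : realType) (d : nat) (hd : (1 <= d)%N)
    (p : R) (hp1 : 1 < p) (hp2 : p < 1 + 4 / d%:R)
    (Q : 'rV[R]_d -> R) (hQ : unique_positive_radial_solution Q) :
  forall M : R, 0 < M -> (M%:E < L2norm Q)%E ->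
  exists (omega : R) (QM : 'rV[R]_d -> R),
    [/\ 0 < omega,
        schwartz QM,
        radial QM,
        forall x, 0 <= QM x /\
          laplacian QM x - omega * QM x
          + QM x `^ (1 + 4 / d%:R) + QM x `^ p = 0
      & L2norm QM = M%:E].
Proof.
case: d hd hp2 Q hQ => [//|n] _; set q := 1 + 4 / n.+1%:R => pq Q hQ M M0 MQ.
have [a0 a00 a0P] := ground_al_bound n p q hp1 pq erefl.
have [||c [sc gc mc c1 c2]] := selection n p q hp1 pq erefl a0 a00 (M ^+ 2).
- by rewrite exprn_gt0.
- move=> c sc c11 gc.
  have [cv vE] := prof_spec n p q hp1 pq c sc; have [_ be0 ga0 abg] := par_bounds c sc.
  have al0 : 0 < c.2 := lt_le_trans a00 (a0P c sc gc).
  have c2 := ground_al_lt n p q hp1 pq c sc gc.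
  have be_0 : par_be c = 0 by rewrite /par_be c11 subrr mulr0.
  have ga1 : 0 < par_ga c by rewrite /par_ga c11 mulr1; lra.
  have q1 : 0 < q - 1 by lra.
  (* For c.1 = 1 the power p is absent; kap^2 al = 1 and k^(q-1) = kap^2 ga then turn the equation
     into that of Q. *)
  pose kap := (Num.sqrt c.2)^-1; pose k := (kap ^+ 2 * par_ga c) `^ (q - 1)^-1.
  have kap0 : 0 < kap by rewrite invr_gt0 sqrtr_gt0.
  have kap_al : kap ^+ 2 * c.2 = 1.
    by rewrite /kap exprVn sqr_sqrtr ?ltW// mulVf// gt_eqF.
  have kg : 0 < kap ^+ 2 * par_ga c by rewrite mulr_gt0 ?exprn_gt0.
  have k0 : 0 < k by exact: powR_gt0.
  have kq : k `^ (q - 1) = kap ^+ 2 * par_ga c.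
    by rewrite /k -powRrM mulVf ?gt_eqF// powRr1// ltW.
  pose u (x : 'rV[R]_n.+1) := k * prof n p q c (kap * enorm x).
  have su : schwartz u by exact: (rescaled_schwartz n p q c.2 (par_be c) (par_ga c)).
  have u0 x : 0 < u x by exact: (rescaled_pos n p q c.2 (par_be c) (par_ga c)).
  have uQ : positive_radial_solution u.
    split=> //; first exact: schwartz_H1.
      by move=> x y xy; rewrite /u xy.
    move=> phi tphi; have := green_identity u phi (proj1 su) tphi.
    (* By the pointwise equation the integrand of the weak form is phi times the Laplacian of u
       minus u times that of phi, whose integral is 0. *)
    move=> E; rewrite -[RHS]E; apply: eq_Rintegral => x _.
    rewrite (rescaled_equation n p q c.2 (par_be c) (par_ga c))// kap_al be_0 -/(u x).
    have -> : u x `^ q = u x * u x `^ (4 / n.+1%:R).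
      by rewrite (powR_pred (u x) (u0 x) q) /q addrAC subrr add0r.
    rewrite gtr0_norm//.
    by move: (u x) (u x `^ _) (laplacian _ _) (phi x) (_ `^ p) => a b e g h; ring.
  have := ae_L2norm u Q (schwartz_Lfun2 u (smooth_cont u (proj1 su)) (fun j => proj2 su j [::]))
    (proj1 (let: And4 h _ _ _ := proj1 hQ in h)) (proj2 hQ u uQ).
  rewrite (rescaled_mass n p q c.2 (par_be c) (par_ga c))// -(ground_mass n p q hp1 pq a0)//.
  move=> EQ; move: MQ; rewrite -EQ lte_fin => Ms.
  (* The square root of a negative number is 0, which M, being positive, could not be less than. *)
  have m0 : 0 <= mass n p q a0 c.
    rewrite leNgt; apply/negP => m0; move: Ms; rewrite ltr0_sqrtr// ltNge.
    by rewrite (ltW M0).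
  by rewrite -(sqr_sqrtr m0) ltr_sqr ?nnegrE ?sqrtr_ge0// ltW.
have [cv vE] := prof_spec n p q hp1 pq c sc; have [_ be0 ga0 abg] := par_bounds c sc.
have al0 : 0 < c.2 := lt_le_trans a00 (a0P c sc gc).
have [c10 c11] : 0 < c.1 /\ c.1 < 1 by apply/andP.
have be1 : 0 < par_be c by apply: mulr_gt0; lra.
have ga1 : 0 < par_ga c by apply: mulr_gt0; lra.
(* Both coefficients become 1 when k^(p-1) = kap^2 be and k^(q-1) = kap^2 ga; the quotient of the
   two conditions determines k, and the former then determines kap. *)
pose k := (par_ga c / par_be c) `^ (q - p)^-1; pose kap := Num.sqrt (k `^ (p - 1) / par_be c).
have k0 : 0 < k by rewrite powR_gt0// divr_gt0.
have kap0 : 0 < kap by rewrite sqrtr_gt0 divr_gt0// powR_gt0.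
have kap2 : kap ^+ 2 = k `^ (p - 1) / par_be c by rewrite sqr_sqrtr// divr_ge0 ?powR_ge0.
have kp : k `^ (p - 1) = kap ^+ 2 * par_be c by rewrite kap2 divfK// gt_eqF.
have kq : k `^ (q - 1) = kap ^+ 2 * par_ga c.
  have kqp : k `^ (q - p) = par_ga c / par_be c.
    by rewrite /k -powRrM mulVf ?powRr1 ?divr_ge0// gt_eqF// subr_gt0.
  rewrite kap2 mulrAC -mulrA -kqp -powRD ?(gt_eqF k0) ?implybT//.
  by congr (_ `^ _); ring.
pose u (x : 'rV[R]_n.+1) := k * prof n p q c (kap * enorm x).
have u0 x : 0 < u x by exact: (rescaled_pos n p q c.2 (par_be c) (par_ga c)).
exists (kap ^+ 2 * c.2), u; split.
- by rewrite mulr_gt0 ?exprn_gt0.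
- exact: (rescaled_schwartz n p q c.2 (par_be c) (par_ga c)).
- by move=> x y xy; rewrite /u xy.
- move=> x; split; first exact: ltW.
  rewrite (rescaled_equation n p q c.2 (par_be c) (par_ga c))// -kp -/(u x) -/q.
  have v0 := ground_pos n p q c.2 (par_be c) (par_ga c) _ hp1 pq (ltW al0) be0 ga0 abg cv vE gc
    (kap * enorm x).
  have -> : u x `^ p = k `^ (p - 1) * (k * prof n p q c (kap * enorm x) `^ p).
    by rewrite /u powRM ?ltW// [k `^ p](powR_pred k k0) mulrCA mulrA.
  by move: (_ * (k * _)) (_ * u x) (_ `^ q) => a b e; ring.
- rewrite (rescaled_mass n p q c.2 (par_be c) (par_ga c))// -(ground_mass n p q hp1 pq a0)//.
  by rewrite mc sqrtr_sqr gtr0_norm.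
Qed.
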